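(* Assume that $V \in H^2_{\mathrm{per}}(\Omega)$ is real-valued, that $\sigma \geq 1/2$, and that the exact solution $\psi$ of the nonlinear Schrödinger equation (NLSE) given in the context satisfies $\psi \in C([0, T]; H^4_{\mathrm{per}}(\Omega)) \cap C^1([0, T]; H^2(\Omega)) \cap C^2([0, T]; L^2(\Omega))$. Let $\psi_N^n$ ($n\ge0$) be the fully discrete sEWI-FS approximations with time step $\tau$ and mesh size $h$ defined in the context. Then there exist $\tau_0>0$ and $h_0>0$ sufficiently small and a constant $C>0$ independent of $\tau$, $h$ and $n$ such that for all $0<\tau<\tau_0$ and $0<h<h_0$ with $\tau\le \frac{h^2}{2\pi}$, and all integers $n$ with $0 \leq n \leq T/\tau$, $$\| \psi(\cdot, t_n) - \psi_N^n \|_{L^2} \leq C( \tau^2+h^4), \qquad \| \psi(\cdot, t_n) - \psi_N^n \|_{H^1} \leq C( \tau^{3/2}+h^3).$$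
   Context: Let $\Omega=(a,b)\subset\mathbb{R}$ be a bounded interval. For integers $m\ge1$, $H^m_{\mathrm{per}}(\Omega)=\{\phi\in H^m(\Omega): \phi^{(k)}(a)=\phi^{(k)}(b),\ k=0,\dots,m-1\}$. All functions are complex-valued unless said otherwise. NLSE: with periodic boundary conditions on $\Omega$, $i\partial_t\psi = -\Delta\psi + V\psi + f(|\psi|^2)\psi$ for $x\in\Omega$, $t>0$, and $\psi(\cdot,0)=\psi_0$, where $\Delta=\partial_{xx}$, $V$ is a given real-valued potential, and $f(\rho)=\beta\rho^\sigma$ for $\rho\ge0$ with fixed $\beta\in\mathbb{R}$ and $\sigma>0$. Let $T_{\max}$ be the maximal existence time of the solution and fix $0<T<T_{\max}$. Define $B(v)=Vv+f(|v|^2)v$. Fourier coefficients: $\widehat u_l=\frac1{b-a}\int_a^b u(x)e^{-i\mu_l(x-a)}\,dx$, $\mu_l=\frac{2\pi l}{b-a}$, $l\in\mathbb{Z}$. Operators that are functions of $\Delta$ are Fourier multipliers obtained by replacing $\Delta$ by $-\mu_l^2$. Let $\varphi_{\mathrm s}(\theta)=\frac{\sin\theta}{\theta}$ (value $1$ at $0$) and $\varphi_1(z)=\frac{e^z-1}{z}$ (value $1$ at $0$). Mesh size: $h=(b-a)/N$ with $N$ a positive even integer; $\mathcal T_N=\{-N/2,\dots,N/2-1\}$; $X_N=\mathrm{span}\{e^{i\mu_l(x-a)}:l\in\mathcal T_N\}$; $P_N:L^2(\Omega)\to X_N$ is the $L^2$-projection $(P_Nu)(x)=\sum_{l\in\mathcal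 T_N}\widehat u_l e^{i\mu_l(x-a)}$. Fully discrete sEWI-FS: for a time step $\tau>0$ and $t_n=n\tau$, $\psi_N^0=P_N\psi_0$, $\ \psi_N^1=e^{i\tau\Delta}\psi_N^0-i\tau\varphi_1(i\tau\Delta)P_NB(\psi_N^0)$, and $\psi_N^{n+1}=e^{2i\tau\Delta}\psi_N^{n-1}-2i\tau e^{i\tau\Delta}\varphi_{\mathrm s}(\tau\Delta)P_NB(\psi_N^n)$ for $n\ge1$. *)

(* Defs.v *)
From HB Require Import structures.
From mathcomp Require Import all_boot all_order all_algebra.
From mathcomp Require Import complex.
From mathcomp Require Import all_classical all_reals all_analysis.

Set Implicit Arguments.
Unset Strict Implicit.
Unset Printing Implicit Defensive.

Import Order.TTheory GRing.Theory Num.Theory.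
Import numFieldNormedType.Exports.

Local Open Scope classical_set_scope.
Local Open Scope ring_scope.
Local Open Scope complex_scope.

(** Functions on [Omega = (a, b)] are represented by functions [R -> R[i]] of
    which only the restriction to [`]a, b[] matters; elements of [L^2] and [H^m]
    are such functions up to equality a.e. on [`]a, b[], with Borel
    representatives. *)

Definition leb (R : realType) := @lebesgue_measure R.

Definition cintegral (R : realType) (a b : R) (u : R -> R[i]) : R[i] :=
  Rintegral (@leb R) `]a, b[ (fun x => complex.Re (u x))
  +i* Rintegral (@leb R) `]a, b[ (fun x => complex.Im (u x)).

Definition ae_same (R : realType) (a b : R) (u v : R -> R[i]) : Prop :=
  {ae @leb R, forall x, `]a, b[%classic x -> u x = v x}.

Definition L2 (R : realType) (a b : R) : set (R -> R[i]) :=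
  [set u : R -> R[i] |
    [/\ measurable_fun `]a, b[ (fun x => complex.Re (u x)),
        measurable_fun `]a, b[ (fun x => complex.Im (u x)) &
        (@leb R).-integrable `]a, b[
          (fun x => (Normc.normc (u x) ^+ 2)%:E)]].

Definition normL2 (R : realType) (a b : R) (u : R -> R[i]) : R :=
  Num.sqrt (Rintegral (@leb R) `]a, b[ (fun x => Normc.normc (u x) ^+ 2)).

Definition test_fun (R : realType) (a b : R) (phi : R -> R) : Prop :=
  [/\ forall x : R, derivable phi x 1,
      continuous (derive1 phi) &
      exists c d : R, [/\ a < c, d < b &
        forall x, ~~ (c <= x <= d) -> phi x = 0]].

Definition weak_deriv (R : realType) (a b : R) (u g : R -> R[i]) : Prop :=
  [/\ L2 a b u, L2 a b g &
      forall phi : R -> R, test_fun a b phi ->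
        cintegral a b (fun x => u x * (derive1 phi x)%:C)
        = - cintegral a b (fun x => g x * (phi x)%:C)].

(** A representative of the weak derivative, unique a.e. when there is one
    ([weak_deriv] tests against real-valued functions of class C^1_c(a, b), which
    by linearity amounts to complex-valued ones). *)
Definition wD (R : realType) (a b : R) (u : R -> R[i]) : R -> R[i] :=
  xget (fun=> 0) [set g : R -> R[i] | weak_deriv a b u g].

Fixpoint sobolev (R : realType) (a b : R) (m : nat) (u : R -> R[i]) : Prop :=
  if m is m'.+1 then exists g, weak_deriv a b u g /\ sobolev a b m' g
  else L2 a b u.

Definition normH (R : realType) (a b : R) (m : nat) (u : R -> R[i]) : R :=
  Num.sqrt (\sum_(k < m.+1) normL2 a b (iter k (wD a b) u) ^+ 2).

(** The representative of [u] that is continuous on [[a, b]] (unique on [[a, b]]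
    when there is one, as for [u] in H^1); boundary values are read off it. *)
Definition cont_rep (R : realType) (a b : R) (u : R -> R[i]) : R -> R[i] :=
  xget u [set w : R -> R[i] |
    [/\ {within `[a, b], continuous (fun x => complex.Re (w x))},
        {within `[a, b], continuous (fun x => complex.Im (w x))} &
        ae_same a b w u]].

Definition Hper (R : realType) (a b : R) (m : nat) : set (R -> R[i]) :=
  [set u : R -> R[i] | sobolev a b m u /\
    forall k, (k < m)%N ->
      cont_rep a b (iter k (wD a b) u) a = cont_rep a b (iter k (wD a b) u) b].

Definition curve_continuous (R : realType) (X : set (R -> R[i]))
    (nrm : (R -> R[i]) -> R) (J : set R) (u : R -> R -> R[i]) : Prop :=
  (forall t, J t -> X (u t)) /\
  (forall t, J t ->
    nrm (fun x => u s x - u t x) @[s --> within J (nbhs t)] --> (0 : R)).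

(** [v] is the derivative of [u] for [nrm], one-sided at end points of [J]. *)
Definition curve_deriv (R : realType) (nrm : (R -> R[i]) -> R) (J : set R)
    (u v : R -> R -> R[i]) : Prop :=
  forall t, J t ->
    nrm (fun x => ((s - t)^-1)%:C * (u s x - u t x) - v t x)
      @[s --> within J t^'] --> (0 : R).

(** C^k(J; X), where [nrm] is the norm of [X]. *)
Fixpoint curve_C (R : realType) (k : nat) (X : set (R -> R[i]))
    (nrm : (R -> R[i]) -> R) (J : set R) (u : R -> R -> R[i]) : Prop :=
  curve_continuous X nrm J u /\
  (if k is k'.+1 then
     exists v, curve_deriv nrm J u v /\ curve_C k' X nrm J v
   else True).

Definition nlf (R : realType) (beta sigma rho : R) : R := beta * rho `^ sigma.

Definition opB (R : realType) (V : R -> R) (beta sigma : R) (v : R -> R[i])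
    (x : R) : R[i] :=
  (V x)%:C * v x + (nlf beta sigma (Normc.normc (v x) ^+ 2))%:C * v x.

(** Strong solutions in C(J; H^2_per) /\ C^1(J; L^2); the periodic boundary
    conditions are part of H^2_per. By persistence of regularity in dimension 1,
    the maximal existence time is the same as for H^1_per solutions. *)
Definition nlse_solution (R : realType) (a b : R) (V : R -> R) (beta sigma : R)
    (psi0 : R -> R[i]) (J : set R) (psi : R -> R -> R[i]) : Prop :=
  [/\ curve_C 0 (Hper a b 2) (normH a b 2) J psi,
      L2 a b psi0,
      ae_same a b (psi 0) psi0 &
      exists psit : R -> R -> R[i],
        [/\ curve_C 0 (L2 a b) (normL2 a b) J psit,
            curve_deriv (normL2 a b) J psi psit &
            forall t, J t -> 0 < t ->
              ae_same a b (fun x => 'i%C * psit t x)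
                (fun x => - wD a b (wD a b (psi t)) x
                          + opB V beta sigma (psi t) x)]].

Definition time_interval (R : realType) (S : \bar R) : set R :=
  [set t : R | 0 <= t /\ (t%:E < S)%E].

Definition maximal_solution (R : realType) (a b : R) (V : R -> R)
    (beta sigma : R) (psi0 : R -> R[i]) (Tmax : \bar R)
    (psi : R -> R -> R[i]) : Prop :=
  nlse_solution a b V beta sigma psi0 (time_interval Tmax) psi /\
  forall (S : \bar R) (chi : R -> R -> R[i]),
    nlse_solution a b V beta sigma psi0 (time_interval S) chi -> (S <= Tmax)%E.

Definition cexp (R : realType) (z : R[i]) : R[i] :=
  (expR (complex.Re z))%:C * (cos (complex.Im z) +i* sin (complex.Im z)).

Definition phi_s (R : realType) (theta : R) : R :=
  if theta == 0 then 1 else sin theta / theta.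

Definition phi_1 (R : realType) (z : R[i]) : R[i] :=
  if z == 0 then 1 else (cexp z - 1) / z.

Definition freq (R : realType) (a b : R) (l : int) : R :=
  2 * pi * l%:~R / (b - a).

Definition fmode (R : realType) (a b : R) (l : int) (x : R) : R[i] :=
  cexp ('i%C * (freq a b l * (x - a))%:C).

Definition fcoef (R : realType) (a b : R) (u : R -> R[i]) (l : int) : R[i] :=
  ((b - a)^-1)%:C *
  cintegral a b (fun x => u x * cexp (- ('i%C * (freq a b l * (x - a))%:C))).

(** The [j]-th element of T_N = {-N/2, ..., N/2 - 1}, for even [N]. *)
Definition TN (N : nat) (j : 'I_N) : int := j%:Z - (N./2)%:Z.

Definition PN (R : realType) (a b : R) (N : nat) (u : R -> R[i]) (x : R) : R[i] :=
  \sum_(j < N) fcoef a b u (TN j) * fmode a b (TN j) x.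

(** The operator [m(Delta)] on X_N, where the Fourier series is the finite sum
    over T_N; [m] is evaluated at the symbol [- mu_l ^ 2] of [Delta].
    It is only applied to elements of X_N. *)
Definition fmult (R : realType) (a b : R) (N : nat) (m : R -> R[i])
    (u : R -> R[i]) (x : R) : R[i] :=
  \sum_(j < N)
    m (- freq a b (TN j) ^+ 2) * fcoef a b u (TN j) * fmode a b (TN j) x.

Fixpoint sEWI (R : realType) (a b : R) (V : R -> R) (beta sigma : R)
    (psi0 : R -> R[i]) (N : nat) (tau : R) (n : nat) : R -> R[i] :=
  let B := opB V beta sigma in
  match n with
  | 0 => PN a b N psi0
  | n1.+1 =>
    let v := sEWI a b V beta sigma psi0 N tau n1 in
    match n1 with
    | 0 => fun x =>
        fmult a b N (fun d => cexp ('i%C * (tau * d)%:C)) v x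
        - 'i%C * tau%:C *
          fmult a b N (fun d => phi_1 ('i%C * (tau * d)%:C)) (PN a b N (B v)) x
    | n2.+1 =>
      let w := sEWI a b V beta sigma psi0 N tau n2 in
      fun x =>
        fmult a b N (fun d => cexp ('i%C * (2 * tau * d)%:C)) w x
        - 2 * 'i%C * tau%:C *
          fmult a b N (fun d => cexp ('i%C * (tau * d)%:C))
            (fmult a b N (fun d => (phi_s (tau * d))%:C) (PN a b N (B v))) x
    end
  end.

(* Main.v *)
Require Import Defs.
From HB Require Import structures.
From mathcomp Require Import all_boot all_order all_algebra.
From mathcomp Require Import complex.
From mathcomp Require Import all_classical all_reals all_analysis.
From mathcomp Require Import measurable_realfun ring lra zify.

(** The estimate is made on Fourier coefficients. Let [c] and [g] be the coefficients
    of the solution and of its nonlinear term at the frequency [mu], and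
    [w = mu ^ 2]. The equation reads [i c' = w c + g], and Duhamel's formula over
    [[t - tau, t + tau]] gives one step of the scheme exactly, except that the
    scheme freezes [g] at the middle [t]. The derivative in [s] of the resulting
    defect on [[t - s, t + s]] is
    [- i cos (w s) (g (t + s) - 2 g t + g (t - s)) + sin (w s) (g (t + s) - g (t - s))].
    The first term is of order [s ^ 2]; the second one is only of order [s], and
    adding up its contributions naively over all the steps would leave a global
    error of order [tau].

    The gain comes from the sum over the time levels of the same parity. In the
    frame that rotates with the free flow, the defects are added with weights
    [exp (i tau w k)], and two consecutive weights differ by the factor
    [exp (2 i tau w)]. The step size restriction gives [tau w <= pi / 2] for
    all the frequencies of the scheme, so that this factor stays away from 1 at
    the rate [tau w / 2] ([damped_geometric]); the partial sums of the weights,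
    multiplied by [sin (w s)], are bounded uniformly in [w]. Summation by parts
    ([ell_abel]) then trades the first differences of [g] for second differences,
    and the accumulated defect is of order [tau ^ 2] ([two_step_defect]). Integrals
    in time are avoided throughout: a curve is estimated by the mean value theorem
    for its pairing with a fixed vector ([ell_growth], [curve_lipschitz]).

    The second differences of [g] are controlled by those of the solution, which is
    twice differentiable in L2, through a bound on the mixed second differences of
    the power nonlinearity ([par_opB]); with [sigma >= 1 / 2] its second derivatives
    are bounded on bounded sets, which is proved for a regularized power and passes
    to the limit.

    Stability ([error_recursion], [discrete_gronwall]) is Gronwall's inequality in
    the rotating frame, where the linear part is an isometry. The nonlinearity is
    only locally Lipschitz; the numerical solution is bounded in the same induction,
    because the sum of the errors of its coefficients is at most [N] times their
    l^2 error, that is of order [h ^ 3] ([coefficient_error]).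

    In space, the projection error of a function of H^4_per is of order [h ^ 4], and
    that of its derivative of order [h ^ 3] ([proj_error_per], [wD_PN_error]). The
    tail of the Fourier series is bounded by Bessel's inequality; that the series
    converges to the function follows from pointwise convergence for Lipschitz
    functions ([PN_cvg]) and Fatou's lemma. On trigonometric polynomials a derivative
    costs a factor [pi / h], and [tau ^ 2 / h] is at most [tau ^ (3 / 2)] when
    [tau <= h ^ 2] ([error_split], [error_rates]).

    Periodicity enters through integration by parts for weak derivatives, which needs
    the continuous representative of a weakly differentiable function. It is
    obtained by testing with C^1 splines that approximate the indicator of the
    interval between two Lebesgue points ([wk_ftc]). *)

Set Implicit Arguments.
Unset Strict Implicit.
Unset Printing Implicit Defensive.

Import Order.TTheory GRing.Theory Num.Theory.
Import numFieldNormedType.Exports.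

Local Open Scope classical_set_scope.
Local Open Scope ring_scope.
Local Open Scope complex_scope.


(** * Square-integrable functions on a bounded interval *)

Section AlmostEverywhere.
Context (R : realType).
Implicit Types P Q : R -> Prop.

Lemma ae_mono P Q : (forall x, P x -> Q x) ->
  {ae @leb R, forall x, P x} -> {ae @leb R, forall x, Q x}.
Proof. exact: (@filterS _ _ (ae_filter_ringOfSetsType (@lebesgue_measure R))). Qed.

Lemma ae_all P : (forall x, P x) -> {ae @leb R, forall x, P x}.
Proof. exact: (@aeW _ _ _ (@lebesgue_measure R)). Qed.

Lemma ae_and P Q : {ae @leb R, forall x, P x} -> {ae @leb R, forall x, Q x} ->
  {ae @leb R, forall x, P x /\ Q x}.
Proof. exact: (@filterI _ _ (ae_filter_ringOfSetsType (@lebesgue_measure R))). Qed.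

Lemma ae_and_mono P Q S : (forall x, P x -> Q x -> S x) ->
  {ae @leb R, forall x, P x} -> {ae @leb R, forall x, Q x} ->
  {ae @leb R, forall x, S x}.
Proof. by move=> H p q; apply: ae_mono (ae_and p q) => x []; exact: H. Qed.

End AlmostEverywhere.

Section RealIntegral.
Context (R : realType) (a b : R).
Local Notation D := (`]a, b[%classic : set R).
Local Notation mu := (@leb R).
Implicit Types (f g h : R -> R) (M c : R).

Definition itg f := mu.-integrable D (EFin \o f).
Definition intg f : R := Rintegral mu D f.
Definition sq f := measurable_fun D f /\ itg (fun x => f x ^+ 2).

Lemma mD : measurable D.
Proof. exact: measurable_itv. Qed.
Hint Resolve mD : core.

Lemma muD : a < b -> mu D = (b - a)%:E.
Proof. by move=> ab; rewrite /leb lebesgue_measure_itv/= lte_fin ab EFinB. Qed.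

Lemma muD_fin : (mu D < +oo)%E.
Proof.
rewrite /leb lebesgue_measure_itv/=; case: ifP => // _.
by rewrite -EFinB ltry.
Qed.

Lemma itg_meas f : itg f -> measurable_fun D f.
Proof. by move/measurable_int => /measurable_EFinP. Qed.

Lemma eq_itg f g : (forall x, D x -> f x = g x) -> itg f -> itg g.
Proof.
move=> fg; apply: eq_integrable => // x; rewrite inE => Dx /=.
by rewrite fg.
Qed.

Lemma eq_intg f g : (forall x, D x -> f x = g x) -> intg f = intg g.
Proof. by move=> fg; apply: eq_Rintegral => x; rewrite inE; exact: fg. Qed.

Lemma itg_bounded f M : measurable_fun D f ->
  (forall x, D x -> `|f x| <= M) -> itg f.
Proof.
move=> mf fM; apply: measurable_bounded_integrable => //; first exact: muD_fin.
exists M; split; first exact: num_real.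
by move=> y My x Dx; apply: le_trans (fM x Dx) (ltW My).
Qed.

Lemma itg_le f g : measurable_fun D f -> itg g ->
  (forall x, D x -> `|f x| <= g x) -> itg f.
Proof.
move=> mf ig fg; apply: (@le_integrable _ _ _ mu D mD _ (EFin \o g)) => //.
  exact/measurable_EFinP.
move=> x Dx /=; rewrite lee_fin (le_trans (fg x Dx))//; exact: ler_norm.
Qed.

Lemma itgD f g : itg f -> itg g -> itg (fun x => f x + g x).
Proof. by move=> i j; have := @integrableD _ _ _ mu D mD _ _ i j; exact: eq_integrable. Qed.

Lemma itgZ c f : itg f -> itg (fun x => c * f x).
Proof. by move=> i; have := @integrableZl _ _ _ mu D mD c _ i; exact: eq_integrable. Qed.

Lemma itgN f : itg f -> itg (fun x => - f x).
Proof. by move=> i; apply: eq_itg (itgZ (-1) i) => x _; rewrite mulN1r. Qed.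

Lemma itgB f g : itg f -> itg g -> itg (fun x => f x - g x).
Proof. by move=> i j; exact: itgD i (itgN j). Qed.

Lemma itg_norm f : itg f -> itg (fun x => `|f x|).
Proof. exact: integrable_norm. Qed.

Lemma itg_cst c : itg (fun=> c).
Proof. by apply: (@itg_bounded _ `|c|) => //. Qed.

Lemma itg_sum n (f : 'I_n -> R -> R) : (forall i, itg (f i)) ->
  itg (fun x => \sum_i f i x).
Proof.
move=> H; have := @integrable_sum _ _ _ mu _ mD _ (index_enum _) xpredT
  (fun i => EFin \o f i) (fun i _ => H i).
by apply: eq_integrable => // x _ /=; rewrite -sumEFin.
Qed.

Lemma intgD f g : itg f -> itg g ->
  intg (fun x => f x + g x) = intg f + intg g.
Proof. exact: (@RintegralD _ _ _ mu D). Qed.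

Lemma intgB f g : itg f -> itg g ->
  intg (fun x => f x - g x) = intg f - intg g.
Proof. exact: (@RintegralB _ _ _ mu). Qed.

Lemma intgZ c f : itg f -> intg (fun x => c * f x) = c * intg f.
Proof. exact: (@RintegralZl _ _ _ mu). Qed.

Lemma intgN f : itg f -> intg (fun x => - f x) = - intg f.
Proof.
by move=> i; rewrite -mulN1r -intgZ//; apply: eq_intg => x _; rewrite mulN1r.
Qed.

Lemma intg_cst c : a < b -> intg (fun=> c) = c * (b - a).
Proof. move=> ab; rewrite /intg /Rintegral.
rewrite (_ : (\int[mu]_(x in D) c%:E)%E = (c%:E * mu D)%E); last first.
  by rewrite -(@integral_cst _ _ _ mu D mD c%:E).
by rewrite muD. Qed.

Lemma intg0 : intg (fun=> 0) = 0.
Proof. by rewrite /intg Rintegral_cst// mul0r. Qed.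

Lemma intg_sum n (f : 'I_n -> R -> R) : (forall i, itg (f i)) ->
  intg (fun x => \sum_i f i x) = \sum_i intg (f i).
Proof.
elim: n f => [|n IH] f H.
  by rewrite big_ord0 -[RHS]intg0; apply: eq_intg => x _; rewrite big_ord0.
rewrite big_ord_recl -IH// -intgD//; last exact: itg_sum.
by apply: eq_intg => x _; rewrite big_ord_recl.
Qed.

Lemma intg_ge0 f : (forall x, D x -> 0 <= f x) -> 0 <= intg f.
Proof. exact: (@Rintegral_ge0 _ _ _ mu). Qed.

Lemma le_intg f g : itg f -> itg g -> (forall x, D x -> f x <= g x) ->
  intg f <= intg g.
Proof. exact: (@le_Rintegral _ _ _ mu). Qed.

Lemma le_norm_intg f : itg f -> `|intg f| <= intg (fun x => `|f x|).
Proof. exact: (@le_normr_Rintegral _ _ _ mu). Qed.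

Lemma ae_eq_intg f g : measurable_fun D f -> measurable_fun D g ->
  {ae mu, forall x, D x -> f x = g x} -> intg f = intg g.
Proof.
move=> mf mg fg; rewrite /intg /Rintegral; congr fine.
apply: ae_eq_integral => //; [exact/measurable_EFinP|exact/measurable_EFinP|].
by apply: ae_mono fg => x H Dx; rewrite H.
Qed.

Lemma ae_itg f g : measurable_fun D g ->
  {ae mu, forall x, D x -> f x = g x} -> itg f -> itg g.
Proof.
move=> mg fg /[dup] /itg_meas mf /integrableP[_ fi]; apply/integrableP; split.
  exact/measurable_EFinP.
rewrite (_ : (\int[mu]_(x in D) `|(EFin \o g) x|)%E =
  (\int[mu]_(x in D) `|(EFin \o f) x|)%E)//.
apply: ae_eq_integral => //.
- by apply: measurableT_comp => //; exact/measurable_EFinP.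
- by apply: measurableT_comp => //; exact/measurable_EFinP.
- by apply: ae_mono fg => x H Dx /=; rewrite H.
Qed.

Lemma sq_meas f : sq f -> measurable_fun D f. Proof. by case. Qed.

Lemma eq_sq f g : (forall x, D x -> f x = g x) -> sq f -> sq g.
Proof.
move=> fg [mf f2]; split.
  by apply: eq_measurable_fun mf => x; rewrite inE => Dx; rewrite fg.
by apply: eq_itg f2 => x Dx; rewrite fg.
Qed.

Lemma sqM f g : sq f -> sq g -> itg (fun x => f x * g x).
Proof.
move=> [mf f2] [mg g2]; apply: itg_le (itgD f2 g2) _.
  exact: measurable_funM.
move=> x _; rewrite normrM -[f x ^+ 2]real_normK ?num_real//.
rewrite -[g x ^+ 2]real_normK ?num_real//.
have := sqr_ge0 (`|f x| - `|g x|).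
have := mulr_ge0 (normr_ge0 (f x)) (normr_ge0 (g x)).
by nra.
Qed.

Lemma sq_bounded f M : measurable_fun D f ->
  (forall x, D x -> `|f x| <= M) -> sq f.
Proof.
move=> mf fM; split => //; apply: (@itg_bounded _ (M ^+ 2)).
  exact: measurable_funX.
move=> x Dx; rewrite normrX lerXn2r// ?nnegrE ?fM// (le_trans _ (fM x Dx))//.
Qed.

Lemma sq_cst c : sq (fun=> c).
Proof. by apply: (@sq_bounded _ `|c|). Qed.

Lemma sq_itg f : sq f -> itg f.
Proof. by move=> sf; apply: eq_itg (sqM sf (sq_cst 1)) => x _; rewrite mulr1. Qed.

Lemma sqD f g : sq f -> sq g -> sq (fun x => f x + g x).
Proof.
move=> sf sg; split; first exact: measurable_funD sf.1 sg.1.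
apply: eq_itg (itgD (itgD sf.2 sg.2) (itgZ 2 (sqM sf sg))) => x _; ring.
Qed.

Lemma sqZ c f : sq f -> sq (fun x => c * f x).
Proof.
move=> sf; split; first exact: measurable_funM (@measurable_cst _ _ _ _ _ _) sf.1.
by apply: eq_itg (itgZ (c ^+ 2) sf.2) => x _; ring.
Qed.

Lemma sqN f : sq f -> sq (fun x => - f x).
Proof.
move=> sf; split; first exact: measurableT_comp sf.1.
by apply: eq_itg sf.2 => x _; rewrite sqrrN.
Qed.

Lemma sqB f g : sq f -> sq g -> sq (fun x => f x - g x).
Proof. by move=> sf sg; exact: sqD sf (sqN sg). Qed.

Lemma sq_le f g : measurable_fun D f -> sq g ->
  (forall x, D x -> `|f x| <= `|g x|) -> sq f.
Proof.
move=> mf sg fg; split => //; apply: itg_le sg.2 _.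
  exact: measurable_funX.
move=> x Dx; rewrite normrX -[g x ^+ 2]ger0_norm ?sqr_ge0// normrX.
by rewrite lerXn2r ?nnegrE ?fg.
Qed.

Lemma sqMb f h (M : R) : sq f -> measurable_fun D h ->
  (forall x, D x -> `|h x| <= M) -> sq (fun x => h x * f x).
Proof.
move=> sf mh hM; apply: sq_le (sqZ M sf) _.
  exact: measurable_funM mh sf.1.
by move=> x Dx; rewrite !normrM ler_wpM2r// (le_trans (hM x Dx))// ler_norm.
Qed.

Lemma ae_sq f g : measurable_fun D g ->
  {ae mu, forall x, D x -> f x = g x} -> sq f -> sq g.
Proof.
move=> mg fg [mf f2]; split => //; apply: ae_itg f2.
  exact: measurable_funX.
by apply: ae_mono fg => x H Dx; rewrite H.
Qed.

End RealIntegral.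
#[global] Hint Resolve mD : core.


(** The discriminant criterion in a form that includes [C = 0], where
    nonnegativity forces [B = 0]. *)
Lemma quad_disc (R : realFieldType) (A B C : R) : 0 <= C ->
  (forall x, 0 <= A + 2 * x * B + x ^+ 2 * C) -> B ^+ 2 <= A * C.
Proof.
move=> C0 H; have [C00|C00] := eqVneq C 0; last first.
  have Cgt : 0 < C by rewrite lt_neqAle eq_sym C00.
  have := H (- B / C).
  have -> : A + 2 * (- B / C) * B + (- B / C) ^+ 2 * C = (A * C - B ^+ 2) / C.
    by field.
  by rewrite pmulr_lge0 ?invr_gt0// subr_ge0.
have [->|B0] := eqVneq B 0; first by rewrite C00 mulr0 expr0n.
have := H (- (A + 1) / (2 * B)); rewrite C00 mulr0 addr0.
have -> : A + 2 * (- (A + 1) / (2 * B)) * B = -1 by field.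
by rewrite ler0N1.
Qed.

Section RealIntegralCS.
Context (R : realType) (a b : R).

(** The integral of the square of [f + x g] is a nonnegative quadratic in [x]. *)
Lemma intg_CS (f g : R -> R) : sq a b f -> sq a b g ->
  intg a b (fun x => f x * g x) ^+ 2 <=
  intg a b (fun x => f x ^+ 2) * intg a b (fun x => g x ^+ 2).
Proof.
move=> sf sg; apply: quad_disc; first by apply: intg_ge0 => x _; exact: sqr_ge0.
move=> x; have sfg := sqM sf sg.
have := @intg_ge0 _ a b (fun z => (f z + x * g z) ^+ 2)
  (fun z _ => sqr_ge0 _).
suff -> : intg a b (fun z => (f z + x * g z) ^+ 2) =
  intg a b (fun x0 => f x0 ^+ 2) + 2 * x * intg a b (fun x0 => f x0 * g x0)
  + x ^+ 2 * intg a b (fun x0 => g x0 ^+ 2) by [].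
rewrite -(intgZ (2 * x) sfg) -(intgZ (x ^+ 2) sg.2).
have I := itgD sf.2 (itgZ (2 * x) sfg).
rewrite -(intgD sf.2 (itgZ (2 * x) sfg)) -(intgD I (itgZ (x ^+ 2) sg.2)).
by apply: eq_intg => z _; ring.
Qed.

End RealIntegralCS.

(** * The space L2 of complex functions *)

Section ComplexL2.
Context (R : realType) (a b : R).
Local Notation D := (`]a, b[%classic : set R).
Local Notation mu := (@leb R).
Local Notation C := R[i].
Local Notation re := (@complex.Re R).
Local Notation im := (@complex.Im R).
Implicit Types u v w : R -> C.

Lemma normc_sqr (z : C) : Normc.normc z ^+ 2 = re z ^+ 2 + im z ^+ 2.
Proof. by case: z => x y /=; rewrite sqr_sqrtr// addr_ge0 ?sqr_ge0. Qed.

Lemma normc_ge0 (z : C) : 0 <= Normc.normc z.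
Proof. by case: z => x y /=; exact: sqrtr_ge0. Qed.

Lemma re_le_normc (z : C) : `|re z| <= Normc.normc z.
Proof.
rewrite -(@ler_pXn2r _ 2)// ?nnegrE ?normc_ge0// normc_sqr -normrX.
by rewrite ger0_norm ?sqr_ge0// lerDl sqr_ge0.
Qed.

Lemma im_le_normc (z : C) : `|im z| <= Normc.normc z.
Proof.
rewrite -(@ler_pXn2r _ 2)// ?nnegrE ?normc_ge0// normc_sqr -normrX.
by rewrite ger0_norm ?sqr_ge0// lerDr sqr_ge0.
Qed.

Lemma normc_le (z : C) : Normc.normc z <= `|re z| + `|im z|.
Proof.
rewrite -(@ler_pXn2r _ 2)// ?nnegrE ?normc_ge0 ?addr_ge0// normc_sqr.
rewrite -[re z ^+ 2]real_normK ?num_real// -[im z ^+ 2]real_normK ?num_real//.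
have := mulr_ge0 (normr_ge0 (re z)) (normr_ge0 (im z)); nra.
Qed.

Lemma reD (z w : C) : re (z + w) = re z + re w. Proof. by case: z; case: w. Qed.
Lemma imD (z w : C) : im (z + w) = im z + im w. Proof. by case: z; case: w. Qed.
Lemma reN (z : C) : re (- z) = - re z. Proof. by case: z. Qed.
Lemma imN (z : C) : im (- z) = - im z. Proof. by case: z. Qed.
Lemma reB (z w : C) : re (z - w) = re z - re w. Proof. by rewrite reD reN. Qed.
Lemma imB (z w : C) : im (z - w) = im z - im w. Proof. by rewrite imD imN. Qed.
Lemma reM (z w : C) : re (z * w) = re z * re w - im z * im w.
Proof. by case: z; case: w. Qed.
Lemma imM (z w : C) : im (z * w) = re z * im w + im z * re w.
Proof. by case: z; case: w. Qed.
Lemma re_sum (I : Type) (s : seq I) (P : pred I) (F : I -> C) :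
  re (\sum_(i <- s | P i) F i) = \sum_(i <- s | P i) re (F i).
Proof. by apply: (big_morph re reD). Qed.
Lemma im_sum (I : Type) (s : seq I) (P : pred I) (F : I -> C) :
  im (\sum_(i <- s | P i) F i) = \sum_(i <- s | P i) im (F i).
Proof. by apply: (big_morph im imD). Qed.
Lemma complex_ext (z w : C) : re z = re w -> im z = im w -> z = w.
Proof. by case: z => ? ?; case: w => ? ? /= -> ->. Qed.

(** Questions of integrability are settled on real and imaginary parts. *)
Lemma L2_parts u : L2 a b u <->
  sq a b (fun x => re (u x)) /\ sq a b (fun x => im (u x)).
Proof.
split=> [[mr mi iu]|[[mr ir] [mi ii]]].
  have H (f : R -> R) : measurable_fun D f ->
      (forall x, `|f x| <= Normc.normc (u x)) -> sq a b f.
    move=> mf fu; split => //; apply: (itg_le _ iu).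
      exact: measurable_funX.
    by move=> x _; rewrite normrX lerXn2r ?nnegrE ?normc_ge0.
  by split; apply: H => // x; [exact: re_le_normc|exact: im_le_normc].
split => //; apply: eq_itg (itgD ir ii) => x _ /=.
by rewrite normc_sqr.
Qed.

Lemma L2_re u : L2 a b u -> sq a b (fun x => re (u x)).
Proof. by case/L2_parts. Qed.
Lemma L2_im u : L2 a b u -> sq a b (fun x => im (u x)).
Proof. by case/L2_parts. Qed.

Lemma L2_eq u v : (forall x, D x -> u x = v x) -> L2 a b u -> L2 a b v.
Proof.
move=> uv [mr mi i]; split.
- apply: eq_measurable_fun mr => x; rewrite inE => Dx; by rewrite uv.
- apply: eq_measurable_fun mi => x; rewrite inE => Dx; by rewrite uv.
- by apply: eq_itg i => x Dx; rewrite uv.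
Qed.

Lemma L2D u v : L2 a b u -> L2 a b v -> L2 a b (fun x => u x + v x).
Proof.
move=> /L2_parts[ur ui] /L2_parts[vr vi]; apply/L2_parts; split.
  by apply: eq_sq (sqD ur vr) => x _; rewrite reD.
by apply: eq_sq (sqD ui vi) => x _; rewrite imD.
Qed.

Lemma L2Z (c : C) u : L2 a b u -> L2 a b (fun x => c * u x).
Proof.
move=> /L2_parts[ur ui]; apply/L2_parts; split.
  by apply: eq_sq (sqB (sqZ (re c) ur) (sqZ (im c) ui)) => x _; rewrite reM.
by apply: eq_sq (sqD (sqZ (re c) ui) (sqZ (im c) ur)) => x _; rewrite imM.
Qed.

Lemma L2N u : L2 a b u -> L2 a b (fun x => - u x).
Proof. by move=> H; apply: L2_eq (L2Z (-1) H) => x _; rewrite mulN1r. Qed.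

Lemma L2B u v : L2 a b u -> L2 a b v -> L2 a b (fun x => u x - v x).
Proof. by move=> H K; exact: L2D H (L2N K). Qed.

Lemma L2_bounded u (M : R) : measurable_fun D (fun x => re (u x)) ->
  measurable_fun D (fun x => im (u x)) ->
  (forall x, D x -> Normc.normc (u x) <= M) -> L2 a b u.
Proof.
move=> mr mi uM; apply/L2_parts; split; apply: (@sq_bounded _ _ _ _ M) => //.
  by move=> x Dx; apply: le_trans (uM x Dx); exact: re_le_normc.
by move=> x Dx; apply: le_trans (uM x Dx); exact: im_le_normc.
Qed.

Lemma L2_cst (c : C) : L2 a b (fun=> c).
Proof. exact: (@L2_bounded _ (Normc.normc c)). Qed.

Lemma L2_sum n (F : 'I_n -> R -> C) : (forall i, L2 a b (F i)) ->
  L2 a b (fun x => \sum_i F i x).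
Proof.
elim: n F => [|n IH] F H.
  by apply: L2_eq (L2_cst 0) => x _; rewrite big_ord0.
have /(L2D (H ord0)) := IH (fun i => F (lift ord0 i)) (fun i => H _).
by apply: L2_eq => x _; rewrite big_ord_recl.
Qed.

Lemma L2_mulb u v (M : R) : L2 a b u ->
  measurable_fun D (fun x => re (v x)) -> measurable_fun D (fun x => im (v x)) ->
  (forall x, D x -> Normc.normc (v x) <= M) -> L2 a b (fun x => v x * u x).
Proof.
move=> /L2_parts[ur ui] mr mi vM; apply/L2_parts.
have rM x : D x -> `|re (v x)| <= M.
  by move=> Dx; apply: le_trans (vM x Dx); exact: re_le_normc.
have iM x : D x -> `|im (v x)| <= M.
  by move=> Dx; apply: le_trans (vM x Dx); exact: im_le_normc.
split.
  by apply: eq_sq (sqB (sqMb ur mr rM) (sqMb ui mi iM)) => x _; rewrite reM.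
by apply: eq_sq (sqD (sqMb ui mr rM) (sqMb ur mi iM)) => x _; rewrite imM.
Qed.

Lemma ae_sameP u v : ae_same a b u v ->
  {ae mu, forall x, D x -> re (u x) = re (v x)} /\
  {ae mu, forall x, D x -> im (u x) = im (v x)}.
Proof. by move=> uv; split; apply: ae_mono uv => x H Dx; rewrite H. Qed.

Lemma L2_ae u v : measurable_fun D (fun x => re (v x)) ->
  measurable_fun D (fun x => im (v x)) -> ae_same a b u v ->
  L2 a b u -> L2 a b v.
Proof.
move=> mr mi /ae_sameP[ar ai] /L2_parts[ur ui]; apply/L2_parts.
by split; [apply: ae_sq ur|apply: ae_sq ui].
Qed.

(** The real inner product underlying [normL2]. *)
Definition ip u v : R :=
  intg a b (fun x => re (u x) * re (v x) + im (u x) * im (v x)).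

Lemma ip_itg u v : L2 a b u -> L2 a b v ->
  itg a b (fun x => re (u x) * re (v x) + im (u x) * im (v x)).
Proof.
by move=> /L2_parts[ur ui] /L2_parts[vr vi]; apply: itgD; exact: sqM.
Qed.

Lemma ipC u v : ip u v = ip v u.
Proof. by apply: eq_intg => x _; congr (_ + _); rewrite mulrC. Qed.

Lemma ipDl u v w : L2 a b u -> L2 a b v -> L2 a b w ->
  ip (fun x => u x + v x) w = ip u w + ip v w.
Proof.
move=> hu hv hw; rewrite -(intgD (ip_itg hu hw) (ip_itg hv hw)).
by apply: eq_intg => x _; rewrite reD imD; ring.
Qed.

Lemma ipZl (c : R) u w : L2 a b u -> L2 a b w ->
  ip (fun x => c%:C * u x) w = c * ip u w.
Proof.
move=> hu hw; rewrite -(intgZ c (ip_itg hu hw)).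
by apply: eq_intg => x _; rewrite reM imM /=; ring.
Qed.

Lemma ipBl u v w : L2 a b u -> L2 a b v -> L2 a b w ->
  ip (fun x => u x - v x) w = ip u w - ip v w.
Proof.
move=> hu hv hw; rewrite -(intgB (ip_itg hu hw) (ip_itg hv hw)).
by apply: eq_intg => x _; rewrite reB imB; ring.
Qed.

Lemma ipDr u v w : L2 a b u -> L2 a b v -> L2 a b w ->
  ip w (fun x => u x + v x) = ip w u + ip w v.
Proof. by move=> hu hv hw; rewrite ipC ipDl// !(ipC w). Qed.

Lemma ipZr (c : R) u w : L2 a b u -> L2 a b w ->
  ip w (fun x => c%:C * u x) = c * ip w u.
Proof. by move=> hu hw; rewrite ipC ipZl// (ipC w). Qed.

Lemma ipBr u v w : L2 a b u -> L2 a b v -> L2 a b w ->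
  ip w (fun x => u x - v x) = ip w u - ip w v.
Proof. by move=> hu hv hw; rewrite ipC ipBl// !(ipC w). Qed.

Lemma ip_suml n (F : 'I_n -> R -> C) w : (forall i, L2 a b (F i)) -> L2 a b w ->
  ip (fun x => \sum_i F i x) w = \sum_i ip (F i) w.
Proof.
move=> HF hw; rewrite -intg_sum; last by move=> i; exact: ip_itg.
apply: eq_intg => x _; rewrite re_sum im_sum !mulr_suml -big_split /=.
by [].
Qed.

Lemma ip_ge0 u : 0 <= ip u u.
Proof. by apply: intg_ge0 => x _; rewrite addr_ge0// -expr2 sqr_ge0. Qed.

Lemma normL2_ip u : normL2 a b u = Num.sqrt (ip u u).
Proof.
by congr Num.sqrt; apply: eq_intg => x _; rewrite normc_sqr !expr2.
Qed.

Lemma normL2_ge0 u : 0 <= normL2 a b u. Proof. exact: sqrtr_ge0. Qed.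

Lemma normL2_sqr u : normL2 a b u ^+ 2 = ip u u.
Proof. by rewrite normL2_ip sqr_sqrtr// ip_ge0. Qed.

Lemma ip_CS u v : L2 a b u -> L2 a b v ->
  `|ip u v| <= normL2 a b u * normL2 a b v.
Proof.
move=> hu hv; rewrite -(@ler_pXn2r _ 2)// ?nnegrE ?mulr_ge0 ?normL2_ge0//.
rewrite exprMn !normL2_sqr real_normK ?num_real//.
apply: quad_disc; first exact: ip_ge0.
move=> x; have hxv := L2Z x%:C hv.
have := ip_ge0 (fun z => u z + x%:C * v z).
rewrite ipDl ?ipDr ?ipZl ?ipZr ?(ipC v u)//; last exact: L2D.
suff -> : ip u u + x * ip u v + (x * ip u v + x * (x * ip v v)) =
   ip u u + 2 * x * ip u v + x ^+ 2 * ip v v by [].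
ring.
Qed.

Lemma normL2D u v : L2 a b u -> L2 a b v ->
  normL2 a b (fun x => u x + v x) <= normL2 a b u + normL2 a b v.
Proof.
move=> hu hv; rewrite -(@ler_pXn2r _ 2)// ?nnegrE ?addr_ge0 ?normL2_ge0//.
have huv := L2D hu hv.
rewrite sqrrD !normL2_sqr ipDl ?ipDr//.
have := ip_CS hu hv; rewrite (ipC v u).
have := ler_norm (ip u v); lra.
Qed.

Lemma eq_normL2 u v : (forall x, D x -> Normc.normc (u x) = Normc.normc (v x)) ->
  normL2 a b u = normL2 a b v.
Proof.
by move=> uv; congr Num.sqrt; apply: eq_intg => x Dx; rewrite uv.
Qed.

Lemma normL2Z (c : C) u : L2 a b u ->
  normL2 a b (fun x => c * u x) = Normc.normc c * normL2 a b u.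
Proof.
move=> hu; rewrite -[RHS]ger0_norm ?mulr_ge0 ?normL2_ge0 ?normc_ge0//.
rewrite -sqrtr_sqr exprMn normL2_sqr normL2_ip; congr Num.sqrt.
rewrite -(intgZ _ (ip_itg hu hu)); apply: eq_intg => x _.
by rewrite normc_sqr reM imM; ring.
Qed.

Lemma normL2N u : normL2 a b (fun x => - u x) = normL2 a b u.
Proof.
by apply: eq_normL2 => x _; case: (u x) => p q /=; rewrite !sqrrN.
Qed.

Lemma normL2B u v : L2 a b u -> L2 a b v ->
  normL2 a b (fun x => u x - v x) <= normL2 a b u + normL2 a b v.
Proof.
by move=> hu hv; have := normL2D hu (L2N hv); rewrite normL2N.
Qed.

Lemma ae_normL2 u v : L2 a b u -> L2 a b v -> ae_same a b u v ->
  normL2 a b u = normL2 a b v.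
Proof.
move=> hu hv uv; congr Num.sqrt; apply: ae_eq_intg.
- by case: hu => _ _ /itg_meas.
- by case: hv => _ _ /itg_meas.
- by apply: ae_mono uv => x H Dx; rewrite H.
Qed.

Lemma ae_ip u v w : L2 a b u -> L2 a b v -> L2 a b w -> ae_same a b u v ->
  ip u w = ip v w.
Proof.
move=> hu hv hw uv; apply: ae_eq_intg.
- exact: itg_meas (ip_itg hu hw).
- exact: itg_meas (ip_itg hv hw).
- by apply: ae_mono uv => x H Dx; rewrite H.
Qed.

Lemma normL2_le u v : L2 a b u -> L2 a b v ->
  (forall x, D x -> Normc.normc (u x) <= Normc.normc (v x)) ->
  normL2 a b u <= normL2 a b v.
Proof.
move=> [_ _ iu] [_ _ iv] uv; apply: ler_wsqrtr; apply: le_intg => // x Dx.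
by rewrite lerXn2r ?nnegrE ?normc_ge0 ?uv.
Qed.

Lemma normL2_cst (M : R) : a < b -> 0 <= M ->
  normL2 a b (fun=> M%:C) = M * Num.sqrt (b - a).
Proof.
move=> ab M0; rewrite normL2_ip /ip intg_cst//= mulr0 addr0.
by rewrite sqrtrM ?mulr_ge0// -expr2 sqrtr_sqr ger0_norm.
Qed.

Lemma normL2_le_cst u (M : R) : a < b -> L2 a b u ->
  (forall x, D x -> Normc.normc (u x) <= M) ->
  normL2 a b u <= M * Num.sqrt (b - a).
Proof.
move=> ab hu uM.
have M0 : 0 <= M.
  have : D ((a + b) / 2) by rewrite /= in_itv/=; lra.
  by move=> /uM; apply: le_trans; exact: normc_ge0.
rewrite -normL2_cst//; apply: normL2_le => //; first exact: L2_cst.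
by move=> x Dx; rewrite /= expr0n addr0 sqrtr_sqr (le_trans (uM x Dx))// ler_norm.
Qed.

End ComplexL2.


(** * Spline test functions *)

Section Splines.
Context (R : realType).
Implicit Types (x z e : R) (f : R -> R).

(** A quadratic Taylor bound is enough for differentiability; it lets piecewise
    polynomial functions be differentiated by a case analysis on signs. *)
Lemma is_derive_quad f x d (K : R) :
  (forall h, `|h| <= 1 -> `|f (x + h) - f x - d * h| <= K * h ^+ 2) ->
  is_derive x (1:R) f d.
Proof.
move=> H.
have K0 : 0 <= K.
  have := H 1; rewrite normr1 => /(_ (lexx _)).
  by move=> /(le_trans (normr_ge0 _)); rewrite expr1n mulr1.
have L : h^-1 *: (f (h *: 1 + x) - f x) @[h --> 0^'] --> d.
  apply/cvgrPdist_le => eps eps0.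
  near=> h.
  have h0 : h != 0 by near: h; exact: nbhs_dnbhs_neq.
  have h1 : `|h| <= 1.
    near: h; apply: dnbhs0_le; exact: ltr01.
  have h2 : `|h| <= eps / (K + 1).
    by near: h; apply: dnbhs0_le; rewrite divr_gt0// ltr_wpDl.
  rewrite /GRing.scale/= mulr1 [h + x]addrC.
  rewrite (_ : d - _ = - (h^-1 * (f (x + h) - f x - d * h))); last by field.
  rewrite normrN normrM normrV ?unitfE// ler_pdivrMl ?normr_gt0//.
  apply: le_trans (H h h1) _; rewrite -real_normK ?num_real//.
  rewrite expr2 mulrCA ler_wpM2l//.
  apply: le_trans (_ : (K + 1) * `|h| <= _); first by rewrite ler_wpM2r// lerDl.
  by rewrite mulrC -ler_pdivlMr// ltr_wpDl.
apply: DeriveDef; first by apply/cvg_ex; exists d.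
by apply/cvg_lim => //.
Unshelve. all: by end_near. Qed.

Definition pos x : R := Num.max x 0.

Lemma pos_cases x : (0 <= x /\ pos x = x) \/ (x <= 0 /\ pos x = 0).
Proof.
rewrite /pos; case: (leP x 0) => [x0|x0]; first by right.
by left; split => //; exact: ltW.
Qed.

Lemma continuous_pos : continuous pos.
Proof.
move=> x; apply/cvgrPdist_le => eps eps0; near=> z.
have : `|x - z| <= eps by near: z; apply: cvgr_dist_le.
apply: le_trans; rewrite ler_norml; apply/andP.
have := ler_norm (x - z); have := ler_norm (z - x); rewrite (distrC z x).
by case: (pos_cases x) => -[? ->]; case: (pos_cases z) => -[? ->]; split; lra.
Unshelve. all: by end_near. Qed.

Lemma is_derive_pos2 x : is_derive x (1:R) (fun z => pos z ^+ 2) (2 * pos x).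
Proof.
apply: (@is_derive_quad _ _ _ 1) => h _; rewrite ler_norml.
by case: (pos_cases (x + h)) => -[? ->]; case: (pos_cases x) => -[? ->];
  apply/andP; split; nra.
Qed.

Lemma is_derive_pos3 x : is_derive x (1:R) (fun z => pos z ^+ 3) (3 * pos x ^+ 2).
Proof.
apply: (@is_derive_quad _ _ _ (3 * `|x| + 1)) => h; rewrite ler_norml => /andP[h1 h2].
rewrite ler_norml.
have := ler_norm x; have := ler_norm (- x); rewrite normrN; move: `|x| => y.
move=> ? ?; have h0 := sqr_ge0 h.
case: (pos_cases (x + h)) => -[? ->]; case: (pos_cases x) => -[? ->].
- have -> : (x + h) ^+ 3 - x ^+ 3 - 3 * x ^+ 2 * h = (3 * x + h) * h ^+ 2 by ring.
  by rewrite -mulNr; apply/andP; split; apply: ler_wpM2r => //; lra.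
- have : (x + h) ^+ 3 <= h ^+ 2 * 1.
    have -> : (x + h) ^+ 3 = (x + h) ^+ 2 * (x + h) by ring.
    by apply: ler_pM => //; [exact: sqr_ge0|nra|lra].
  have : 0 <= (x + h) ^+ 3 by apply: exprn_ge0.
  by move=> ? ?; apply/andP; split; nra.
- have : x ^+ 3 <= y * h ^+ 2.
    have -> : x ^+ 3 = x * x ^+ 2 by ring.
    by apply: ler_pM => //; [exact: sqr_ge0|nra].
  have : 0 <= x ^+ 3 by apply: exprn_ge0.
  have : x ^+ 2 * - h <= y * h ^+ 2.
    have -> : x ^+ 2 * - h = x * (x * - h) by ring.
    by apply: ler_pM => //; [apply: mulr_ge0; lra|nra].
  have : 0 <= x ^+ 2 * - h by apply: mulr_ge0; [exact: sqr_ge0|lra].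
  by move=> ? ? ? ?; apply/andP; split; lra.
- by apply/andP; split; nra.
Qed.

(** Cumulated quadratic B-spline: it climbs from 0 to 1 over [[0, 3]]. *)
Definition spline3 z : R :=
  6^-1 * (pos z ^+ 3 - 3 * pos (z - 1) ^+ 3 + 3 * pos (z - 2) ^+ 3
          - pos (z - 3) ^+ 3).
Definition spline2 z : R :=
  2^-1 * (pos z ^+ 2 - 3 * pos (z - 1) ^+ 2 + 3 * pos (z - 2) ^+ 2
          - pos (z - 3) ^+ 2).
Definition spline1 z : R :=
  pos z - 3 * pos (z - 1) + 3 * pos (z - 2) - pos (z - 3).

Lemma is_derive_shiftc f (c x d : R) : is_derive (x - c) (1:R) f d ->
  is_derive x (1:R) (fun z => f (z - c)) d.
Proof.
move=> H; have := @is_derive1_comp _ f (fun z => z - c) x d 1 H.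
by rewrite mulr1; apply; apply: is_derive_eq; rewrite subr0.
Qed.

Lemma is_derive_spline3 x : is_derive x (1:R) spline3 (spline2 x).
Proof.
have H c := is_derive_shiftc (is_derive_pos3 (x - c)).
have H1 := H 1; have H2 := H 2; have H3 := H 3.
have H0 := is_derive_pos3 x.
apply: is_derive_eq; rewrite /spline2 /GRing.scale/=; by field.
Qed.

Lemma is_derive_spline2 x : is_derive x (1:R) spline2 (spline1 x).
Proof.
have H c := is_derive_shiftc (is_derive_pos2 (x - c)).
have H1 := H 1; have H2 := H 2; have H3 := H 3.
have H0 := is_derive_pos2 x.
apply: is_derive_eq; rewrite /spline1 /GRing.scale/=; by field.
Qed.

Lemma continuous_spline1 : continuous spline1.
Proof.
have H c : continuous (fun z => pos (z - c)).
  move=> x; apply: (@continuous_comp _ _ _ (fun z => z - c) pos).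
    by apply: cvgB; [exact: cvg_id|exact: cvg_cst].
  exact: continuous_pos.
move=> x; apply: cvgB; last exact: H.
apply: cvgD; last by apply: cvgM; [exact: cvg_cst|exact: H].
apply: cvgB; last by apply: cvgM; [exact: cvg_cst|exact: H].
exact: continuous_pos.
Qed.

Ltac pos4 z :=
  case: (pos_cases z) => -[? ->]; case: (pos_cases (z - 1)) => -[? ->];
  case: (pos_cases (z - 2)) => -[? ->]; case: (pos_cases (z - 3)) => -[? ->].

Lemma spline3_lt0 z : z <= 0 -> spline3 z = 0.
Proof.
move=> z0; rewrite /spline3 /pos !max_r ?expr0n/=; lra.
Qed.

Lemma spline3_gt3 z : 3 <= z -> spline3 z = 1.
Proof.
move=> z3; rewrite /spline3 /pos !max_l; lra.
Qed.

Lemma spline2_out z : ~~ (0 <= z <= 3) -> spline2 z = 0.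
Proof.
rewrite negb_and -!ltNge => /orP[z0|z3]; rewrite /spline2 /pos.
  by rewrite !max_r ?expr0n/=; lra.
by rewrite !max_l; lra.
Qed.

Lemma spline2_bound z : `|spline2 z| <= 12.
Proof.
have [zin|/spline2_out ->] := boolP (0 <= z <= 3); last by rewrite normr0.
move: zin => /andP[z0 z3]; rewrite ler_norml /spline2.
by pos4 z; apply/andP; split; nra.
Qed.

Lemma spline3_bound z : `|spline3 z| <= 10.
Proof.
have [z0|z0] := leP z 0; first by rewrite spline3_lt0// normr0.
have [z3|z3] := leP 3 z; first by rewrite spline3_gt3// normr1; lra.
have B c : 0 <= c -> 0 <= pos (z - c) ^+ 3 <= 27.
  move=> c0; have [pc0 pc3] : 0 <= pos (z - c) /\ pos (z - c) <= 3.
    by case: (pos_cases (z - c)) => -[? ->]; lra.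
  rewrite exprn_ge0//= (_ : 27 = 3 ^+ 3 :> R); last by ring.
  by rewrite lerXn2r ?nnegrE.
have := B 0 (lexx _); rewrite subr0 => /andP[? ?].
have /andP[? ?] := B 1 ler01.
have /andP[? ?] : 0 <= pos (z - 2) ^+ 3 <= 1.
  have [pc0 pc3] : 0 <= pos (z - 2) /\ pos (z - 2) <= 1.
    by case: (pos_cases (z - 2)) => -[? ->]; lra.
  by rewrite exprn_ge0//= exprn_ile1.
have /andP[? ?] : 0 <= pos (z - 1) ^+ 3 <= 8.
  have [pc0 pc3] : 0 <= pos (z - 1) /\ pos (z - 1) <= 2.
    by case: (pos_cases (z - 1)) => -[? ->]; lra.
  rewrite exprn_ge0//= (_ : 8 = 2 ^+ 3 :> R); last by ring.
  by rewrite lerXn2r ?nnegrE.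
have -> : spline3 z = 6^-1 * (pos z ^+ 3 - 3 * pos (z - 1) ^+ 3 + 3 * pos (z - 2) ^+ 3).
  by rewrite /spline3 [pos (z - 3)]max_r ?expr0n/= ?subr0//; lra.
by rewrite ler_norml; apply/andP; split; lra.
Qed.

(** [ramp e x] climbs from 0 to 1 over an interval of length [3 e] starting at [x];
    its derivative [bump e x] is an approximate Dirac mass. The spline is smooth
    enough for both to enter test functions of class C^1. *)
Definition ramp e x z : R := spline3 ((z - x) / e).
Definition bump e x z : R := e^-1 * spline2 ((z - x) / e).
Definition bump' e x z : R := e^-1 * (e^-1 * spline1 ((z - x) / e)).

Lemma is_derive_scalec f e (x z d : R) : is_derive ((z - x) / e) (1:R) f d ->
  is_derive z (1:R) (fun t => f ((t - x) / e)) (e^-1 * d).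
Proof.
move=> H; have := @is_derive1_comp _ f (fun t => (t - x) / e) z d (e^-1) H.
rewrite mulrC; apply; apply: is_derive_eq; rewrite /GRing.scale/=; ring.
Qed.

Lemma is_derive_ramp e x z : is_derive z (1:R) (ramp e x) (bump e x z).
Proof. exact/is_derive_scalec/is_derive_spline3. Qed.

Lemma is_derive_bump e x z : is_derive z (1:R) (bump e x) (bump' e x z).
Proof.
have H := is_derive_scalec (is_derive_spline2 ((z - x) / e)).
by apply: is_derive_eq; rewrite /GRing.scale/= ?mul1r ?scaler0 ?mulr0 ?add0r ?addr0.
Qed.

End Splines.


Section WeakReal.
Context (R : realType) (a b : R).
Hypothesis hab : a < b.
Local Notation D := (`]a, b[%classic : set R).
Local Notation mu := (@leb R).
Implicit Types (x y z e : R) (f g w psi : R -> R).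

Lemma inD x : D x = (a < x < b) :> Prop.
Proof. by rewrite /= in_itv. Qed.

Lemma measDT f : measurable_fun setT f -> measurable_fun D f.
Proof. exact: (@measurable_funTS _ _ R R D f). Qed.

Lemma continuous_measD f : continuous f -> measurable_fun D f.
Proof. by move=> cf; exact (measDT (continuous_measurable_fun cf)). Qed.

Lemma is_derive_continuous f df : (forall x, is_derive x (1:R) f (df x)) ->
  continuous f.
Proof.
by move=> H x; apply: differentiable_continuous; apply/derivable1_diffP; case: (H x).
Qed.

Lemma intg_FTC f F : (forall x, is_derive x (1:R) F (f x)) -> continuous f ->
  intg a b f = F b - F a.
Proof.
move=> dF cf; have cF := is_derive_continuous dF.
have := @continuous_FTC2 R f F a b hab.
move=> H; rewrite /intg /Rintegral.
rewrite (_ : (\int[mu]_(x in D) (f x)%:E)%E =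
   (\int[lebesgue_measure]_(x in `[a, b]) (f x)%:E)%E); last first.
  rewrite -integral_itv_bndo_bndc; last first.
    by apply/measurable_EFinP; exact (@measurable_funTS _ _ R R _ _ (continuous_measurable_fun cf)).
  rewrite -integral_itv_obnd_cbnd//.
  by apply/measurable_EFinP; exact (@measurable_funTS _ _ R R _ _ (continuous_measurable_fun cf)).
rewrite H//.
- exact: continuous_subspaceT.
- split; first by move=> x _; case: (dF x).
  + by apply: cvg_at_right_filter; exact: cF.
  + by apply: cvg_at_left_filter; exact: cF.
- by move=> x _; rewrite derive1E; case: (dF x).
Qed.

(** * Integration against indicators of half-lines *)

Definition step x z : R := (z <= x)%R%:R.

Lemma step_meas x : measurable_fun D (step x).
Proof.
apply: measDT.
rewrite (_ : step x = \1_(`]-oo, x]%classic)); first exact: measurable_indic.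
by apply/funext => z; rewrite /step indicE mem_setE in_itv.
Qed.

Lemma step_bound x z : `|step x z| <= 1.
Proof. by rewrite /step; case: (z <= x); rewrite ?normr1 ?normr0. Qed.

Lemma sq_step x : sq a b (step x).
Proof. by apply: (@sq_bounded _ _ _ _ 1) => [|z _]; [exact: step_meas|exact: step_bound]. Qed.

Lemma intg_step x : a <= x -> x <= b -> intg a b (step x) = x - a.
Proof.
move=> ax xb; rewrite /intg.
rewrite (@eq_Rintegral _ _ _ mu D (\1_(`]-oo, x]%classic) : R -> R)); last first.
  by move=> z _; rewrite /step indicE mem_setE in_itv.
rewrite /Rintegral integral_indic//=.
have [->|xb'] := eqVneq x b.
  rewrite (_ : `]-oo, b] `&` D = D); last first.
    apply/seteqP; split => z /=; rewrite !in_itv/=; first by case.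
    by move=> /andP[-> zb]; split => //; exact: ltW.
  exact: (congr1 fine (muD hab)).
have xb2 : x < b by rewrite lt_neqAle xb'.
rewrite (_ : `]-oo, x] `&` D = `]a, x]%classic); last first.
  apply/seteqP; split => z /=; rewrite !in_itv/=; first by case=> -> /andP[->].
  by move=> /andP[-> zx]; split => //; exact: le_lt_trans xb2.
have H : mu (`]a, x]%classic : set R) = (x - a)%:E.
  rewrite /leb lebesgue_measure_itv/= lte_fin.
  by case: ltP => // xa; rewrite (@le_anti _ _ x a) ?ax ?xa// subrr.
exact: (congr1 fine H).
Qed.

(** The primitive of [g] that vanishes at [a]; the indicator keeps the domain of
    integration fixed. *)
Definition prim g x : R := intg a b (fun z => step x z * g z).

Lemma sq_step_mul g x : sq a b g -> sq a b (fun z => step x z * g z).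
Proof.
by move=> sg; apply: (@sqMb _ _ _ _ _ 1) => //; [exact: step_meas|move=> z _; exact: step_bound].
Qed.

Lemma prim_a g : prim g a = 0.
Proof.
rewrite /prim -[RHS](intg0 a b); apply: eq_intg => z; rewrite inD => /andP[az _].
by rewrite /step leNgt az mul0r.
Qed.

Lemma prim_b g : prim g b = intg a b g.
Proof.
apply: eq_intg => z; rewrite inD => /andP[_ zb].
by rewrite /step ltW// mul1r.
Qed.

Lemma intg_stepB g x y : sq a b g ->
  intg a b (fun z => (step y z - step x z) * g z) = prim g y - prim g x.
Proof.
move=> sg; rewrite -intgB; try exact/sq_itg/sq_step_mul.
by apply: eq_intg => z _; rewrite mulrBl.
Qed.

Definition nrm2 g : R := Num.sqrt (intg a b (fun z => g z ^+ 2)).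

Lemma sq_norm g : sq a b g -> sq a b (fun z => `|g z|).
Proof.
move=> sg; apply: (sq_le _ sg); last by move=> z _; rewrite normr_id.
by apply: measurableT_comp => //; exact: sq_meas sg.
Qed.

(** Cauchy-Schwarz against the indicator of the interval between [x] and [y]. *)
Lemma intg_step_le g x y : sq a b g -> a <= x -> x <= y -> y <= b ->
  intg a b (fun z => (step y z - step x z) * `|g z|) <=
  Num.sqrt (y - x) * nrm2 g.
Proof.
move=> sg ax xy yb.
have xb := le_trans xy yb; have ay := le_trans ax xy.
have ss := sqB (sq_step y) (sq_step x); have sn := sq_norm sg.
have := intg_CS ss sn.
rewrite (_ : intg a b (fun z => (step y z - step x z) ^+ 2) = y - x); last first.
  transitivity (intg a b (fun z => step y z - step x z)).
    apply: eq_intg => z _; rewrite /step.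
    have [zx|zx] := leP z x; first by rewrite (le_trans zx xy) subrr expr0n.
    by case: (z <= y); rewrite subr0 ?expr1n ?expr0n.
  rewrite intgB; try exact/sq_itg/sq_step.
  by rewrite !intg_step//; ring.
rewrite (_ : intg a b (fun z => `|g z| ^+ 2) = nrm2 g ^+ 2); last first.
  rewrite sqr_sqrtr; last by apply: intg_ge0 => z _; exact: sqr_ge0.
  by apply: eq_intg => z _; rewrite real_normK ?num_real.
have yx : 0 <= y - x by rewrite subr_ge0.
rewrite -{1}[y - x]sqr_sqrtr// -exprMn ler_pXn2r// ?nnegrE.
- apply: intg_ge0 => z _; apply: mulr_ge0 => //; rewrite subr_ge0 /step.
  have [zx|zx] := leP z x; first by rewrite (le_trans zx xy).
  by case: (z <= y).
- by rewrite mulr_ge0 ?sqrtr_ge0.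
Qed.

Lemma prim_hoelder g x y : sq a b g -> a <= x -> x <= y -> y <= b ->
  `|prim g y - prim g x| <= Num.sqrt (y - x) * nrm2 g.
Proof.
move=> sg ax xy yb; rewrite -intg_stepB//.
have ss := sqB (sq_step y) (sq_step x).
apply: le_trans (le_norm_intg (sqM ss sg)) _.
apply: le_trans (intg_step_le sg ax xy yb).
rewrite le_eqVlt; apply/orP; left; apply/eqP; apply: eq_intg => z _.
rewrite normrM [X in X * _]ger0_norm// subr_ge0 /step.
have [zx|zx] := leP z x; first by rewrite (le_trans zx xy).
by case: (z <= y).
Qed.

(** * Approximation of point values at Lebesgue points *)

Lemma intg_bump e x : 0 < e -> a <= x -> x + 3 * e <= b ->
  intg a b (bump e x) = 1.
Proof.
move=> e0 ax xb; transitivity (ramp e x b - ramp e x a).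
  have cb : continuous (@bump R e x).
    exact: (is_derive_continuous (fun z => is_derive_bump e x z)).
  exact: (@intg_FTC (@bump R e x) (@ramp R e x) (fun z => is_derive_ramp e x z) cb).
rewrite /ramp spline3_gt3 ?spline3_lt0 ?subr0//.
  by apply: mulr_le0_ge0; [rewrite subr_le0|rewrite invr_ge0 ltW].
by rewrite ler_pdivlMr//; lra.
Qed.

Lemma continuous_bump e x : continuous (bump e x).
Proof. exact: (is_derive_continuous (fun z => is_derive_bump e x z)). Qed.

Lemma continuous_ramp e x : continuous (@ramp R e x).
Proof. exact: (is_derive_continuous (fun z => is_derive_ramp e x z)). Qed.

Lemma bump_out e x z : 0 < e -> ~~ (x <= z <= x + 3 * e) -> bump e x z = 0.
Proof.
move=> e0 H; rewrite /bump spline2_out ?mulr0//; apply: contra H.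
by rewrite ler_pdivlMr// ler_pdivrMr// => /andP[? ?]; apply/andP; split; lra.
Qed.

Lemma bump_bound e x z : 0 < e -> `|bump e x z| <= 12 / e.
Proof.
move=> e0; have e1 : 0 < e^-1 by rewrite invr_gt0.
rewrite /bump normrM gtr0_norm// (mulrC e^-1).
by apply: ler_wpM2r; [exact: ltW|exact: spline2_bound].
Qed.

Lemma bump_meas e x : measurable_fun D (bump e x).
Proof. exact (continuous_measD (@continuous_bump e x)). Qed.

Lemma sq_bump e x : 0 < e -> sq a b (bump e x).
Proof.
by move=> e0; apply: (sq_bounded (@bump_meas e x)) => z _; exact: bump_bound.
Qed.

Lemma lebesgue_pt_ae w : sq a b w -> {ae mu, forall x, lebesgue_pt (w \_ D) x}.
Proof.
move=> /sq_itg iw; apply: lebesgue_differentiation.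
apply: open_integrable_locally; first exact: openT.
rewrite -restrict_EFin.
exact: (@integrable_mkcond _ _ _ mu D (EFin \o w) (mD a b)).1 iw.
Qed.

(** The bump has mass 1 and height of order [1 / e] on an interval of length
    [3 e], so that the error is a multiple of the mean oscillation of [w] at [x]. *)
Lemma bump_lebesgue w x : sq a b w -> D x -> lebesgue_pt (w \_ D) x ->
  forall eta : R, 0 < eta -> exists2 d : R, 0 < d &
    forall e, 0 < e -> e < d -> `|intg a b (fun z => w z * bump e x z) - w x| <= eta.
Proof.
move=> sw; rewrite inD => /andP[ax xb] lx eta eta0.
have : \forall r \near 0^'+, (davg (w \_ D) x r <= (eta / 96)%:E)%E.
  have /fine_cvgP[fin /cvgrPdist_le/(_ (eta / 96))] := lx.
  rewrite divr_gt0// => /(_ isT) H.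
  near=> r.
  have fr : davg (w \_ D) x r \is a fin_num by near: r.
  rewrite -(fineK fr) lee_fin.
  have : `|0 - fine (davg (w \_ D) x r)| <= eta / 96 by near: r; exact: H.
  by rewrite sub0r normrN; apply: le_trans; exact: ler_norm.
rewrite nearE /= => -[d /= d0 Hd].
exists (Num.min (d / 4) (Num.min ((b - x) / 4) ((x - a) / 4))).
  by rewrite !lt_min !divr_gt0//; rewrite subr_gt0.
move=> e e0; rewrite !lt_min => /andP[ed /andP[eb ea]].
have sb := sq_bump x e0.
have -> : w x = intg a b (fun z => w x * bump e x z).
  by rewrite intgZ ?intg_bump ?mulr1//; [exact: ltW|lra|exact: sq_itg].
rewrite -intgB; [|exact: sqM|exact/itgZ/sq_itg].
have swx := sqB sw (sq_cst a b (w x)).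
have sprod := sqM swx sb.
apply: le_trans (_ : `|intg a b (fun z => (w z - w x) * bump e x z)| <= _).
  rewrite le_eqVlt; apply/orP; left; apply/eqP; congr `|_|.
  by apply: eq_intg => z _; rewrite mulrBl.
apply: le_trans (le_norm_intg sprod) _.
pose B : set R := ball x (4 * e).
have BD : B `<=` D.
  move=> z; rewrite /B ball_itv /= !in_itv/= => /andP[? ?]; apply/andP; split; lra.
have mB : measurable B by exact: measurable_ball.
pose k z := (12 / e * `|w z - w x|) * \1_B z.
have ik : itg a b k.
  apply: (@itg_le _ _ _ _ (fun z => 12 / e * `|w z - w x|)).
  - apply: measurable_funM; last by apply: measDT; exact: measurable_indic.
    apply: measurable_funM; first exact: measurable_cst.
    by apply: measurableT_comp => //; exact: sq_meas swx.
  - by apply: itgZ; apply: itg_norm; exact: sq_itg.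
  - move=> z _; rewrite /k indicE; case: (z \in B); rewrite ?mulr1 ?mulr0 ?normr0.
      by rewrite ger0_norm// mulr_ge0// divr_ge0// ltW.
    by rewrite mulr_ge0// divr_ge0// ltW.
apply: (@le_trans _ _ (intg a b k)).
  apply: le_intg => //; first exact: itg_norm.
  move=> z Dz; rewrite /k indicE.
  have [zB|zB] := boolP (z \in B).
    rewrite mulr1 normrM mulrC ler_wpM2r//; exact: bump_bound.
  rewrite mulr0 bump_out ?mulr0 ?normr0//.
  apply: contra zB => /andP[z1 z2]; rewrite inE /B ball_itv /= in_itv/=.
  by apply/andP; split; lra.
have B4 : (mu B = (8 * e)%:E)%E.
  rewrite /B /leb lebesgue_measure_ball; last by rewrite mulr_ge0// ltW.
  by congr (_%:E); rewrite -mulrnAl; congr (_ * _); ring.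
have key : (\int[mu]_(z in B) `|((w \_ D) z - (w \_ D) x)%:E| <= (eta / 12 * e)%:E)%E.
  have := Hd (4 * e).
  rewrite /= sub0r normrN gtr0_norm ?mulr_gt0//.
  have l4 : 4 * e < d by lra.
  move=> /(_ l4 isT).
  rewrite /davg /iavg -/B.
  have -> : lebesgue_measure B = (8 * e)%:E by [].
  rewrite inver gt_eqF ?mulr_gt0// muleC lee_pdivrMr ?mulr_gt0//.
  rewrite -EFinM (_ : eta / 96 * (8 * e) = eta / 12 * e) //; first by field.
have -> : intg a b k = (12 / e) * fine (\int[mu]_(z in B) `|((w \_ D) z - (w \_ D) x)%:E|)%E.
  rewrite /k.
  transitivity (intg a b (fun z => 12 / e * (`|w z - w x| * \1_B z))).
    by apply: eq_intg => z _; rewrite mulrA.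
  have ii : itg a b (fun z => `|w z - w x| * \1_B z).
    apply: (@itg_le _ _ _ _ (fun z => `|w z - w x|)).
    - apply: measurable_funM; last by apply: measDT; exact: measurable_indic.
      by apply: measurableT_comp => //; exact: sq_meas swx.
    - by apply: itg_norm; exact: sq_itg.
    - move=> z _; rewrite indicE; case: (z \in B); rewrite ?mulr1 ?mulr0 ?normr0//.
      by rewrite normr_id.
  rewrite intgZ//; congr (_ * _); rewrite /intg /Rintegral; congr fine.
  have -> : B = D `&` B by apply/esym/setIidr.
  rewrite integral_mkcondr; apply: eq_integral => z; rewrite inE => Dz.
  rewrite !patchE indicE in_setI (mem_set Dz) /=.
  case: (z \in B) => /=; last by rewrite mulr0.
  by rewrite mulr1 mem_set ?inD ?ax.
have fl : (fine (\int[mu]_(z in B) `|((w \_ D) z - (w \_ D) x)%:E|)%E <= eta / 12 * e).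
  rewrite -lee_fin fineK// ge0_fin_numE; last exact: integral_ge0.
  exact: le_lt_trans key (ltry _).
apply: le_trans (_ : 12 / e * (eta / 12 * e) <= _).
  by rewrite ler_wpM2l// divr_ge0// ltW.
by rewrite le_eqVlt; apply/orP; left; apply/eqP; field; rewrite gt_eqF.
Unshelve. all: by end_near. Qed.

End WeakReal.


(** * Weak derivatives of real functions *)

Section WeakAC.
Context (R : realType) (a b : R).
Hypothesis hab : a < b.
Local Notation D := (`]a, b[%classic : set R).
Local Notation mu := (@leb R).
Implicit Types (x y z e : R) (f g w psi : R -> R).

Definition wk w g := [/\ sq a b w, sq a b g &
  forall phi : R -> R, test_fun a b phi ->
    intg a b (fun x => w x * derive1 phi x) =
    - intg a b (fun x => g x * phi x)].

Lemma continuous_bounded f (c d : R) : continuous f ->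
  exists M, forall x, c <= x <= d -> `|f x| <= M.
Proof.
move=> cf; have [cd|dc] := leP c d; last first.
  by exists 0 => x /andP[? ?]; lra.
have cn : {within `[c, d], continuous (fun x => `|f x|)}.
  apply: continuous_subspaceT => x.
  by apply: continuous_comp; [exact: cf|exact: norm_continuous].
have [m _ Hm] := EVT_max cd cn.
by exists `|f m| => x xcd; apply: Hm; rewrite in_itv.
Qed.

Lemma sq_continuous f : continuous f -> sq a b f.
Proof.
move=> cf; have [M HM] := continuous_bounded a b cf.
apply: (@sq_bounded _ _ _ _ M (continuous_measD cf)) => x.
by rewrite inD => /andP[? ?]; apply: HM; rewrite !ltW.
Qed.

Lemma sq_mul_continuous f g : sq a b f -> continuous g ->
  sq a b (fun x => f x * g x).
Proof.
move=> sf cg; have [M HM] := continuous_bounded a b cg.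
have := @sqMb _ a b f g M sf (continuous_measD cg).
move=> H; apply: (eq_sq _ (H _)) => [x _|x]; first by rewrite mulrC.
by rewrite inD => /andP[? ?]; apply: HM; rewrite !ltW.
Qed.

Lemma test_fun_build phi dphi c d : (forall x, is_derive x (1:R) phi (dphi x)) ->
  continuous dphi -> a < c -> d < b ->
  (forall x, ~~ (c <= x <= d) -> phi x = 0) ->
  test_fun a b phi /\ derive1 phi = dphi.
Proof.
move=> H cd ac db out.
have E : derive1 phi = dphi.
  by apply/funext => x; rewrite derive1E; case: (H x).
split => //; split; first by move=> x; case: (H x).
  by rewrite E.
by exists c, d; split.
Qed.

(** Product rule: multiplication by a C^1 function maps test functions to test
    functions. *)
Lemma wk_mul w g psi dpsi : (forall x, is_derive x (1:R) psi (dpsi x)) ->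
  continuous dpsi -> wk w g ->
  wk (fun x => w x * psi x) (fun x => g x * psi x + w x * dpsi x).
Proof.
move=> dp cp [sw sg H]; have cpsi := is_derive_continuous dp.
have swp := sq_mul_continuous sw cpsi; have sgp := sq_mul_continuous sg cpsi.
have swd := sq_mul_continuous sw cp.
split => //; first exact: sqD.
move=> phi tphi; have [dphi cphi [c [d [ac db out]]]] := tphi.
have dphi' x : is_derive x (1:R) phi (derive1 phi x).
  by apply: DeriveDef; [exact: dphi|rewrite derive1E].
have cph := is_derive_continuous dphi'.
have dprod x : is_derive x (1:R) (fun z => psi z * phi z)
    (psi x * derive1 phi x + phi x * dpsi x).
  by have := dphi' x; have := dp x => ? ?; apply: is_derive_eq.
have cprod : continuous (fun x => psi x * derive1 phi x + phi x * dpsi x).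
  by move=> x; apply: cvgD; apply: cvgM; [exact: cpsi|exact: cphi|exact: cph|exact: cp].
have [tp ep] : test_fun a b (fun z => psi z * phi z) /\
    derive1 (fun z => psi z * phi z) =
    (fun x => psi x * derive1 phi x + phi x * dpsi x).
  apply: (@test_fun_build _ _ c d) => // x /out ->; exact: mulr0.
have := H _ tp; rewrite ep => E.
have I1 : itg a b (fun x => w x * psi x * derive1 phi x).
  by apply: sqM => //; exact: sq_continuous.
have I2 : itg a b (fun x => w x * dpsi x * phi x).
  by apply: sqM => //; exact: sq_continuous.
have I3 : itg a b (fun x => g x * psi x * phi x).
  by apply: sqM => //; exact: sq_continuous.
have E1 : intg a b (fun x => w x * (psi x * derive1 phi x + phi x * dpsi x)) =
  intg a b (fun x => w x * psi x * derive1 phi x) +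
  intg a b (fun x => w x * dpsi x * phi x).
  by rewrite -intgD//; apply: eq_intg => x _; ring.
have E2 : intg a b (fun x => (g x * psi x + w x * dpsi x) * phi x) =
  intg a b (fun x => g x * psi x * phi x) +
  intg a b (fun x => w x * dpsi x * phi x).
  by rewrite -intgD//; apply: eq_intg => x _; ring.
have E3 : intg a b (fun x => g x * (psi x * phi x)) =
  intg a b (fun x => g x * psi x * phi x).
  by apply: eq_intg => x _; ring.
by move: E; rewrite E1 E2 E3 opprD => <-; ring.
Qed.

(** Bumps near a Lebesgue point of [g] are test functions: their pairings with
    [g] vanish, and they tend to the value of [g] there. *)
Lemma wk0_ae g : wk (fun=> 0) g -> {ae mu, forall x, D x -> g x = 0}.
Proof.
move=> [_ sg H]; apply: ae_mono (lebesgue_pt_ae sg) => x lx Dx.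
apply/eqP; rewrite -normr_le0; apply/ler_addgt0Pr => eta eta0; rewrite add0r.
have [d d0 Hd] := bump_lebesgue hab sg Dx lx eta0.
move: (Dx); rewrite inD => /andP[ax xb].
pose e := Num.min (d / 2) ((b - x) / 4).
have e0 : 0 < e by rewrite lt_min !divr_gt0// subr_gt0.
have ed : e < d by rewrite gt_min; apply/orP; left; lra.
have eb : e <= (b - x) / 4 by rewrite ge_min lexx orbT.
have cb' : continuous (@bump' R e x).
  move=> z; apply: cvgM; first exact: cvg_cst.
  apply: cvgM; first exact: cvg_cst.
  apply: (@continuous_comp _ _ _ (fun t => (t - x) / e) (@spline1 R)).
    by apply: cvgM; [apply: cvgB; [exact: cvg_id|exact: cvg_cst]|exact: cvg_cst].
  exact: continuous_spline1.
have [tb _] := @test_fun_build (@bump R e x) (@bump' R e x) x (x + 3 * e)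
  (fun z => is_derive_bump e x z) cb' ax ltac:(lra)
  (fun z => @bump_out _ e x z e0).
have := H _ tb.
rewrite (@eq_intg _ _ _ _ (fun=> 0)); last by move=> z _; rewrite mul0r.
rewrite intg0 => /esym/eqP; rewrite oppr_eq0 => /eqP E.
by have := Hd e e0 ed; rewrite E sub0r normrN.
Qed.

Lemma ae_dense (P : R -> Prop) c d : a <= c -> c < d -> d <= b ->
  {ae mu, forall x, D x -> P x} -> exists2 x, c < x < d & P x.
Proof.
move=> ac cd db aeP; apply: contrapT => H.
have : {ae mu, forall x, (`]c, d[%classic : set R) x -> False}.
  apply: ae_mono aeP => x HP; rewrite /= in_itv/= => xcd; apply: H; exists x => //.
  apply: HP; rewrite inD; move: xcd => /andP[? ?]; apply/andP; split.
    exact: le_lt_trans ac _.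
  exact: lt_le_trans db.
move=> [A [mA A0 HA]].
have : (mu (`]c, d[%classic : set R) <= mu A)%E.
  apply: le_measure; rewrite ?inE//.
  by apply: subset_trans HA => x xcd /(_ xcd).
rewrite A0 /leb lebesgue_measure_itv/= lte_fin cd -EFinB lee_fin.
by rewrite leNgt subr_gt0 cd.
Qed.

(** Absolutely continuous representative: the test function that climbs near one
    Lebesgue point and descends near another one approximates an indicator. *)
Lemma wk_ftc w g x y : wk w g -> D x -> D y -> x < y ->
  lebesgue_pt (w \_ D) x -> lebesgue_pt (w \_ D) y ->
  w y - w x = prim a b g y - prim a b g x.
Proof.
move=> [sw sg H] Dx Dy xy lx ly.
apply/eqP; rewrite -subr_eq0 -normr_le0; apply/ler_addgt0Pr => eta eta0.
rewrite add0r.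
have eta3 : 0 < eta / 4 by rewrite divr_gt0.
have [d1 d10 H1] := bump_lebesgue hab sw Dx lx eta3.
have [d2 d20 H2] := bump_lebesgue hab sw Dy ly eta3.
move: (Dx) (Dy); rewrite !inD => /andP[ax xb] /andP[ay yb].
set n := nrm2 a b g.
have n0 : 0 <= n by exact: sqrtr_ge0.
pose d3 := (eta / (44 * (n + 1))) ^+ 2 / 3.
have n1 : 0 < n + 1 by rewrite ltr_wpDl.
have d30 : 0 < d3 by rewrite divr_gt0// exprn_gt0// divr_gt0// mulr_gt0.
pose e := Num.min (Num.min (d1 / 2) (d2 / 2)) (Num.min ((b - y) / 4) d3).
have e0 : 0 < e by rewrite !lt_min d30 andbT !divr_gt0// subr_gt0.
have [ed1 ed2 ed3 eb] : [/\ e < d1, e < d2, e <= d3 & e <= (b - y) / 4].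
  split.
  - by rewrite !gt_min; apply/orP; left; apply/orP; left; lra.
  - by rewrite !gt_min; apply/orP; left; apply/orP; right; lra.
  - by rewrite !ge_min lexx !orbT.
  - by rewrite !ge_min lexx !orbT.
pose phi z := ramp e x z - ramp e y z.
pose dphi z := bump e x z - bump e y z.
have dphiP z : is_derive z (1:R) phi (dphi z).
  have := is_derive_ramp e x z; have := is_derive_ramp e y z => ? ?.
  exact: is_deriveB.
have cdphi : continuous dphi.
  by move=> z; apply: cvgB; exact: continuous_bump.
have rampl t z : z <= t -> ramp e t z = 0 :> R.
  move=> zt; rewrite /ramp spline3_lt0//.
  by apply: mulr_le0_ge0; [rewrite subr_le0|rewrite invr_ge0 ltW].
have rampr t z : t + 3 * e <= z -> ramp e t z = 1 :> R.
  by move=> zt; rewrite /ramp spline3_gt3// ler_pdivlMr//; lra.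
have [tphi ephi] : test_fun a b phi /\ derive1 phi = dphi.
  apply: (@test_fun_build _ _ x (y + 3 * e)) => //; first by lra.
  move=> z; rewrite negb_and -!ltNge /phi => /orP[zx|zy].
    by rewrite !rampl ?subrr//; lra.
  by rewrite !rampr ?subrr//; lra.
have := H _ tphi; rewrite ephi => E.
have sbx := sq_bump a b x e0; have sby := sq_bump a b y e0.
have E1 : intg a b (fun z => w z * dphi z) =
    intg a b (fun z => w z * bump e x z) - intg a b (fun z => w z * bump e y z).
  by rewrite -intgB; try exact: sqM; apply: eq_intg => z _; rewrite mulrBr.
have sramp t : sq a b (@ramp R e t).
  exact: (sq_continuous (@continuous_ramp _ e t)).
have sphi : sq a b phi by exact: sqB.
have Er t : D t -> t + 3 * e <= b ->
    `|intg a b (fun z => (1 - step t z - ramp e t z) * g z)| <= eta / 4.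
  rewrite inD => /andP[at_ tb] t3.
  have ss : sq a b (fun z => 1 - step t z - ramp e t z).
    by apply: sqB => //; apply: sqB; [exact: sq_cst|exact: sq_step].
  have st : sq a b (fun z => 11 * (step (t + 3 * e) z - step t z)).
    by apply: sqZ; apply: sqB; exact: sq_step.
  apply: le_trans (le_norm_intg (sqM ss sg)) _.
  apply: (@le_trans _ _ (intg a b (fun z => 11 * ((step (t + 3 * e) z - step t z) * `|g z|)))).
    apply: le_intg.
    - by apply: itg_norm; exact: sqM.
    - apply: itgZ; apply: sqM; last exact: sq_norm.
      by apply: sqB; exact: sq_step.
    - move=> z _; rewrite normrM mulrA ler_wpM2r// /step.
      have [zt|zt] := leP z t.
        have -> : z <= t + 3 * e by lra.
        by rewrite rampl// subr0 subrr normr0 mulr0.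
      have [zt3|zt3] := leP z (t + 3 * e).
        rewrite !subr0 mulr1.
        apply: le_trans (ler_normB _ _) _; rewrite normr1.
        by have := spline3_bound ((z - t) / e); rewrite /ramp; lra.
      rewrite rampr; last exact: ltW.
      by rewrite !subr0 subrr normr0 mulr0.
  rewrite intgZ; last first.
    apply: sqM; last exact: sq_norm.
    by apply: sqB; exact: sq_step.
  have t3' : t <= t + 3 * e by rewrite lerDl mulr_ge0// ltW.
  have := intg_step_le hab sg (ltW at_) t3' t3; rewrite (_ : t + 3 * e - t = 3 * e) -/n; last by ring.
  move=> B.
  apply: le_trans (_ : 11 * (eta / (44 * (n + 1)) * n) <= _).
    rewrite ler_wpM2l//; apply: le_trans B _; rewrite ler_wpM2r//.
    rewrite -[X in _ <= X]ger0_norm; last by rewrite divr_ge0 ?mulr_ge0 ?ltW.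
    rewrite -sqrtr_sqr; apply: ler_wsqrtr.
    by rewrite /d3 in ed3; lra.
  have -> : 11 * (eta / (44 * (n + 1)) * n) = eta / 4 * (n / (n + 1)).
    by field; rewrite gt_eqF.
  apply: ler_piMr; first by rewrite divr_ge0 ?ltW.
  by rewrite ler_pdivrMr// mul1r lerDl ler01.
have Ex := Er x Dx ltac:(lra). have Ey := Er y Dy ltac:(lra).
have sst t : sq a b (fun z => 1 - step t z - ramp e t z).
  by apply: sqB => //; apply: sqB; [exact: sq_cst|exact: sq_step].
have E2 : intg a b (fun z => g z * phi z) =
   prim a b g y - prim a b g x
   - intg a b (fun z => (1 - step x z - ramp e x z) * g z)
   + intg a b (fun z => (1 - step y z - ramp e y z) * g z).
  rewrite -intg_stepB// -intgB.
  - rewrite -intgD; first by apply: eq_intg => z _; rewrite /phi; ring.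
    + apply: itgB; last exact: sqM.
      by apply: sqM => //; apply: sqB; exact: sq_step.
    + exact: sqM.
  - by apply: sqM => //; apply: sqB; exact: sq_step.
  - exact: sqM.
have := H1 e e0 ed1; have := H2 e e0 ed2.
move: E Ex Ey; rewrite E1 E2 !ler_norml.
by clear=> ? /andP[? ?] /andP[? ?] /andP[? ?] /andP[? ?]; apply/andP; split; lra.
Qed.

(** The increments between Lebesgue points are known; one of them serves as base
    point. *)
Lemma wk_ac w g : wk w g ->
  exists c, {ae mu, forall x, D x -> w x = c + prim a b g x}.
Proof.
move=> H; have sw : sq a b w by case: H.
have L := lebesgue_pt_ae sw.
have [x0 Dx0 l0] : exists2 x, a < x < b & lebesgue_pt (w \_ D) x.
  by apply: ae_dense (lexx a) hab (lexx b) _; apply: ae_mono L.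
exists (w x0 - prim a b g x0); apply: ae_mono L => x lx Dx.
have [xx0|x0x|->] := ltgtP x x0; last by rewrite subrK.
  by have := wk_ftc H Dx _ xx0 lx l0; rewrite inD => /(_ Dx0); lra.
by have := wk_ftc H _ Dx x0x l0 lx; rewrite inD => /(_ Dx0); lra.
Qed.

End WeakAC.


(** * Continuous representatives *)

Section ContinuousRep.
Context (R : realType) (a b : R).
Hypothesis hab : a < b.
Local Notation D := (`]a, b[%classic : set R).
Local Notation mu := (@leb R).
Implicit Types (x y z e : R) (f g w psi : R -> R).

Lemma within_itvP f : {within `[a, b], continuous f} <->
  forall x, a <= x <= b -> forall eta : R, 0 < eta -> exists2 d : R, 0 < d &
    forall z, a <= z <= b -> `|x - z| < d -> `|f x - f z| <= eta.
Proof.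
split=> [/subspace_continuousP H x xab eta eta0|H].
  have := H x; rewrite /= in_itv/= => /(_ xab) /cvgrPdist_le /(_ _ eta0).
  rewrite nearE/= => /nbhs_ballP[d /= d0 Hd]; exists d => // z zab xz.
  by apply: Hd => //=; rewrite in_itv.
apply/subspace_continuousP => x; rewrite /= in_itv/= => xab.
apply/cvgrPdist_le => eta eta0; have [d d0 Hd] := H x xab eta eta0.
apply/nbhs_ballP; exists d => //= z xz; rewrite in_itv/= => zab.
exact: Hd.
Qed.

(** A set of full measure is dense. *)
Lemma within_ae_le f g : {within `[a, b], continuous f} ->
  {within `[a, b], continuous g} -> {ae mu, forall x, D x -> f x <= g x} ->
  forall x, a <= x <= b -> f x <= g x.
Proof.
move=> /within_itvP cf /within_itvP cg fg x xab.
apply/ler_addgt0Pr => eta eta0.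
have eta2 : 0 < eta / 2 by rewrite divr_gt0.
have [d d0 Hd] := cf x xab _ eta2; have [e e0 He] := cg x xab _ eta2.
move: (xab) => /andP[ax xb].
pose c1 := Num.max a (x - Num.min d e); pose c2 := Num.min b (x + Num.min d e).
have m0 : 0 < Num.min d e by rewrite lt_min d0.
have [z /andP[z1 z2] fgz] : exists2 z, c1 < z < c2 & f z <= g z.
  apply: (@ae_dense R a b (fun z => f z <= g z)) => //.
  - by rewrite /c1 le_max lexx.
  - rewrite /c1 /c2 gt_max !lt_min hab/=.
    by apply/andP; split; [|apply/andP; split]; lra.
  - by rewrite /c2 ge_min lexx.
move: z1 z2; rewrite /c1 /c2 gt_max lt_min => /andP[az xz] /andP[zb zx].
have xzm : `|x - z| < Num.min d e by rewrite ltr_norml; apply/andP; split; lra.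
move: xzm; rewrite lt_min => /andP[xzd xze].
have zab : a <= z <= b by rewrite !ltW.
have := Hd z zab xzd; have := He z zab xze; rewrite !ler_norml.
by move=> /andP[? ?] /andP[? ?]; lra.
Qed.

Lemma within_ae_eq f g : {within `[a, b], continuous f} ->
  {within `[a, b], continuous g} -> {ae mu, forall x, D x -> f x = g x} ->
  forall x, a <= x <= b -> f x = g x.
Proof.
move=> cf cg fg x xab; apply/eqP; rewrite eq_le; apply/andP; split.
  by apply: within_ae_le => //; apply: ae_mono fg => z H /H ->.
by apply: within_ae_le => //; apply: ae_mono fg => z H /H ->.
Qed.

Lemma within_measD f : {within `[a, b], continuous f} -> measurable_fun D f.
Proof.
move=> cf; have mab : measurable (`[a, b]%classic : set R) by exact: measurable_itv.
have := subspace_continuous_measurable_fun mab cf.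
apply: (@measurable_funS _ _ R R `[a, b]%classic D) => //.
exact: subset_itv_oo_cc.
Qed.

Lemma intg_norm_le g : sq a b g ->
  intg a b (fun z => `|g z|) <= Num.sqrt (b - a) * nrm2 a b g.
Proof.
move=> sg; have := @intg_step_le _ a b hab g a b sg (lexx a) (ltW hab) (lexx b).
congr (_ <= _); apply: eq_intg => z; rewrite inD => /andP[az zb].
by rewrite /step (ltW zb) leNgt az subr0 mul1r.
Qed.

Lemma prim_hoelder_abs g x y : sq a b g -> a <= x <= b -> a <= y <= b ->
  `|prim a b g y - prim a b g x| <= Num.sqrt `|y - x| * nrm2 a b g.
Proof.
move=> sg /andP[ax xb] /andP[ay yb]; have [xy|yx] := leP x y.
  by rewrite [X in Num.sqrt X]ger0_norm ?subr_ge0//; apply: prim_hoelder.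
rewrite distrC [`|y - x|]distrC [X in Num.sqrt X]ger0_norm ?subr_ge0 ?(ltW yx)//.
by apply: prim_hoelder => //; exact: ltW.
Qed.

Lemma prim_within g : sq a b g -> {within `[a, b], continuous (prim a b g)}.
Proof.
move=> sg; apply/within_itvP => x xab eta eta0.
have n0 : 0 < nrm2 a b g + 1 by rewrite ltr_wpDl// sqrtr_ge0.
exists ((eta / (nrm2 a b g + 1)) ^+ 2); first by rewrite exprn_gt0// divr_gt0.
move=> z zab xz; apply: le_trans (prim_hoelder_abs sg zab xab) _.
apply: le_trans (_ : eta / (nrm2 a b g + 1) * nrm2 a b g <= _).
  apply: ler_wpM2r; first exact: sqrtr_ge0.
  rewrite -[X in _ <= X]ger0_norm; last by rewrite divr_ge0 ?ltW.
  by rewrite -(sqrtr_sqr (eta / _)); apply: ler_wsqrtr; rewrite ?ltW// distrC ltW.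
by rewrite mulrAC ler_pdivrMr// ler_wpM2l ?ltW// ltrDl.
Qed.

(** The function [c + prim g] is continuous by its Hoelder estimate. *)
Lemma wk_rep w g : wk a b w g -> exists W : R -> R,
  [/\ {within `[a, b], continuous W},
      {ae mu, forall x, D x -> w x = W x} &
      forall x, a <= x <= b -> W x = W a + prim a b g x].
Proof.
move=> H; have [c Hc] := wk_ac hab H; have [_ sg _] := H.
exists (fun x => c + prim a b g x); split => //.
- apply/within_itvP => x xab eta eta0.
  have /within_itvP/(_ x xab eta eta0)[d d0 Hd] := prim_within sg.
  exists d => // z zab xz; rewrite opprD addrACA subrr add0r; exact: Hd.
- by move=> x _; rewrite prim_a addr0.
Qed.

Lemma ae_nrm2 f g : measurable_fun D f -> measurable_fun D g ->
  {ae mu, forall x, D x -> f x = g x} -> nrm2 a b f = nrm2 a b g.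
Proof.
move=> mf mg fg; congr Num.sqrt; apply: ae_eq_intg.
- exact: measurable_funX.
- exact: measurable_funX.
- by apply: ae_mono fg => x H Dx; rewrite H.
Qed.

(** The Hoelder estimate bounds the oscillation of [W] by the norm of [g];
    averaging [|W x| <= |W y| + oscillation] over [y] brings in the norm of [w]. *)
Lemma wk_sup w g W : wk a b w g -> {within `[a, b], continuous W} ->
  {ae mu, forall x, D x -> w x = W x} -> forall x, a <= x <= b ->
  `|W x| <= (Num.sqrt (b - a))^-1 * nrm2 a b w + Num.sqrt (b - a) * nrm2 a b g.
Proof.
move=> H cW wW x xab; have [W' [cW' wW' W'E]] := wk_rep H.
have [sw sg _] := H.
have WW' z : a <= z <= b -> W z = W' z.
  apply: within_ae_eq => //; apply: ae_and_mono wW wW' => y H1 H2 Dy.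
  by rewrite -H1// H2.
have ba : 0 < b - a by rewrite subr_gt0.
have s0 : 0 < Num.sqrt (b - a) by rewrite sqrtr_gt0.
have n0 : 0 <= nrm2 a b g by exact: sqrtr_ge0.
have osc y : a <= y <= b -> `|W x| <= `|W y| + Num.sqrt (b - a) * nrm2 a b g.
  move=> yab; have := prim_hoelder_abs sg yab xab.
  have -> : prim a b g x - prim a b g y = W x - W y.
    by rewrite !WW'// [W' x]W'E// [W' y]W'E//; ring.
  have xy : Num.sqrt `|x - y| <= Num.sqrt (b - a).
    apply: ler_wsqrtr; rewrite ler_norml.
    by move: xab yab => /andP[? ?] /andP[? ?]; apply/andP; split; lra.
  have := ler_wpM2r n0 xy; have := lerB_normD (W x) (- W y).
  by rewrite normrN; lra.
have sW : sq a b W by apply: ae_sq wW sw; exact: within_measD.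
have iW := itg_norm (sq_itg sW).
have : intg a b (fun=> `|W x|) <=
    intg a b (fun y => `|W y| + Num.sqrt (b - a) * nrm2 a b g).
  apply: le_intg; [exact: itg_cst|by apply: itgD => //; exact: itg_cst|].
  by move=> y; rewrite inD => /andP[? ?]; apply: osc; rewrite !ltW.
rewrite intgD//; last exact: itg_cst.
rewrite !intg_cst// => I.
have := intg_norm_le sW.
rewrite -(ae_nrm2 sw.1 sW.1 wW) => J.
rewrite -(ler_pM2r ba) mulrDl; apply: le_trans I _.
rewrite lerD2r; apply: le_trans J _.
rewrite le_eqVlt; apply/orP; left; apply/eqP.
rewrite mulrAC -{3}[b - a]sqr_sqrtr ?ltW// expr2.
by field; rewrite gt_eqF.
Qed.

(** An increment of [W] is the integral of [g] over the interval in between. *)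
Lemma wk_lipschitz w g W M : wk a b w g -> {within `[a, b], continuous W} ->
  {ae mu, forall x, D x -> w x = W x} -> {ae mu, forall x, D x -> `|g x| <= M} ->
  forall x y, a <= x <= b -> a <= y <= b -> `|W x - W y| <= M * `|x - y|.
Proof.
move=> H cW wW gM; have [W' [cW' wW' W'E]] := wk_rep H; have [sw sg _] := H.
have WW' z : a <= z <= b -> W z = W' z.
  apply: within_ae_eq => //; apply: ae_and_mono wW wW' => y H1 H2 Dy.
  by rewrite -H1// H2.
suff L x y : a <= x -> x <= y -> y <= b -> `|W x - W y| <= M * `|x - y|.
  move=> x y /andP[ax xb] /andP[ay yb]; have [xy|yx] := leP x y.
    exact: L.
  by rewrite distrC (distrC x); apply: L => //; exact: ltW.
move=> ax xy yb; have xb := le_trans xy yb; have ay := le_trans ax xy.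
rewrite !WW' ?ax ?ay ?xb ?yb// [W' x]W'E ?ax// [W' y]W'E ?ay//.
rewrite (_ : _ - _ = - (prim a b g y - prim a b g x)); last by ring.
rewrite normrN -intg_stepB//.
have ss := sqB (sq_step a b y) (sq_step a b x).
have st0 z : 0 <= step y z - step x z.
  rewrite subr_ge0 /step; have [zx|zx] := leP z x; first by rewrite (le_trans zx xy).
  by case: (z <= y).
apply: le_trans (le_norm_intg (sqM ss sg)) _.
have -> : M * `|x - y| = intg a b (fun z => M * (step y z - step x z)).
  rewrite intgZ; last exact: sq_itg.
  rewrite intgB; try exact/sq_itg/sq_step.
  rewrite !intg_step// distrC ger0_norm ?subr_ge0//; ring.
set f1 := fun z => _; set f2 := fun z => M * _.
have m1 : measurable_fun D f1.
  by apply: measurableT_comp => //; exact: itg_meas (sqM ss sg).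
have i1 : itg a b f1 by exact: itg_norm (sqM ss sg).
have i2 : itg a b f2 by exact/itgZ/sq_itg.
(* [f1 <= f2] is only known almost everywhere; the minimum makes it pointwise. *)
pose f3 := fun z => Num.min (f1 z) (f2 z).
have f30 z : `|f3 z| <= `|f1 z| + `|f2 z|.
  by rewrite /f3; case: (leP (f1 z) (f2 z)) => _; rewrite ?lerDl ?lerDr.
have m3 : measurable_fun D f3.
  by apply: measurable_minr => //; exact: itg_meas i2.
rewrite (ae_eq_intg m1 m3); last first.
  apply: ae_mono gM => z gz Dz; rewrite /f3 min_l// /f1 /f2 normrM mulrC.
  by rewrite (ger0_norm (st0 z)) ler_wpM2r ?gz.
apply: le_intg => //.
- apply: (itg_le m3 (itgD (itg_norm i1) (itg_norm i2))) => z _; exact: f30.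
- by move=> z _; rewrite /f3 ge_min lexx orbT.
Qed.

(** The product rule gives [w psi] a weak derivative; representing the product by
    the primitive of that derivative reaches the end points by continuity. *)
Lemma wk_parts w g W psi dpsi : (forall x, is_derive x (1:R) psi (dpsi x)) ->
  continuous dpsi -> wk a b w g -> {within `[a, b], continuous W} ->
  {ae mu, forall x, D x -> w x = W x} ->
  intg a b (fun x => g x * psi x) + intg a b (fun x => w x * dpsi x) =
  W b * psi b - W a * psi a.
Proof.
move=> dp cp H cW wW.
have cpsi := is_derive_continuous dp.
have [sw sg _] := H.
have [W' [cW' wW' W'E]] := wk_rep (wk_mul dp cp H).
have cWp : {within `[a, b], continuous (fun x => W x * psi x)}.
  apply/subspace_continuousP => x xab; apply: cvgM.
    by move/subspace_continuousP : cW; exact.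
  have := @continuous_subspaceT _ _ (`[a, b]%classic : set R) psi cpsi.
  by move/subspace_continuousP; exact.
have E x : a <= x <= b -> W x * psi x = W' x.
  apply: (@within_ae_eq (fun x => W x * psi x) W' cWp cW').
  by apply: ae_and_mono wW wW' => z H1 H2 Dz; rewrite -H2// H1.
rewrite !E ?lexx ?ltW// [W' b]W'E ?lexx ?ltW//.
rewrite (_ : _ - W' a = prim a b (fun x => g x * psi x + w x * dpsi x) b); last by ring.
rewrite prim_b intgD//; apply: sqM => //; exact: sq_continuous.
Qed.

End ContinuousRep.


(** * Sobolev functions *)

Section Sobolev.
Context (R : realType) (a b : R).
Hypothesis hab : a < b.
Local Notation D := (`]a, b[%classic : set R).
Local Notation mu := (@leb R).
Local Notation C := R[i].
Local Notation re := (@complex.Re R).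
Local Notation im := (@complex.Im R).
Implicit Types (u v g k U : R -> C).

Lemma ae_same_refl u : ae_same a b u u.
Proof. exact: ae_all. Qed.

Lemma ae_same_sym u v : ae_same a b u v -> ae_same a b v u.
Proof. by apply: ae_mono => x H Dx; rewrite H. Qed.

Lemma ae_same_trans u v g : ae_same a b u v -> ae_same a b v g -> ae_same a b u g.
Proof. by apply: ae_and_mono => x H1 H2 Dx; rewrite H1// H2. Qed.

Lemma test_fun_itg (w phi : R -> R) : sq a b w -> test_fun a b phi ->
  itg a b (fun x => w x * phi x) /\ itg a b (fun x => w x * derive1 phi x).
Proof.
move=> sw [d c _]; split; apply: sqM => //; apply: sq_continuous => //.
by apply: (@is_derive_continuous _ _ (derive1 phi)) => x; apply: DeriveDef;
  [exact: d|rewrite derive1E].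
Qed.

(** Test functions are real, so that the complex condition splits. *)
Lemma weak_derivP u g : weak_deriv a b u g <->
  [/\ L2 a b u, L2 a b g,
      wk a b (fun x => re (u x)) (fun x => re (g x)) &
      wk a b (fun x => im (u x)) (fun x => im (g x))].
Proof.
have E (v : R -> C) (phi : R -> R) :
    cintegral a b (fun x => v x * (phi x)%:C) =
    Complex (intg a b (fun x => re (v x) * phi x))
            (intg a b (fun x => im (v x) * phi x)).
  rewrite /cintegral; congr (_ +i* _); apply: eq_Rintegral => x _.
    by rewrite reM /= mulr0 subr0.
  by rewrite imM /= mulr0 add0r.
split=> [[hu hg H]|[hu hg [sr sgr Hr] [si sgi Hi]]].
  have [ur ui] := (L2_parts _ _ _).1 hu; have [gr gi] := (L2_parts _ _ _).1 hg.
  by split => //; split => // phi tphi; have := H phi tphi; rewrite !E => -[].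
split => // phi tphi; rewrite !E Hr// Hi//.
Qed.

Lemma wkZ c (w g : R -> R) : wk a b w g -> wk a b (fun x => c * w x) (fun x => c * g x).
Proof.
move=> [sw sg H]; split; [exact: sqZ|exact: sqZ|move=> phi tphi].
have [i1 i2] := test_fun_itg sw tphi; have [j1 j2] := test_fun_itg sg tphi.
transitivity (c * intg a b (fun x => w x * derive1 phi x)).
  by rewrite -intgZ//; apply: eq_intg => x _; rewrite mulrA.
rewrite H// mulrN -intgZ//; congr (- _).
by apply: eq_intg => x _; rewrite mulrA.
Qed.

Lemma wkD (w g w' g' : R -> R) : wk a b w g -> wk a b w' g' ->
  wk a b (fun x => w x + w' x) (fun x => g x + g' x).
Proof.
move=> [sw sg H] [sw' sg' H']; split; [exact: sqD|exact: sqD|move=> phi tphi].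
have [i1 i2] := test_fun_itg sw tphi; have [j1 j2] := test_fun_itg sg tphi.
have [i1' i2'] := test_fun_itg sw' tphi; have [j1' j2'] := test_fun_itg sg' tphi.
transitivity (intg a b (fun x => w x * derive1 phi x) +
              intg a b (fun x => w' x * derive1 phi x)).
  by rewrite -intgD//; apply: eq_intg => x _; rewrite mulrDl.
rewrite H// H'// -opprD -intgD//; congr (- _).
by apply: eq_intg => x _; rewrite mulrDl.
Qed.

Lemma eq_wk (w g w' g' : R -> R) : w =1 w' -> g =1 g' -> wk a b w g -> wk a b w' g'.
Proof. by move=> /funext-> /funext->. Qed.

Lemma weak_deriv_lin (c d : C) u v g k :
  weak_deriv a b u g -> weak_deriv a b v k ->
  weak_deriv a b (fun x => c * u x + d * v x) (fun x => c * g x + d * k x).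
Proof.
move=> /weak_derivP[hu hg rw iw] /weak_derivP[hv hk rw' iw'].
apply/weak_derivP; split; try by apply: L2D; exact: L2Z.
  apply: (eq_wk _ _ (wkD (wkD (wkZ (re c) rw) (wkZ (- im c) iw))
    (wkD (wkZ (re d) rw') (wkZ (- im d) iw')))) => x;
  by rewrite reD !reM !mulNr.
by apply: (eq_wk _ _ (wkD (wkD (wkZ (re c) iw) (wkZ (im c) rw))
    (wkD (wkZ (re d) iw') (wkZ (im d) rw')))) => x;
  rewrite imD !imM.
Qed.

Lemma weak_deriv_ae u v g k : L2 a b v -> L2 a b k -> ae_same a b u v ->
  ae_same a b g k -> weak_deriv a b u g -> weak_deriv a b v k.
Proof.
move=> hv hk /ae_sameP[ur ui] /ae_sameP[gr gi] /weak_derivP[hu hg wr wi].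
have K (w w' q q' : R -> R) : sq a b w' -> sq a b q' ->
    {ae mu, forall x, D x -> w x = w' x} ->
    {ae mu, forall x, D x -> q x = q' x} -> wk a b w q -> wk a b w' q'.
  move=> sw' sq' ew eq [sw sqq H]; split => // phi tphi.
  have [i1 i2] := test_fun_itg sw tphi; have [j1 j2] := test_fun_itg sqq tphi.
  have [i1' i2'] := test_fun_itg sw' tphi; have [j1' j2'] := test_fun_itg sq' tphi.
  rewrite -(ae_eq_intg (itg_meas i2) (itg_meas i2')); last first.
    by apply: ae_mono ew => x E Dx; rewrite E.
  rewrite -(ae_eq_intg (itg_meas j1) (itg_meas j1')) ?H//.
  by apply: ae_mono eq => x E Dx; rewrite E.
apply/weak_derivP; split => //.
  by apply: K wr => //; [exact: L2_re|exact: L2_re].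
by apply: K wi => //; [exact: L2_im|exact: L2_im].
Qed.

Lemma weak_deriv_uniq u g k : weak_deriv a b u g -> weak_deriv a b u k ->
  ae_same a b g k.
Proof.
move=> H1 H2; have := weak_deriv_lin 1 (-1) H1 H2.
move=> /weak_derivP[_ _ wr wi].
have Z (w q : R -> R) : w =1 (fun=> 0) -> wk a b w q ->
    {ae mu, forall x, D x -> q x = 0}.
  by move=> w0 H; apply: (wk0_ae hab); apply: eq_wk H.
apply: ae_and_mono (Z _ _ _ wr) (Z _ _ _ wi).
- move=> x r0 i0 Dx; apply: complex_ext.
    by have := r0 Dx; rewrite mul1r mulN1r reB => /eqP; rewrite subr_eq0 => /eqP.
  by have := i0 Dx; rewrite mul1r mulN1r imB => /eqP; rewrite subr_eq0 => /eqP.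
- by move=> x; rewrite mul1r mulN1r reB subrr.
- by move=> x; rewrite mul1r mulN1r imB subrr.
Qed.

(** The derivative chosen by [wD] may be traded for any other weak derivative. *)
Lemma wDP u g : weak_deriv a b u g ->
  weak_deriv a b u (wD a b u) /\ ae_same a b (wD a b u) g.
Proof.
move=> H; have K : weak_deriv a b u (wD a b u) by exact: (xgetPex _ (ex_intro _ g H)).
by split => //; exact: weak_deriv_uniq K H.
Qed.

(** Functions that agree almost everywhere have the same set of weak derivatives,
    hence the same choice in it: the conclusion is an equality. *)
Lemma wD_ae u v : L2 a b u -> L2 a b v -> ae_same a b u v -> wD a b u = wD a b v.
Proof.
move=> hu hv uv; rewrite /wD; congr xget; apply/seteqP; split => g /= H.
  by apply: (weak_deriv_ae _ _ _ _ H) => //; [case: H|exact: ae_same_refl].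
by apply: (weak_deriv_ae _ _ _ _ H) => //; [case: H|exact: ae_same_sym|exact: ae_same_refl].
Qed.

Lemma sobolev_L2 m u : sobolev a b m u -> L2 a b u.
Proof. by case: m => //= m [g [[]]]. Qed.

Lemma sobolev_ae m u v : L2 a b v -> ae_same a b u v -> sobolev a b m u ->
  sobolev a b m v.
Proof.
case: m => [//|m] hv uv [g [H sg]]; exists g; split => //.
by apply: (weak_deriv_ae _ _ _ _ H) => //; [case: H|exact: ae_same_refl].
Qed.

Lemma sobolevS m u : sobolev a b m.+1 u ->
  weak_deriv a b u (wD a b u) /\ sobolev a b m (wD a b u).
Proof.
move=> [g [H sg]]; have [K e] := wDP H; split => //.
by apply: sobolev_ae sg; [case: K|exact: ae_same_sym].
Qed.

Lemma sobolev_iter (k m : nat) u : sobolev a b (k + m) u -> sobolev a b m (iter k (wD a b) u).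
Proof.
elim: k u => [//|k IH] u; rewrite addSn => /sobolevS[_ /IH].
by rewrite iterSr.
Qed.

Lemma sobolev_le (k m : nat) u : (k <= m)%N -> sobolev a b m u -> sobolev a b k u.
Proof.
elim: k m u => [|k IH] [|m] u //; first by move=> _ /sobolev_L2.
by rewrite ltnS => km [g [H sg]]; exists g; split => //; exact: IH km sg.
Qed.

Lemma sobolev_lin m (c d : C) u v : sobolev a b m u -> sobolev a b m v ->
  sobolev a b m (fun x => c * u x + d * v x).
Proof.
elim: m u v => [|m IH] u v; first by move=> hu hv; apply: L2D; exact: L2Z.
move=> [g [H sg]] [k [K sk]]; exists (fun x => c * g x + d * k x); split.
  exact: weak_deriv_lin.
exact: IH.
Qed.

Lemma iter_wD_ae n u v : L2 a b u -> L2 a b v -> ae_same a b u v ->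
  ae_same a b (iter n (wD a b) u) (iter n (wD a b) v).
Proof.
case: n => [//|n] hu hv uv; rewrite !iterSr (wD_ae hu hv uv).
exact: ae_same_refl.
Qed.

Lemma iter_wD_lin n (c d : C) u v : sobolev a b n u -> sobolev a b n v ->
  ae_same a b (iter n (wD a b) (fun x => c * u x + d * v x))
    (fun x => c * iter n (wD a b) u x + d * iter n (wD a b) v x).
Proof.
elim: n u v => [|n IH] u v; first by move=> _ _; exact: ae_same_refl.
move=> /sobolevS[Hu su] /sobolevS[Hv sv]; rewrite !iterSr.
have [K e] := wDP (weak_deriv_lin c d Hu Hv).
apply: ae_same_trans (IH _ _ su sv).
apply: iter_wD_ae e; first by case: K.
by apply: L2D; apply: L2Z; [case: Hu|case: Hv].
Qed.

Lemma iter_wDB n u v : sobolev a b n u -> sobolev a b n v ->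
  ae_same a b (iter n (wD a b) (fun x => u x - v x))
    (fun x => iter n (wD a b) u x - iter n (wD a b) v x).
Proof.
move=> su sv; have := iter_wD_lin 1 (-1) su sv.
congr ae_same; first (congr (iter _ _ _));
  by apply/funext => x; rewrite mul1r mulN1r.
Qed.

Lemma sobolevB m u v : sobolev a b m u -> sobolev a b m v ->
  sobolev a b m (fun x => u x - v x).
Proof.
move=> su sv; have := sobolev_lin 1 (-1) su sv.
by congr sobolev; apply/funext => x; rewrite mul1r mulN1r.
Qed.

Lemma L2_iter n u : sobolev a b n u -> L2 a b (iter n (wD a b) u).
Proof.
by rewrite -[n in sobolev _ _ n]addn0 => /sobolev_iter.
Qed.

Lemma normL2_iter_le n m u : (n <= m)%N ->
  normL2 a b (iter n (wD a b) u) <= normH a b m u.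
Proof.
move=> nm; rewrite -[leLHS]ger0_norm ?normL2_ge0// -sqrtr_sqr.
apply: ler_wsqrtr; have nm1 : (n < m.+1)%N by rewrite ltnS.
rewrite (bigD1 (Ordinal nm1))//= lerDl.
by apply: sumr_ge0 => i _; exact: sqr_ge0.
Qed.

Lemma normH1_le u : normH a b 1 u <= normL2 a b u + normL2 a b (wD a b u).
Proof.
rewrite -[leRHS]ger0_norm ?addr_ge0 ?normL2_ge0// -sqrtr_sqr.
apply: ler_wsqrtr; rewrite !big_ord_recl big_ord0 addr0 /=.
rewrite sqrrD; have := mulr_ge0 (normL2_ge0 a b u) (normL2_ge0 a b (wD a b u)).
lra.
Qed.

(** * Continuous representatives of complex functions *)

Definition is_crep u U := [/\ {within `[a, b], continuous (fun x => re (U x))},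
  {within `[a, b], continuous (fun x => im (U x))} & ae_same a b U u].

Lemma crep_ex u : sobolev a b 1 u -> is_crep u (cont_rep a b u).
Proof.
move=> /sobolevS[/weak_derivP[hu hg wr wi] _].
have [W1 [c1 e1 _]] := wk_rep hab wr; have [W2 [c2 e2 _]] := wk_rep hab wi.
have H : is_crep u (fun x => Complex (W1 x) (W2 x)).
  split => //; apply: ae_and_mono e1 e2 => x H1 H2 Dx.
  by apply: complex_ext; rewrite /= ?H1 ?H2.
exact: (xgetPex _ (ex_intro _ _ H)).
Qed.

Lemma crep_L2 u U : L2 a b u -> is_crep u U -> L2 a b U.
Proof.
move=> hu [c1 c2 e]; apply: L2_ae (ae_same_sym e) hu; exact: within_measD.
Qed.

Lemma crep_B u v U V : is_crep u U -> is_crep v V ->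
  is_crep (fun x => u x - v x) (fun x => U x - V x).
Proof.
move=> [c1 c2 e] [c1' c2' e']; split.
- rewrite (_ : (fun x => _) = (fun x => re (U x) - re (V x))); last first.
    by apply/funext => x; rewrite reB.
  apply/subspace_continuousP => x xab; apply: cvgB.
    by move/subspace_continuousP : c1; exact.
  by move/subspace_continuousP : c1'; exact.
- rewrite (_ : (fun x => _) = (fun x => im (U x) - im (V x))); last first.
    by apply/funext => x; rewrite imB.
  apply/subspace_continuousP => x xab; apply: cvgB.
    by move/subspace_continuousP : c2; exact.
  by move/subspace_continuousP : c2'; exact.
- by apply: ae_and_mono e e' => x H1 H2 Dx; rewrite H1// H2.
Qed.

Lemma nrm2_re u : L2 a b u -> nrm2 a b (fun x => re (u x)) <= normL2 a b u.
Proof.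
move=> hu; have [ur ui] := (L2_parts _ _ _).1 hu; case: (hu) => _ _ iu.
apply: ler_wsqrtr; apply: le_intg => //; first exact: ur.2.
by move=> x _; rewrite normc_sqr lerDl sqr_ge0.
Qed.

Lemma nrm2_im u : L2 a b u -> nrm2 a b (fun x => im (u x)) <= normL2 a b u.
Proof.
move=> hu; have [ur ui] := (L2_parts _ _ _).1 hu; case: (hu) => _ _ iu.
apply: ler_wsqrtr; apply: le_intg => //; first exact: ui.2.
by move=> x _; rewrite normc_sqr lerDr sqr_ge0.
Qed.

(** The constant of the Sobolev embedding; the factor 2 adds up the real and
    imaginary parts. *)
Definition csob : R := 2 * ((Num.sqrt (b - a))^-1 + Num.sqrt (b - a)).

Lemma csob_gt0 : 0 < csob.
Proof.
have ba : 0 < b - a by rewrite subr_gt0.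
by rewrite mulr_gt0// addr_gt0// ?invr_gt0 ?sqrtr_gt0.
Qed.

Lemma crep_sup u U : sobolev a b 1 u -> is_crep u U -> forall x, a <= x <= b ->
  Normc.normc (U x) <= csob * (normL2 a b u + normL2 a b (wD a b u)).
Proof.
move=> /sobolevS[/weak_derivP[hu hg wr wi] _] [c1 c2 e] x xab.
have [er ei] := ae_sameP (ae_same_sym e).
have s0 : 0 < Num.sqrt (b - a) by rewrite sqrtr_gt0 subr_gt0.
have B (p q p' q' s : R) : 0 < s -> 0 <= p' -> 0 <= q' -> p <= p' -> q <= q' ->
    s^-1 * p + s * q <= (s^-1 + s) * (p' + q').
  move=> s_gt0 p0 q0 pp qq; have si : 0 < s^-1 by rewrite invr_gt0.
  have := ler_wpM2l (ltW si) pp; have := ler_wpM2l (ltW s_gt0) qq.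
  have := mulr_ge0 (ltW si) q0; have := mulr_ge0 (ltW s_gt0) p0; lra.
have n1 := normL2_ge0 a b u; have n2 := normL2_ge0 a b (wD a b u).
have := wk_sup hab wr c1 er xab; have := wk_sup hab wi c2 ei xab.
have := B _ _ _ _ _ s0 n1 n2 (nrm2_re hu) (nrm2_re hg).
have := B _ _ _ _ _ s0 n1 n2 (nrm2_im hu) (nrm2_im hg).
have := normc_le (U x); rewrite /csob; lra.
Qed.

Lemma sobolev_ae_bound u : sobolev a b 1 u ->
  {ae mu, forall x, D x -> Normc.normc (u x) <=
     csob * (normL2 a b u + normL2 a b (wD a b u))}.
Proof.
move=> su; have H := crep_ex su; have [_ _ e] := H.
apply: ae_mono e => x E Dx; rewrite -E//; apply: crep_sup => //.
by move: Dx; rewrite inD => /andP[? ?]; rewrite !ltW.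
Qed.

(** The first derivative lies in H1, hence is bounded. *)
Lemma crep_lipschitz u U : sobolev a b 2 u -> is_crep u U ->
  exists2 M, 0 <= M & forall x y, a <= x <= b -> a <= y <= b ->
    Normc.normc (U x - U y) <= M * `|x - y|.
Proof.
move=> /sobolevS[/weak_derivP[hu hg wr wi] sg] [c1 c2 e].
have [er ei] := ae_sameP (ae_same_sym e).
have B := sobolev_ae_bound sg; set M := csob * _ in B.
have M0 : 0 <= M by rewrite mulr_ge0 ?addr_ge0 ?normL2_ge0 ?ltW ?csob_gt0.
exists (2 * M); first by rewrite mulr_ge0.
move=> x y xab yab.
have Br : {ae mu, forall x, D x -> `|re (wD a b u x)| <= M}.
  by apply: ae_mono B => z H Dz; apply: le_trans (H Dz); exact: re_le_normc.
have Bi : {ae mu, forall x, D x -> `|im (wD a b u x)| <= M}.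
  by apply: ae_mono B => z H Dz; apply: le_trans (H Dz); exact: im_le_normc.
have := wk_lipschitz hab wr c1 er Br xab yab.
have := wk_lipschitz hab wi c2 ei Bi xab yab.
have := normc_le (U x - U y); rewrite reB imB; lra.
Qed.

End Sobolev.


(** * Fourier coefficients *)

Section UnitCircle.
Context (R : realType).
Local Notation C := R[i].
Local Notation re := (@complex.Re R).
Local Notation im := (@complex.Im R).
Local Notation normc := (@Normc.normc R).
Implicit Types (r s : R) (z w : C).

Definition ei r : C := cos r +i* sin r.

Lemma cexp_i r : cexp ('i%C * r%:C) = ei r.
Proof.
rewrite /cexp reM imM /= !mul0r !mul1r ?mulr0 ?subrr ?add0r expR0.
exact: mul1r.
Qed.

Lemma cexp_Ni r : cexp (- ('i%C * r%:C)) = ei (- r).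
Proof. by rewrite -cexp_i rmorphN mulrN. Qed.

Lemma ei0 : ei 0 = 1.
Proof. by rewrite /ei cos0 sin0. Qed.

Lemma eiD r s : ei (r + s) = ei r * ei s.
Proof.
apply: complex_ext; rewrite ?reM ?imM /= ?cosD ?sinD//.
by rewrite addrC; congr (_ + _); rewrite mulrC.
Qed.

Lemma normc_ei r : normc (ei r) = 1.
Proof. by rewrite /= cos2Dsin2 sqrtr1. Qed.

Lemma conj_ei r : conjc (ei r) = ei (- r).
Proof. by rewrite /= /ei cosN sinN. Qed.

Lemma eiNK r : ei r * ei (- r) = 1.
Proof. by rewrite -eiD subrr ei0. Qed.

Lemma ei_2pin (n : nat) : ei (2 * pi * n%:R) = 1.
Proof.
elim: n => [|n IH]; first by rewrite mulr0 ei0.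
rewrite -[n.+1%:R]natr1 mulrDr eiD IH mul1r mulr1 /ei.
have -> : 2 * pi = pi *+ 2 :> R by rewrite mulr2n; ring.
by rewrite cos2pi sin2pi.
Qed.

Lemma ei_2pi (l : int) : ei (2 * pi * l%:~R) = 1.
Proof.
case: l => n; first exact: ei_2pin.
rewrite NegzE mulrNz mulrN -[RHS](eiNK (2 * pi * n.+1%:R)).
by rewrite ei_2pin mul1r.
Qed.

Lemma normcD z w : normc (z + w) <= normc z + normc w.
Proof. exact: le_normcD. Qed.

Lemma normcB z w : normc (z - w) <= normc z + normc w.
Proof. by rewrite -[normc w]normcN; exact: normcD. Qed.

Lemma normc_sum (I : Type) (s : seq I) (P : pred I) (F : I -> C) :
  normc (\sum_(i <- s | P i) F i) <= \sum_(i <- s | P i) normc (F i).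
Proof.
elim/big_rec2: _ => [|i x y _ H]; first by rewrite Normc.normc0.
by apply: le_trans (normcD _ _) _; rewrite lerD2l.
Qed.

Lemma normc_real r : normc r%:C = `|r|.
Proof. by rewrite /= expr0n addr0 sqrtr_sqr. Qed.

Lemma normc_i : normc 'i%C = 1 :> R.
Proof. by rewrite /= expr0n add0r expr1n sqrtr1. Qed.

Lemma re_iM z : re ('i%C * z) = - im z.
Proof. by case: z => p q /=; ring. Qed.

Lemma im_iM z : im ('i%C * z) = re z.
Proof. by case: z => p q /=; ring. Qed.

End UnitCircle.

Section Fourier.
Context (R : realType) (a b : R).
Hypothesis hab : a < b.
Local Notation D := (`]a, b[%classic : set R).
Local Notation mu := (@leb R).
Local Notation C := R[i].
Local Notation re := (@complex.Re R).
Local Notation im := (@complex.Im R).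
Local Notation normc := (@Normc.normc R).
Local Notation freq := (freq a b).
Local Notation fmode := (fmode a b).
Local Notation fcoef := (fcoef a b).
Implicit Types (u v w g : R -> C) (l m : int).

Let ba0 : b - a != 0. Proof. by rewrite subr_eq0 gt_eqF. Qed.
Let ba_gt0 : 0 < b - a. Proof. by rewrite subr_gt0. Qed.

Lemma fmodeE l x : fmode l x = ei (freq l * (x - a)).
Proof. exact: cexp_i. Qed.

Lemma freqD l m : freq (l + m) = freq l + freq m.
Proof. by rewrite /Defs.freq rmorphD/= mulrDr mulrDl. Qed.

Lemma freqN l : freq (- l) = - freq l.
Proof. by rewrite /Defs.freq rmorphN/= mulrN mulNr. Qed.

Lemma freq0 : freq 0 = 0.
Proof. by rewrite /Defs.freq mulr0 mul0r. Qed.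

Lemma freq_eq0 l : (freq l == 0) = (l == 0).
Proof.
rewrite /Defs.freq mulf_eq0 invr_eq0 (negbTE ba0) orbF mulf_eq0.
by rewrite mulf_eq0 pnatr_eq0/= (gt_eqF (pi_gt0 R)) intr_eq0.
Qed.

Lemma fmodeD l m x : fmode (l + m) x = fmode l x * fmode m x.
Proof. by rewrite !fmodeE freqD mulrDl eiD. Qed.

Lemma fmode_b l : fmode l b = 1.
Proof. by rewrite fmodeE /Defs.freq mulfVK// ei_2pi. Qed.

Lemma normc_fmode l x : normc (fmode l x) = 1.
Proof. by rewrite fmodeE normc_ei. Qed.

Lemma is_derive_cosl (r x : R) :
  is_derive x (1:R) (fun x => cos (r * (x - a))) (- r * sin (r * (x - a))).
Proof.
have H : is_derive x (1:R) (fun x => r * (x - a)) r.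
  by apply: is_derive_eq; rewrite /GRing.scale/=; ring.
have K := is_derive_cos (r * (x - a)).
have := @is_derive1_comp _ _ _ x _ _ K H.
by move/is_derive_eq; apply; ring.
Qed.

Lemma is_derive_sinl (r x : R) :
  is_derive x (1:R) (fun x => sin (r * (x - a))) (r * cos (r * (x - a))).
Proof.
have H : is_derive x (1:R) (fun x => r * (x - a)) r.
  by apply: is_derive_eq; rewrite /GRing.scale/=; ring.
have K := is_derive_sin (r * (x - a)).
have := @is_derive1_comp _ _ _ x _ _ K H.
by move/is_derive_eq; apply; ring.
Qed.

Lemma continuous_cosl (r : R) : continuous (fun x => cos (r * (x - a))).
Proof. exact: (is_derive_continuous (is_derive_cosl r)). Qed.

Lemma continuous_sinl (r : R) : continuous (fun x => sin (r * (x - a))).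
Proof. exact: (is_derive_continuous (is_derive_sinl r)). Qed.

Lemma re_fmode l x : re (fmode l x) = cos (freq l * (x - a)).
Proof. by rewrite fmodeE. Qed.
Lemma im_fmode l x : im (fmode l x) = sin (freq l * (x - a)).
Proof. by rewrite fmodeE. Qed.

Lemma re_fmode_fun l : (fun x => re (fmode l x)) = (fun x => cos (freq l * (x - a))).
Proof. by apply/funext => x; rewrite re_fmode. Qed.
Lemma im_fmode_fun l : (fun x => im (fmode l x)) = (fun x => sin (freq l * (x - a))).
Proof. by apply/funext => x; rewrite im_fmode. Qed.

Lemma L2_fmode l : L2 a b (fmode l).
Proof.
apply: (@L2_bounded _ _ _ _ 1).
- by rewrite re_fmode_fun; exact (continuous_measD (continuous_cosl (r := freq l))).
- by rewrite im_fmode_fun; exact (continuous_measD (continuous_sinl (r := freq l))).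
- by move=> x _; rewrite normc_fmode.
Qed.

Lemma fcoefE u l : L2 a b u ->
  fcoef u l = ((b - a)^-1 * ip a b u (fmode l)) +i*
              ((b - a)^-1 * ip a b u (fun x => 'i%C * fmode l x)).
Proof.
move=> hu; rewrite /Defs.fcoef /cintegral.
apply: complex_ext; rewrite ?reM ?imM /= mul0r ?subr0 ?addr0; congr (_ * _);
  apply: eq_intg => x _; rewrite cexp_Ni -conj_ei -fmodeE; case: (fmode l x) => p q;
  case: (u x) => r s /=; ring.
Qed.

Lemma L2_ifmode l : L2 a b (fun x => 'i%C * fmode l x).
Proof. exact: L2Z (L2_fmode l). Qed.

Lemma fcoefD u v l : L2 a b u -> L2 a b v ->
  fcoef (fun x => u x + v x) l = fcoef u l + fcoef v l.
Proof.
move=> hu hv; rewrite !fcoefE//; last exact: L2D.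
have h1 := L2_fmode l; have h2 := L2_ifmode l.
by apply: complex_ext; rewrite ?reD ?imD /= ipDl// mulrDr.
Qed.

Lemma fcoefB u v l : L2 a b u -> L2 a b v ->
  fcoef (fun x => u x - v x) l = fcoef u l - fcoef v l.
Proof.
move=> hu hv; rewrite !fcoefE//; last exact: L2B.
have h1 := L2_fmode l; have h2 := L2_ifmode l.
by apply: complex_ext; rewrite ?reB ?imB /= ipBl// mulrBr.
Qed.

Lemma fcoefZ (c : C) u l : L2 a b u ->
  fcoef (fun x => c * u x) l = c * fcoef u l.
Proof.
move=> hu; have h1 := L2_fmode l; have h2 := L2_ifmode l.
rewrite !fcoefE//; last exact: L2Z.
have E (v : R -> C) : L2 a b v -> ip a b (fun x => c * u x) v =
    re c * ip a b u v - im c * ip a b u (fun x => 'i%C * v x).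
  move=> hv; rewrite -!(intgZ _ (ip_itg _ _))//; last exact: L2Z.
  rewrite -intgB; [|exact/itgZ/ip_itg|by apply/itgZ/ip_itg => //; exact: L2Z].
  apply: eq_intg => x _; rewrite reM imM.
  by case: (u x) => ? ?; case: (v x) => ? ? /=; ring.
have E2 : ip a b u (fun x => 'i%C * ('i%C * fmode l x)) = - ip a b u (fmode l).
  rewrite -intgN; last exact: ip_itg.
  apply: eq_intg => x _; case: (u x) => ? ?; case: (fmode l x) => ? ? /=; ring.
by apply: complex_ext; rewrite ?reM ?imM /= !E// ?E2; ring.
Qed.

Lemma fcoef_ae u v l : L2 a b u -> L2 a b v -> ae_same a b u v ->
  fcoef u l = fcoef v l.
Proof.
move=> hu hv uv; rewrite !fcoefE//; congr (_ +i* _); congr (_ * _).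
  by apply: ae_ip => //; exact: L2_fmode.
by apply: ae_ip => //; exact: L2_ifmode.
Qed.

Lemma eq_fcoef u v l : (forall x, D x -> u x = v x) -> fcoef u l = fcoef v l.
Proof.
move=> uv; rewrite /Defs.fcoef /cintegral; congr (_ * (_ +i* _));
  by apply: eq_intg => x Dx; rewrite uv.
Qed.

(** Integration by parts: the boundary terms cancel by periodicity. *)
Lemma fcoef_wD u l : sobolev a b 1 u -> cont_rep a b u a = cont_rep a b u b ->
  fcoef (wD a b u) l = 'i%C * (freq l)%:C * fcoef u l.
Proof.
move=> su per; have [c1 c2 e] := crep_ex hab su.
have [/weak_derivP[hu hg wr wi] _] := sobolevS hab su.
have [er ei_] := ae_sameP (ae_same_sym e).
have [ur ui] := (L2_parts _ _ _).1 hu; have [gr gi] := (L2_parts _ _ _).1 hg.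
have dc x := is_derive_cosl (freq l) x; have ds x := is_derive_sinl (freq l) x.
have cc := @continuous_cosl (freq l); have cs := @continuous_sinl (freq l).
have cc' : continuous (fun x => freq l * cos (freq l * (x - a))).
  by move=> x; apply: cvgM; [exact: cvg_cst|exact: cc].
have cs' : continuous (fun x => - freq l * sin (freq l * (x - a))).
  by move=> x; apply: cvgM; [exact: cvg_cst|exact: cs].
have cosb : cos (freq l * (b - a)) = 1 by rewrite -re_fmode fmode_b.
have sinb : sin (freq l * (b - a)) = 0 by rewrite -im_fmode fmode_b.
have := wk_parts hab dc cs' wr c1 er; have := wk_parts hab ds cc' wr c1 er.
have := wk_parts hab dc cs' wi c2 ei_; have := wk_parts hab ds cc' wi c2 ei_.
have cosa : cos (freq l * (a - a)) = 1 by rewrite subrr mulr0 cos0.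
have sina : sin (freq l * (a - a)) = 0 by rewrite subrr mulr0 sin0.
rewrite cosb sinb cosa sina !mulr0 subr0 !mulr1 per (subrr (re _)) (subrr (im _)).
have Z (w f : R -> R) (c : R) : sq a b w -> continuous f ->
    intg a b (fun x => w x * (c * f x)) = c * intg a b (fun x => w x * f x).
  move=> sw cf; rewrite -intgZ; last by apply: sqM => //; exact: sq_continuous.
  by apply: eq_intg => x _; ring.
rewrite !Z// => E1 E2 E3 E4.
have I (w f : R -> R) : sq a b w -> continuous f -> itg a b (fun x => w x * f x).
  by move=> sw cf; apply: sqM => //; exact: sq_continuous.
have P1 (q : R -> C) : L2 a b q -> ip a b q (fmode l) =
  intg a b (fun x => re (q x) * cos (freq l * (x - a))) +
  intg a b (fun x => im (q x) * sin (freq l * (x - a))).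
  move=> /L2_parts[qr qi]; rewrite -intgD; [|exact: I|exact: I].
  by apply: eq_intg => x _; rewrite re_fmode im_fmode.
have P2 (q : R -> C) : L2 a b q -> ip a b q (fun x => 'i%C * fmode l x) =
  intg a b (fun x => im (q x) * cos (freq l * (x - a))) -
  intg a b (fun x => re (q x) * sin (freq l * (x - a))).
  move=> /L2_parts[qr qi]; rewrite -intgB; [|exact: I|exact: I].
  by apply: eq_intg => x _; rewrite reM imM re_fmode im_fmode /=; ring.
rewrite !fcoefE// !P1// !P2//.
move/eqP : E1; rewrite addr_eq0 => /eqP E1.
move/eqP : E2; rewrite addr_eq0 => /eqP E2.
move/eqP : E3; rewrite addr_eq0 => /eqP E3.
move/eqP : E4; rewrite addr_eq0 => /eqP E4.
by apply: complex_ext; rewrite ?reM ?imM /= ?E1 ?E2 ?E3 ?E4; ring.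
Qed.

Lemma fcoef_fmode l m : fcoef (fmode m) l = (m == l)%:R.
Proof.
have K (k : int) : intg a b (fun x => cos (freq k * (x - a))) = (k == 0)%:R * (b - a)
   /\ intg a b (fun x => sin (freq k * (x - a))) = 0.
  have [->|k0] := eqVneq k 0.
    split.
      rewrite mul1r -[RHS]mul1r -intg_cst//; apply: eq_intg => x _.
      by rewrite freq0 mul0r cos0.
    by rewrite -[RHS](intg0 a b); apply: eq_intg => x _; rewrite freq0 mul0r sin0.
  have f0 : freq k != 0 by rewrite freq_eq0.
  have cosb : cos (freq k * (b - a)) = 1 by rewrite -re_fmode fmode_b.
  have sinb : sin (freq k * (b - a)) = 0 by rewrite -im_fmode fmode_b.
  split.
    have H x : is_derive x (1:R) (fun x => (freq k)^-1 * sin (freq k * (x - a)))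
        (cos (freq k * (x - a))).
      have := is_derive_sinl (freq k) x => ?; apply: is_derive_eq.
      by rewrite /GRing.scale/=; field.
    rewrite (@intg_FTC _ _ _ hab _ _ H (@continuous_cosl (freq k))).
    by rewrite sinb subrr !mulr0 sin0 !mulr0 subrr mul0r.
  have H x : is_derive x (1:R) (fun x => - (freq k)^-1 * cos (freq k * (x - a)))
      (sin (freq k * (x - a))).
    have := is_derive_cosl (freq k) x => ?; apply: is_derive_eq.
    by rewrite /GRing.scale/=; field.
  rewrite (@intg_FTC _ _ _ hab _ _ H (@continuous_sinl (freq k))).
  by rewrite cosb subrr mulr0 cos0 subrr.
have [Kc Ks] := K (m - l).
rewrite fcoefE; last exact: L2_fmode.
have E x : fmode m x = fmode (m - l) x * fmode l x.
  by rewrite -fmodeD subrK.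
have N x : re (fmode l x) ^+ 2 + im (fmode l x) ^+ 2 = 1.
  by rewrite -normc_sqr normc_fmode expr1n.
rewrite (_ : ip a b (fmode m) (fmode l) = (m - l == 0)%:R * (b - a)); last first.
  rewrite -Kc; apply: eq_intg => x _; rewrite E reM imM -re_fmode.
  rewrite -[RHS]mulr1 -(N x); ring.
rewrite (_ : ip a b (fmode m) (fun x => 'i%C * fmode l x) = 0); last first.
  rewrite -[RHS]Ks; apply: eq_intg => x _; rewrite E re_iM im_iM reM imM -im_fmode.
  rewrite -[RHS]mulr1 -[X in _ = _ * X](N x); ring.
rewrite mulr0 subr_eq0 mulrCA mulVf// mulr1; by case: (m == l).
Qed.

Definition trigpoly n (l : 'I_n -> int) (c : 'I_n -> C) (x : R) : C :=
  \sum_(j < n) c j * fmode (l j) x.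

Lemma L2_trigpoly n (l : 'I_n -> int) c : L2 a b (trigpoly l c).
Proof. by apply: L2_sum => j; apply: L2Z; exact: L2_fmode. Qed.

Lemma fcoef_sum n (F : 'I_n -> R -> C) m : (forall i, L2 a b (F i)) ->
  fcoef (fun x => \sum_i F i x) m = \sum_i fcoef (F i) m.
Proof.
elim: n F => [|n IH] F H.
  rewrite big_ord0 (@eq_fcoef _ (fun x => 0 * fmode 0 x)); last first.
    by move=> x _; rewrite big_ord0 mul0r.
  by rewrite fcoefZ ?mul0r//; exact: L2_fmode.
rewrite big_ord_recl -IH// -fcoefD//; last exact: L2_sum.
by apply: eq_fcoef => x _; rewrite big_ord_recl.
Qed.

Lemma fcoef_trigpoly n (l : 'I_n -> int) c m :
  fcoef (trigpoly l c) m = \sum_(j < n) c j * (l j == m)%:R.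
Proof.
rewrite fcoef_sum; last by move=> j; apply: L2Z; exact: L2_fmode.
by apply: eq_bigr => j _; rewrite fcoefZ ?fcoef_fmode//; exact: L2_fmode.
Qed.

Lemma fcoef_trigpoly_inj n (l : 'I_n -> int) c j : injective l ->
  fcoef (trigpoly l c) (l j) = c j.
Proof.
move=> il; rewrite fcoef_trigpoly (bigD1 j)//= eqxx mulr1 big1 ?addr0// => i ij.
by rewrite (inj_eq il) (negbTE ij) mulr0.
Qed.

Lemma ip_trigpoly n (l : 'I_n -> int) c u : L2 a b u ->
  ip a b (trigpoly l c) u =
  (b - a) * \sum_(j < n) (re (c j) * re (fcoef u (l j)) + im (c j) * im (fcoef u (l j))).
Proof.
move=> hu; rewrite ip_suml//; last by move=> j; apply: L2Z; exact: L2_fmode.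
rewrite mulr_sumr; apply: eq_bigr => j _.
have hm := L2_fmode (l j); have hi := L2_ifmode (l j).
rewrite fcoefE//= !(mulrCA _ (b - a)^-1) -!mulrDr mulrA mulfV// mul1r.
rewrite -!(intgZ _ (ip_itg _ _))// -intgD; [|exact/itgZ/ip_itg|exact/itgZ/ip_itg].
apply: eq_intg => x _; rewrite !reM !imM /=; ring.
Qed.

Lemma normL2_trigpoly n (l : 'I_n -> int) c : injective l ->
  normL2 a b (trigpoly l c) ^+ 2 = (b - a) * \sum_(j < n) normc (c j) ^+ 2.
Proof.
move=> il; rewrite normL2_sqr ip_trigpoly; last exact: L2_trigpoly.
congr (_ * _); apply: eq_bigr => j _.
by rewrite fcoef_trigpoly_inj// normc_sqr !expr2.
Qed.

(** The squared distance from [u] to its partial Fourier sum is nonnegative. *)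
Lemma bessel n (l : 'I_n -> int) u : injective l -> L2 a b u ->
  (b - a) * \sum_(j < n) normc (fcoef u (l j)) ^+ 2 <= normL2 a b u ^+ 2.
Proof.
move=> il hu; pose c j := fcoef u (l j).
have hP := L2_trigpoly l c.
have := ip_ge0 a b (fun x => u x - trigpoly l c x).
rewrite ipBl ?ipBr//; last exact: L2B.
rewrite -!normL2_sqr (normL2_trigpoly c il) (ipC _ _ u) !ip_trigpoly//.
rewrite (_ : \sum_(j < n) (_ + _) = \sum_(j < n) normc (fcoef u (l j)) ^+ 2); last first.
  by apply: eq_bigr => j _; rewrite normc_sqr !expr2.
lra.
Qed.

End Fourier.


(** * Convergence of Fourier series and the projection error *)

Section SineBounds.
Context (R : realType).
Implicit Types (x y m : R).

(** A crude form of Jordan's inequality, from the double-angle formula and the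
    mean value theorem. *)
Lemma sin_ge_quarter y : 0 <= y -> y <= pi / 2 -> y / 4 <= sin y.
Proof.
move=> y0 ypi; have p0 := pi_gt0 R; have [->|yn0] := eqVneq y 0; first by rewrite mul0r sin0.
have ygt : 0 < y by rewrite lt_neqAle eq_sym yn0.
have cos_half (z : R) : 0 <= z -> z <= y / 2 -> 2^-1 <= cos z.
  move=> z0 zy; have c2 : 0 <= cos (z *+ 2).
    by apply: cos_ge0_pihalf; rewrite (mulr2n z); apply/andP; split; lra.
  have c1 : 0 <= cos z by apply: cos_ge0_pihalf; apply/andP; split; lra.
  by move: c2; rewrite cos_mulr2n (mulr2n (_ ^+ 2)); nra.
have y2 : 0 < y / 2 by rewrite divr_gt0.
have csin : {within `[0, y / 2], continuous (@sin R)}.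
  by apply: continuous_subspaceT => x; exact: continuous_sin.
have [c cin] := @MVT R sin cos 0 (y / 2) y2 (fun x _ => is_derive_sin x) csin.
rewrite sin0 !subr0 => E.
have cc : 2^-1 <= cos c.
  by move: cin; rewrite in_itv/= => /andP[c0 c1]; apply: cos_half; exact: ltW.
have ch := cos_half (y / 2) (ltW y2) (lexx _).
have -> : sin y = 2 * (cos (y / 2) * sin (y / 2)).
  rewrite {1}(_ : y = (y / 2) *+ 2) ?sin_mulr2n ?mulr_natl//.
  by rewrite (mulr2n (y / 2)); field.
have AB : 4^-1 <= cos (y / 2) * cos c by nra.
have : 0 <= (cos (y / 2) * cos c - 4^-1) * y by rewrite mulr_ge0// subr_ge0.
by rewrite E; lra.
Qed.

(** Reflection at [pi / 2] extends the linear lower bound as long as [y] stays away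
    from [pi]. *)
Lemma sin_ge_linear y m : 0 <= y -> y <= m -> m < pi ->
  (pi - m) / (4 * pi) * y <= sin y.
Proof.
move=> y0 ym mpi; have p0 := pi_gt0 R; have pn0 : pi != 0 :> R by rewrite gt_eqF.
have KK (P : R) : P != 0 -> (P - m) / (4 * P) = (P - m) / P / 4 /\
  (P - m) / 4 = (P - m) / P / 4 * P by move=> P0; split; field.
have [K K'] := KK _ pn0.
have f1 : (pi - m) / pi <= 1 by rewrite ler_pdivrMr// mul1r; lra.
have f0 : 0 <= (pi - m) / pi by apply: divr_ge0; lra.
have [yp|yp] := leP y (pi / 2).
  apply: le_trans (sin_ge_quarter y0 yp); rewrite K.
  by move: f1 f0; move: (_ / pi) => t; nra.
have -> : sin y = sin (pi - y) by rewrite sinD cosN sinN sinpi cospi; ring.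
have B : (pi - y) / 4 <= sin (pi - y) by apply: sin_ge_quarter; lra.
apply: le_trans B; apply: le_trans (_ : (pi - m) / 4 <= _); last by lra.
rewrite K; have yp1 : y <= pi by lra.
rewrite K'.
by apply: ler_wpM2l => //; rewrite divr_ge0.
Qed.

Lemma normc_ei_sub1 (t : R) : Normc.normc (ei t - 1) ^+ 2 = (2 * sin (t / 2)) ^+ 2.
Proof.
rewrite normc_sqr reB imB /=; have := cos2Dsin2 t.
have -> : cos t = 1 - 2 * sin (t / 2) ^+ 2.
  rewrite {1}(_ : t = (t / 2) *+ 2); last by rewrite (mulr2n (t / 2)); field.
  by rewrite cos_mulr2n (mulr2n (_ ^+ 2)); have := cos2Dsin2 (t / 2); lra.
move=> H; rewrite subr0; have -> : sin t ^+ 2 = 1 - (1 - 2 * sin (t / 2) ^+ 2) ^+ 2 by lra.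
ring.
Qed.

End SineBounds.

Lemma bounded_series_terms (R : realType) (f : nat -> R) (B : R) :
  (forall n, 0 <= f n) -> (forall n, \sum_(i < n) f i <= B) ->
  forall eta, 0 < eta -> exists K, forall n, (K <= n)%N -> f n <= eta.
Proof.
move=> f0 fB eta eta0.
have : cvgn (series f).
  apply: nondecreasing_is_cvgn.
    by apply/nondecreasing_seqP => n; rewrite /series/= big_nat_recr//= lerDl.
  by exists B => _ [n _ <-]; rewrite /series/= big_mkord; exact: fB.
move=> /cvg_series_cvg_0 /cvgrPdist_le /(_ eta eta0) [K _ HK].
exists K => n Kn; have := HK n Kn; rewrite sub0r normrN.
by apply: le_trans; exact: ler_norm.
Qed.

Section Convergence.
Context (R : realType) (a b : R).
Hypothesis hab : a < b.
Local Notation D := (`]a, b[%classic : set R).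
Local Notation mu := (@leb R).
Local Notation C := R[i].
Local Notation re := (@complex.Re R).
Local Notation im := (@complex.Im R).
Local Notation normc := (@Normc.normc R).
Local Notation freq := (freq a b).
Local Notation fmode := (fmode a b).
Local Notation fcoef := (fcoef a b).
Local Notation PN := (PN a b).
Implicit Types (u v w g : R -> C) (l m : int).

Let ba0 : b - a != 0. Proof. by rewrite subr_eq0 gt_eqF. Qed.
Let ba_gt0 : 0 < b - a. Proof. by rewrite subr_gt0. Qed.

(** Bessel's inequality makes the squared coefficients summable. *)
Lemma riemann_lebesgue g : L2 a b g -> forall eta : R, 0 < eta ->
  exists K : nat, forall n, (K <= n)%N ->
    normc (fcoef g n%:Z) <= eta /\ normc (fcoef g (- n.+1%:Z)) <= eta.
Proof.
move=> hg eta eta0.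
have H (l : nat -> int) : injective l -> exists K : nat, forall n, (K <= n)%N ->
    normc (fcoef g (l n)) <= eta.
  move=> il.
  have [||K HK] := @bounded_series_terms R (fun n => normc (fcoef g (l n)) ^+ 2)
    ((b - a)^-1 * normL2 a b g ^+ 2) _ _ (eta ^+ 2) (exprn_gt0 2 eta0).
  - by move=> n; exact: sqr_ge0.
  - move=> n; rewrite mulrC ler_pdivlMr// mulrC.
    apply: (@bessel R a b hab n (fun j : 'I_n => l j)) => // i j /il/val_inj; exact.
  - exists K => n /HK; rewrite ler_pXn2r// nnegrE ?normc_ge0// ltW//.
have [|K1 H1] := H (fun n => n%:Z); first by move=> i j [].
have [|K2 H2] := H (fun n => - n.+1%:Z); first by move=> i j /oppr_inj [].
exists (maxn K1 K2) => n; rewrite geq_max => /andP[n1 n2].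
by split; [exact: H1|exact: H2].
Qed.

Lemma PNE N u x : PN N u x =
  \sum_(0 <= i < N) fcoef u (i%:Z - (N./2)%:Z) * fmode (i%:Z - (N./2)%:Z) x.
Proof. by rewrite big_mkord. Qed.

Lemma PNB N u v x : L2 a b u -> L2 a b v ->
  PN N (fun x => u x - v x) x = PN N u x - PN N v x.
Proof.
move=> hu hv; rewrite -sumrB; apply: eq_bigr => j _.
by rewrite fcoefB// mulrBl.
Qed.

Lemma PN_cst K (c : C) x : PN K.+1.*2 (fun=> c) x = c.
Proof.
have E l : fcoef (fun=> c) l = c * (0 == l)%:R.
  rewrite -(fcoef_fmode hab) -fcoefZ//; last exact: L2_fmode.
  by apply: eq_fcoef => z _; rewrite fmodeE freq0 mul0r ei0 mulr1.
have KN : (K.+1 < K.+1.*2)%N by rewrite -addnn; lia.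
rewrite /Defs.PN (bigD1 (Ordinal KN))//= big1 ?addr0.
  by rewrite E /TN /= doubleK subrr eqxx mulr1 fmodeE freq0 mul0r ei0 mulr1.
move=> j jK; rewrite E; case: eqP => [e|_]; last by rewrite mulr0 mul0r.
case/eqP: jK; apply: val_inj => /=; move: e; rewrite /TN doubleK.
by move=> /esym/eqP; rewrite subr_eq0 => /eqP [].
Qed.

(** Pointwise convergence for Lipschitz functions. The difference quotient [g]
    of [u] at [x0] over the unit circle is bounded, and the partial Fourier sums
    of [u] - [u x0] telescope into two Fourier coefficients of [g], which
    tend to zero. *)
Lemma PN_cvg u M x0 : L2 a b u -> a < x0 < b ->
  (forall x, a <= x <= b -> normc (u x - u x0) <= M * `|x - x0|) ->
  forall eta : R, 0 < eta -> exists K0 : nat, forall K, (K0 <= K)%N ->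
    normc (PN K.*2 u x0 - u x0) <= eta.
Proof.
move=> hu /andP[ax0 x0b] lip eta eta0.
have M0 : 0 <= M.
  have := lip a; rewrite lexx (ltW hab) => /(_ isT) /(le_trans (normc_ge0 _)).
  by rewrite pmulr_lge0// normr_gt0 subr_eq0 lt_eqF.
pose q x := ei (freq 1 * (x - x0)) - 1 : C.
have qE x : normc (q x) ^+ 2 = (2 * sin (freq 1 * (x - x0) / 2)) ^+ 2.
  exact: normc_ei_sub1.
pose p x := powR (normc (q x) ^+ 2) (-1).
pose g x := (u x - u x0) * (conjc (q x) * (p x)%:C).
have pE x : p x = (normc (q x) ^+ 2)^-1 by rewrite /p powR_inv1// sqr_ge0.
have f1 : freq 1 = 2 * pi / (b - a) by rewrite /Defs.freq mulr1.
have p0 := pi_gt0 R.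
pose m := pi * Num.max (x0 - a) (b - x0) / (b - a).
have mpi : m < pi.
  rewrite /m -mulrA gtr_pMr// ltr_pdivrMr// mul1r gt_max.
  by apply/andP; split; lra.
have qlow x : a <= x <= b ->
    (pi - m) / (4 * pi) * (2 * pi / (b - a)) * `|x - x0| <= normc (q x).
  move=> /andP[ax xb].
  have -> : normc (q x) = `|2 * sin (freq 1 * (x - x0) / 2)|.
    by rewrite -sqrtr_sqr -qE sqrtr_sqr ger0_norm// normc_ge0.
  have -> : `|2 * sin (freq 1 * (x - x0) / 2)| = `|2 * sin (freq 1 * `|x - x0| / 2)|.
    have [xx0|xx0] := leP 0 (x - x0); first by rewrite [`|x - x0|]ger0_norm.
    by rewrite [`|x - x0|]ltr0_norm// mulrN mulNr sinN mulrN normrN.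
  apply: le_trans (ler_norm _).
  have y0 : 0 <= freq 1 * `|x - x0| / 2.
    by rewrite f1 !mulr_ge0// ?invr_ge0 ?ltW.
  have ym : freq 1 * `|x - x0| / 2 <= m.
    rewrite f1 /m (_ : 2 * pi / (b - a) * `|x - x0| / 2 = pi * `|x - x0| / (b - a)); last by field.
    rewrite ler_pM2r ?invr_gt0// ler_pM2l//.
    rewrite le_max !ler_norml; apply/orP.
    have [?|?] := leP x x0; [left|right]; apply/andP; split; lra.
  have := sin_ge_linear y0 ym mpi; rewrite f1; lra.
pose cl := (pi - m) / (4 * pi) * (2 * pi / (b - a)).
have cl0 : 0 < cl.
  by rewrite /cl !mulr_gt0 ?invr_gt0 ?mulr_gt0 ?subr_gt0.
have gE x : a <= x <= b -> u x - u x0 = g x * q x.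
  move=> xab; have [->|xx0] := eqVneq x x0.
    by rewrite /g subrr mul0r mul0r.
  have qn : normc (q x) ^+ 2 != 0.
    rewrite expf_neq0// gt_eqF//; apply: lt_le_trans (qlow x xab).
    by rewrite -/cl mulr_gt0// normr_gt0 subr_eq0.
  rewrite /g -mulrA -[LHS]mulr1; congr (_ * _); rewrite mulrAC.
  have -> : conjc (q x) * q x = (normc (q x) ^+ 2)%:C.
    by rewrite normc_sqr; case: (q x) => s t /=; apply: complex_ext => /=; ring.
  by rewrite pE -rmorphM/= mulfV.
have gM x : D x -> normc (g x) <= M / cl.
  rewrite inD => /andP[ax xb]; have xab : a <= x <= b by rewrite !ltW.
  rewrite /g; have [->|xx0] := eqVneq x x0.
    by rewrite subrr mul0r Normc.normc0 divr_ge0// ltW.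
  have nq := qlow x xab; rewrite -/cl in nq.
  have x0' : 0 < `|x - x0| by rewrite normr_gt0 subr_eq0.
  have nq0 : 0 < normc (q x) by apply: lt_le_trans nq; rewrite mulr_gt0.
  rewrite !Normc.normcM normc_real pE.
  have -> : normc (conjc (q x)) = normc (q x) by case: (q x) => s t /=; rewrite sqrrN.
  rewrite ger0_norm ?invr_ge0 ?sqr_ge0//.
  rewrite (_ : normc (q x) * _ = (normc (q x))^-1); last by field; rewrite gt_eqF.
  rewrite ler_pdivrMr//; apply: le_trans (lip x xab) _.
  rewrite mulrAC ler_pdivlMr// -mulrA ler_wpM2l// mulrC//.
have mq_re : measurable_fun D (fun x => re (q x)).
  apply: continuous_measD; rewrite (_ : (fun x => _) = (fun x => cos (freq 1 * (x - x0)) - 1)); last first.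
    by apply/funext => x; rewrite /q reB.
  move=> x; apply: cvgB; last exact: cvg_cst.
  exact: (@continuous_cosl R x0 (freq 1)).
have mq_im : measurable_fun D (fun x => im (q x)).
  apply: continuous_measD; rewrite (_ : (fun x => _) = (fun x => sin (freq 1 * (x - x0)))); last first.
    by apply/funext => x; rewrite /q imB subr0.
  exact: (@continuous_sinl R x0 (freq 1)).
have mp : measurable_fun D p.
  rewrite (_ : p = (fun x => powR (re (q x) ^+ 2 + im (q x) ^+ 2) (-1))); last first.
    by apply/funext => x; rewrite /p normc_sqr.
  apply: (measurableT_comp (measurable_powR _)).
  by apply: measurable_funD; exact: measurable_funX.
have hd := L2B hu (L2_cst a b (u x0)).
have [hdr hdi] := (L2_parts _ _ _).1 hd.
have hg : L2 a b g.
  apply: (@L2_bounded _ _ _ _ (M / cl)) => //.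
  - rewrite (_ : (fun x => _) = (fun x => re (u x - u x0) * (re (q x) * p x) +
       im (u x - u x0) * (im (q x) * p x))); last first.
      by apply/funext => x; rewrite /g !reM !imM; case: (q x) => s t /=; ring.
    apply: measurable_funD; apply: measurable_funM; try exact: measurable_funM.
      exact: hdr.1.
    exact: hdi.1.
  - rewrite (_ : (fun x => _) = (fun x => im (u x - u x0) * (re (q x) * p x) -
       re (u x - u x0) * (im (q x) * p x))); last first.
      by apply/funext => x; rewrite /g !imM !reM; case: (q x) => s t /=; ring.
    apply: measurable_funB; apply: measurable_funM; try exact: measurable_funM.
      exact: hdi.1.
    exact: hdr.1.
pose gam l := fcoef g l * fmode l x0.
have dcoef l : fcoef (fun x => u x - u x0) l * fmode l x0 = gam (l - 1) - gam l.
  rewrite (@eq_fcoef _ _ _ _ (fun x => ei (- (freq 1 * (x0 - a))) * (fmode 1 x * g x) - g x)); last first.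
    move=> x; rewrite inD => /andP[ax xb]; rewrite gE ?(ltW ax) ?(ltW xb)// /q.
    rewrite (_ : freq 1 * (x - x0) = - (freq 1 * (x0 - a)) + freq 1 * (x - a)); last by ring.
    rewrite eiD -fmodeE; ring.
  have h1g : L2 a b (fun x => fmode 1 x * g x).
    apply: (@L2_mulb _ _ _ _ _ 1) => //.
    - by rewrite re_fmode_fun; exact (continuous_measD (continuous_cosl (r := freq 1))).
    - by rewrite im_fmode_fun; exact (continuous_measD (continuous_sinl (r := freq 1))).
    - by move=> x _; rewrite normc_fmode.
  rewrite fcoefB//; last exact: L2Z.
  rewrite fcoefZ//.
  have -> : fcoef (fun x => fmode 1 x * g x) l = fcoef g (l - 1).
    rewrite /Defs.fcoef; congr (_ * cintegral _ _ _); apply/funext => x.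
    rewrite !cexp_Ni freqD freqN mulrDl mulNr opprD opprK eiD -!fmodeE; ring.
  rewrite /gam mulrBl; congr (_ - _).
  have F : fmode l x0 = fmode (l - 1) x0 * ei (freq 1 * (x0 - a)).
    by rewrite -fmodeE -fmodeD subrK.
  rewrite F; transitivity (fcoef g (l - 1) * fmode (l - 1) x0 *
    (ei (freq 1 * (x0 - a)) * ei (- (freq 1 * (x0 - a))))); first by ring.
  by rewrite eiNK mulr1.
have eta2 : 0 < eta / 2 by rewrite divr_gt0.
have [K0 HK0] := riemann_lebesgue hg eta2.
exists K0.+1 => -[//|K] KK.
have -> : PN K.+1.*2 u x0 - u x0 = gam (- K.+2%:Z) - gam K%:Z.
  have -> : PN K.+1.*2 u x0 - u x0 = PN K.+1.*2 (fun x => u x - u x0) x0.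
    rewrite PNB//; last exact: L2_cst.
    by rewrite PN_cst.
  rewrite PNE doubleK.
  rewrite (eq_bigr (fun i : nat => - gam (i.+1%:Z - K.+2%:Z) - - gam (i%:Z - K.+2%:Z))); last first.
    move=> i _; rewrite dcoef opprK addrC; congr (- gam _ + gam _); clear; lia.
  rewrite telescope_sumr// opprK addrC; by congr (gam _ - gam _); clear; lia.
apply: le_trans (normcB _ _) _; rewrite /gam !(Normc.normcM (fcoef _ _)) !normc_fmode !mulr1.
have [_ H1] := HK0 K.+1 (leq_trans KK (leqnSn _)).
have [H2 _] := HK0 K KK.
by move: H1 H2; clear; lra.
Qed.

End Convergence.


Section Projection.
Context (R : realType) (a b : R).
Hypothesis hab : a < b.
Local Notation D := (`]a, b[%classic : set R).
Local Notation mu := (@leb R).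
Local Notation C := R[i].
Local Notation re := (@complex.Re R).
Local Notation im := (@complex.Im R).
Local Notation normc := (@Normc.normc R).
Local Notation freq := (freq a b).
Local Notation fmode := (fmode a b).
Local Notation fcoef := (fcoef a b).
Local Notation PN := (PN a b).
Implicit Types (u v w g : R -> C) (l m : int).

Let ba0 : b - a != 0. Proof. by rewrite subr_eq0 gt_eqF. Qed.
Let ba_gt0 : 0 < b - a. Proof. by rewrite subr_gt0. Qed.

(** The frequencies kept by [PN K.*2]. *)
Definition low (K : nat) l := (- K%:Z <= l) && (l < K%:Z).

Lemma sum_low (V : zmodType) (F : int -> V) (K M : nat) : (K <= M)%N ->
  \sum_(0 <= i < M.*2) (if low K (i%:Z - M%:Z) then F (i%:Z - M%:Z) else 0) =
  \sum_(0 <= i < K.*2) F (i%:Z - K%:Z).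
Proof.
move=> KM; rewrite -!addnn.
rewrite (@big_cat_nat _ _ _ (M - K) 0) ?leq0n//=; last by lia.
rewrite big_nat_cond big1 ?add0r; last first.
  by move=> i /andP[/andP[_ iK] _]; rewrite /low ifF//; lia.
rewrite (@big_cat_nat _ _ _ (M + K) (M - K))/=; [|lia|lia].
rewrite [X in _ + X]big_nat_cond [X in _ + X]big1 ?addr0; last first.
  by move=> i /andP[/andP[Ki _] _]; rewrite /low ifF//; lia.
rewrite -{1}[(M - K)%N]add0n big_addn.
rewrite (_ : (M + K - (M - K))%N = (K + K)%N); last by lia.
rewrite big_nat_cond [RHS]big_nat_cond; apply: eq_bigr => i /andP[/andP[_ iK] _].
rewrite (_ : (i + (M - K))%:Z - M%:Z = i%:Z - K%:Z); last by lia.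
by rewrite /low ifT//; lia.
Qed.

Lemma TN_inj N : injective (@TN N).
Proof. by move=> i j; rewrite /TN => /addIr [] /val_inj. Qed.

Lemma PN_trigpoly N u : PN N u = trigpoly a b (@TN N) (fun j => fcoef u (TN j)).
Proof. by []. Qed.

Lemma L2_PN N u : L2 a b (PN N u).
Proof. exact: L2_trigpoly. Qed.

Definition tail_coef K M u (j : 'I_M.*2) : C :=
  if low K (TN j) then 0 else fcoef u (TN j).

Lemma PN_tail K M u x : (K <= M)%N ->
  PN M.*2 u x - PN K.*2 u x = trigpoly a b (@TN M.*2) (@tail_coef K M u) x.
Proof.
move=> KM; rewrite !PNE !doubleK.
rewrite -(sum_low (fun l => fcoef u l * fmode l x) KM) -sumrB.
rewrite /trigpoly big_mkord; apply: eq_bigr => j _.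
rewrite /tail_coef /TN doubleK; case: ifP => _; first by rewrite subrr mul0r.
by rewrite subr0.
Qed.

Lemma freq_high K l : ~~ low K l -> 2 * pi * K%:R / (b - a) <= `|freq l|.
Proof.
move=> H; have p0 := pi_gt0 R.
rewrite /Defs.freq normrM normrM gtr0_norm ?mulr_gt0// (@gtr0_norm _ (b - a)^-1) ?invr_gt0//.
apply: ler_wpM2r; first by rewrite invr_ge0 ltW.
apply: ler_wpM2l; first by rewrite mulr_ge0// ltW.
rewrite -intr_norm -[K%:R]/(K%:Z%:~R) ler_int.
by move: H; rewrite /low; lia.
Qed.

(** Each discarded frequency is at least [2 pi K / (b - a)], which is paid [k] times
    by the hypothesis on the coefficients; Bessel sums up. *)
Lemma tail_bound K M k u g : (0 < K)%N -> (K <= M)%N -> L2 a b g ->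
  (forall l, `|freq l| ^+ k * normc (fcoef u l) <= normc (fcoef g l)) ->
  normL2 a b (fun x => PN M.*2 u x - PN K.*2 u x) <=
  ((b - a) / (2 * pi * K%:R)) ^+ k * normL2 a b g.
Proof.
move=> K0 KM hg H; have p0 := pi_gt0 R.
have Kr : 0 < K%:R :> R by rewrite ltr0n.
set r := (b - a) / _.
have r0 : 0 < r by rewrite divr_gt0// !mulr_gt0.
have rk : 0 < r ^+ k by rewrite exprn_gt0.
rewrite (_ : (fun x => _) = trigpoly a b (@TN M.*2) (@tail_coef K M u)); last first.
  by apply/funext => x; rewrite PN_tail.
rewrite -(@ler_pXn2r _ 2)// ?nnegrE ?mulr_ge0 ?normL2_ge0 ?(ltW rk)// exprMn.
rewrite normL2_trigpoly//; last exact: TN_inj.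
apply: le_trans (_ : r ^+ k ^+ 2 * ((b - a) * \sum_(j < M.*2) normc (fcoef g (TN j)) ^+ 2) <= _).
  rewrite mulrCA; apply: ler_wpM2l; first exact: ltW.
  rewrite mulr_sumr; apply: ler_sum => j _.
  rewrite -exprMn lerXn2r ?nnegrE ?mulr_ge0 ?normc_ge0 ?(ltW rk)//.
  rewrite /tail_coef; case: ifP => [_|/negbT hi].
    by rewrite Normc.normc0 mulr_ge0 ?normc_ge0 ?(ltW rk).
  have := H (TN j); have := freq_high hi => F1 F2.
  have F3 : 1 <= r ^+ k * `|freq (TN j)| ^+ k.
    rewrite -exprMn exprn_ege1// /r; apply: le_trans (ler_wpM2l (ltW r0) F1).
    rewrite /r le_eqVlt; apply/orP; left; apply/eqP.
    have : 2 * pi * K%:R != 0 :> R by rewrite gt_eqF// !mulr_gt0.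
    by move: (2 * pi * K%:R) => P P0; field; rewrite ba0.
  apply: le_trans (ler_wpM2l (ltW rk) F2); rewrite mulrA ler_peMl//.
  exact: normc_ge0.
rewrite ler_wpM2l ?sqr_ge0//; apply: bessel => //; exact: TN_inj.
Qed.

(** The tail bound does not depend on the number of added frequencies; pointwise
    convergence and Fatou's lemma pass to the limit. *)
Lemma proj_error K k u g M : (0 < K)%N -> L2 a b u -> L2 a b g ->
  (forall x y, a <= x <= b -> a <= y <= b -> normc (u x - u y) <= M * `|x - y|) ->
  (forall l, `|freq l| ^+ k * normc (fcoef u l) <= normc (fcoef g l)) ->
  normL2 a b (fun x => u x - PN K.*2 u x) <=
  ((b - a) / (2 * pi * K%:R)) ^+ k * normL2 a b g.
Proof.
move=> K0 hu hg lip H; set B := _ * normL2 a b g.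
have B0 : 0 <= B.
  by rewrite mulr_ge0 ?normL2_ge0// exprn_ge0// divr_ge0 ?(ltW ba_gt0)// !mulr_ge0 ?pi_ge0.
pose f n x : \bar R := (normc (PN (K + n).*2 u x - PN K.*2 u x) ^+ 2)%:E.
have hf n : L2 a b (fun x => PN (K + n).*2 u x - PN K.*2 u x).
  by apply: L2B; exact: L2_PN.
have iin n : mu.-integrable D (f n) by case: (hf n).
have mf n := measurable_int mu (iin n).
have f0 n x : D x -> (0 <= f n x)%E by move=> _; rewrite lee_fin sqr_ge0.
have fB n : (\int[mu]_(x in D) f n x <= (B ^+ 2)%:E)%E.
  have fin := @integrable_fin_num _ _ _ mu D (@mD R a b) _ (iin n).
  rewrite -(fineK fin) lee_fin.
  rewrite -[leLHS]sqr_sqrtr; last by apply: fine_ge0; apply: (@integral_ge0 _ _ _ mu D (f n)); exact: f0.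
  rewrite lerXn2r ?nnegrE ?sqrtr_ge0//.
  by apply: (tail_bound K0 (leq_addr n K) hg H).
have lim x : D x -> limn_einf (f^~ x) = (normc (u x - PN K.*2 u x) ^+ 2)%:E.
  rewrite inD => xab; move: (xab) => /andP[ax xb].
  have lipx z : a <= z <= b -> normc (u z - u x) <= M * `|z - x|.
    by move=> zab; apply: lip => //; rewrite !ltW.
  have cv := PN_cvg hab hu xab lipx.
  suff : f n x @[n --> \oo] --> (normc (u x - PN K.*2 u x) ^+ 2)%:E.
    by move=> c; have [-> _] := cvg_limn_einf_sup c.
  apply: cvg_EFin; first by apply: nearW.
  have cn : normc (PN (K + n).*2 u x - PN K.*2 u x) @[n --> \oo] --> normc (u x - PN K.*2 u x).
    apply/cvgrPdist_le => eta eta0; have [K1 HK1] := cv eta eta0.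
    exists K1 => // n /= K1n; have := HK1 (K + n)%N (leq_trans K1n (leq_addl _ _)).
    set p := PN _ u x; set q := PN _ u x => Hp.
    have := normcD (p - u x) (u x - q); have := normcD (u x - p) (p - q).
    rewrite !addrA !subrK -(normcN (u x - p)) opprB => N1 N2.
    by rewrite ler_norml; apply/andP; split; lra.
  rewrite /comp /=.
  exact: (cvgM cn cn).
have I := @fatou _ _ R mu D (@mD R a b) f mf f0.
have E : (\int[mu]_(x in D) (normc (u x - PN K.*2 u x) ^+ 2)%:E =
    \int[mu]_(x in D) limn_einf (f^~ x))%E.
  by apply: (@eq_integral _ _ R mu D) => x; rewrite inE => Dx; rewrite lim.
have hw : L2 a b (fun x => u x - PN K.*2 u x) by apply: L2B => //; exact: L2_PN.
have J : (\int[mu]_(x in D) (normc (u x - PN K.*2 u x) ^+ 2)%:E <= (B ^+ 2)%:E)%E.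
  rewrite E; apply: (le_trans I); rewrite limn_einf_lim; apply: lime_le.
    exact: is_cvg_einfs.
  apply: nearW => n; apply: le_trans (fB n).
  by apply: ereal_inf_lbound; exists n => /=.
rewrite -(@ler_pXn2r _ 2)// ?nnegrE ?normL2_ge0// /normL2 sqr_sqrtr; last first.
  by apply: intg_ge0 => x _; exact: sqr_ge0.
have [_ _ iw] := hw.
have fin := @integrable_fin_num _ _ _ mu D (@mD R a b) _ iw.
by rewrite -lee_fin /Rintegral fineK.
Qed.

End Projection.


(** * The power nonlinearity *)

Section PowerNonlinearity.
Context (R : realType).
Implicit Types (x y p q t u s e r : R).

Lemma normM_le x y p q : `|x| <= p -> `|y| <= q -> `|x * y| <= p * q.
Proof. by move=> xp yq; rewrite normrM; apply: ler_pM. Qed.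

Lemma normD_le x y p q : `|x| <= p -> `|y| <= q -> `|x + y| <= p + q.
Proof. by move=> xp yq; apply: le_trans (ler_normD _ _) _; exact: lerD. Qed.

Lemma mvt01 (f df : R -> R) : (forall x, is_derive x (1:R) f (df x)) ->
  exists2 c, 0 < c < 1 & f 1 - f 0 = df c.
Proof.
move=> H; have cf := is_derive_continuous H.
have cw : {within `[0, 1], continuous f} by exact: continuous_subspaceT.
have [c c01 E] := MVT ltr01 (fun x _ => H x) cw.
by exists c; [move: c01; rewrite in_itv|rewrite E subr0 mulr1].
Qed.

Lemma is_derive_powRc (q : R -> R) (t dq s : R) : 0 < q t -> is_derive t (1:R) q dq ->
  is_derive t (1:R) (fun t => q t `^ s) (s * q t `^ (s - 1) * dq).
Proof.
move=> q0 H; have K := is_derive1_powR s q0.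
by have := @is_derive1_comp _ (@powR R ^~ s) q t _ _ K H.
Qed.

Lemma powR_shift q s : 0 <= q -> 0 < s -> forall eta : R, 0 < eta ->
  exists2 d : R, 0 < d & forall e, 0 < e -> e < d -> `|(q + e) `^ s - q `^ s| <= eta.
Proof.
move=> q0 s0 eta eta0; have [->|qn0] := eqVneq q 0.
  have /cvgrPdist_le/(_ eta eta0) := powR_cvg0 s0.
  rewrite nearE /= => -[d /= d0 Hd]; exists d => // e e0 ed.
  have := Hd e; rewrite /= sub0r normrN gtr0_norm// => /(_ ed e0).
  by rewrite sub0r normrN add0r powR0 ?gt_eqF// subr0.
have qgt : 0 < q by rewrite lt_neqAle eq_sym qn0.
have K := is_derive1_powR s qgt.
have : {for q, continuous (@powR R ^~ s)}.
  by apply: differentiable_continuous; apply/derivable1_diffP; case: K.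
move=> /cvgrPdist_le /(_ eta eta0); rewrite nearE /= => /nbhs_ballP[d /= d0 Hd].
exists d => // e e0 ed; rewrite distrC; apply: Hd.
by rewrite /ball/= opprD addrA subrr sub0r normrN gtr0_norm.
Qed.

(** Takes the values [p4], [p3], [p2], [p1] at (0, 0), (1, 0), (0, 1), (1, 1); along
    it, a mixed second difference becomes a mixed second derivative. *)
Definition bilin (p1 p2 p3 p4 t u : R) : R :=
  p4 + t * (p3 - p4) + u * (p2 - p4) + t * u * (p1 - p2 - p3 + p4).

Lemma is_derive_bilin1 p1 p2 p3 p4 t u :
  is_derive t (1:R) (bilin p1 p2 p3 p4 ^~ u) (p3 - p4 + u * (p1 - p2 - p3 + p4)).
Proof. by apply: is_derive_eq; rewrite /GRing.scale/=; ring. Qed.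

Lemma is_derive_bilin2 p1 p2 p3 p4 t u :
  is_derive u (1:R) (bilin p1 p2 p3 p4 t) (p2 - p4 + t * (p1 - p2 - p3 + p4)).
Proof. by apply: is_derive_eq; rewrite /GRing.scale/=; ring. Qed.

Lemma bilin_bound p1 p2 p3 p4 t u r : 0 < t < 1 -> 0 < u < 1 ->
  `|p1| <= r -> `|p2| <= r -> `|p3| <= r -> `|p4| <= r ->
  `|bilin p1 p2 p3 p4 t u| <= 9 * r.
Proof.
move=> /andP[t0 t1] /andP[u0 u1] h1 h2 h3 h4.
have ht : `|t| <= 1 by rewrite ger0_norm ltW.
have hu : `|u| <= 1 by rewrite ger0_norm ltW.
have B34 : `|p3 - p4| <= 2 * r by apply: le_trans (ler_normB _ _) _; lra.
have B24 : `|p2 - p4| <= 2 * r by apply: le_trans (ler_normB _ _) _; lra.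
have B4 : `|p1 - p2 - p3 + p4| <= 4 * r.
  rewrite (_ : _ + p4 = (p1 - p2) - (p3 - p4)); last by ring.
  apply: le_trans (ler_normB _ _) _.
  by have := ler_normB p1 p2; lra.
have := normD_le (normD_le (normD_le h4 (normM_le ht B34)) (normM_le hu B24))
  (normM_le (normM_le ht hu) B4).
by rewrite /bilin; lra.
Qed.

Lemma bilin_slope p1 p2 p3 p4 u : 0 < u < 1 ->
  `|p3 - p4 + u * (p1 - p2 - p3 + p4)| <= `|p1 - p2| + `|p3 - p4|.
Proof.
move=> /andP[u0 u1].
have hu : 0 <= u by exact: ltW.
have hu' : 0 <= 1 - u by lra.
have -> : p3 - p4 + u * (p1 - p2 - p3 + p4) = u * (p1 - p2) + (1 - u) * (p3 - p4) by ring.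
apply: le_trans (ler_normD _ _) _; rewrite !normrM (ger0_norm hu) (ger0_norm hu').
apply: lerD; apply: ler_piMl => //; lra.
Qed.

(** Size of a mixed second derivative of [Q `^ s * x], where [Q] is
    [x ^+ 2 + y ^+ 2 + e]: the singular powers of [Q] are absorbed by the factors
    [x] and [y], which are at most the square root of [Q]. *)
Lemma mixed_deriv_bound s e r x y xt yt xu yu dx dy (A B E : R) :
  1 / 2 <= s -> 0 < e -> e <= 1 -> 1 <= r -> `|x| <= 9 * r -> `|y| <= 9 * r ->
  `|xt| + `|yt| <= A -> `|xu| + `|yu| <= B -> `|dx| + `|dy| <= E ->
  forall Q Qt Qu Qtu : R, Q = x ^+ 2 + y ^+ 2 + e ->
  Qt = 2 * (x * xt + y * yt) -> Qu = 2 * (x * xu + y * yu) ->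
  Qtu = 2 * (xu * xt + x * dx + (yu * yt + y * dy)) ->
  `|s * ((s - 1) * Q `^ (s - 1 - 1) * Qu) * Qt * x + s * Q `^ (s - 1) * Qtu * x +
    s * Q `^ (s - 1) * Qt * xu + (s * Q `^ (s - 1) * Qu * xt + Q `^ s * dx)| <=
  (4 * s * `|s - 1| + 6 * s) * (163 * r ^+ 2) `^ (s - 1 / 2) * (A * B) +
  (2 * s + 1) * (163 * r ^+ 2) `^ s * E.
Proof.
move=> s12 e0 e1 r1 hX hY XA XB XE Q Qt Qu Qtu QE QtE QuE QtuE.
have s0 : 0 < s by lra.
have q0 : 0 < Q by rewrite QE ltr_wpDl// addr_ge0 ?sqr_ge0.
pose rho := Num.sqrt (Q).
have rho0 : 0 < rho by rewrite sqrtr_gt0.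
have rho2 : rho * rho = Q by rewrite -expr2 sqr_sqrtr// ltW.
have Xr : `|x| <= rho.
  by rewrite -sqrtr_sqr; apply: ler_wsqrtr; rewrite QE; have := sqr_ge0 (y); lra.
have Yr : `|y| <= rho.
  by rewrite -sqrtr_sqr; apply: ler_wsqrtr; rewrite QE; have := sqr_ge0 (x); lra.
have qn0 : Q != 0 by rewrite gt_eqF.
pose P := Q `^ (s - 1).
have P0 : 0 < P by apply: powR_gt0.
have Ps : Q `^ s = P * Q.
  have := @powRD R (Q) (s - 1) 1; rewrite qn0 implybT => /(_ isT).
  by rewrite subrK powRr1// ltW.
have Pm : Q `^ (s - 1 - 1) * Q = P.
  have := @powRD R (Q) (s - 1 - 1) 1; rewrite qn0 implybT => /(_ isT).
  by rewrite subrK powRr1// ltW.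
(* [163 = 9 ^ 2 + 9 ^ 2 + 1]. *)
have Qm : Q <= 163 * r ^+ 2.
  have r2 : 1 <= r ^+ 2 by rewrite exprn_ege1.
  have sq9 z : `|z| <= 9 * r -> z ^+ 2 <= 81 * r ^+ 2.
    move=> hz; rewrite -(@real_normK _ z) ?num_real//.
    have -> : 81 * r ^+ 2 = (9 * r) ^+ 2 by ring.
    by rewrite lerXn2r ?nnegrE//; lra.
  by rewrite QE; have := sq9 _ hX; have := sq9 _ hY; lra.
have m0 : 0 <= 163 * r ^+ 2 by rewrite mulr_ge0 ?sqr_ge0.
pose k1 := (163 * r ^+ 2) `^ (s - 1 / 2); pose k2 := (163 * r ^+ 2) `^ s.
have Prho : P * rho <= k1.
  have -> : P * rho = Q `^ (s - 1 / 2).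
    rewrite /rho -powR12_sqrt; last exact: ltW.
    rewrite /P -powRD; last by rewrite qn0 implybT.
    by congr powR; field.
  by apply: ge0_ler_powR; rewrite ?nnegrE ?(ltW q0)//; lra.
have PQ : P * Q <= k2.
  by rewrite -Ps; apply: ge0_ler_powR; rewrite ?nnegrE ?(ltW q0) ?(ltW s0).
have A0 : 0 <= A by apply: le_trans XA; rewrite addr_ge0.
have B0 : 0 <= B by apply: le_trans XB; rewrite addr_ge0.
have E0 : 0 <= E by apply: le_trans XE; rewrite addr_ge0.
have Qt_le : `|Qt| <= 2 * rho * A.
  rewrite QtE.
  apply: le_trans (normM_le (_ : `|2| <= 2) (normD_le (normM_le Xr (lexx _)) (normM_le Yr (lexx _)))) _.
    by rewrite ger0_norm.
  by rewrite -mulrDr mulrA; apply: ler_wpM2l => //; rewrite mulr_ge0// ltW.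
have Qu_le : `|Qu| <= 2 * rho * B.
  rewrite QuE.
  apply: le_trans (normM_le (_ : `|2| <= 2) (normD_le (normM_le Xr (lexx _)) (normM_le Yr (lexx _)))) _.
    by rewrite ger0_norm.
  by rewrite -mulrDr mulrA; apply: ler_wpM2l => //; rewrite mulr_ge0// ltW.
have Xt_le : `|xt| <= A by apply: le_trans XA; rewrite lerDl.
have Xu_le : `|xu| <= B by apply: le_trans XB; rewrite lerDl.
have Yt_le : `|yt| <= A by apply: le_trans XA; rewrite lerDr.
have Yu_le : `|yu| <= B by apply: le_trans XB; rewrite lerDr.
have Qtu_le : `|Qtu| <= 2 * (A * B + rho * E).
  rewrite QtuE normrM ger0_norm// ler_wpM2l//.
  rewrite (_ : _ + _ = xu * xt + yu * yt + (x * dx + y * dy)); last by ring.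
  apply: normD_le.
    apply: le_trans (normD_le (normM_le (lexx _) Xt_le) (normM_le (lexx _) Yt_le)) _.
    by rewrite -mulrDl mulrC ler_wpM2l.
  apply: le_trans (normD_le (normM_le Xr (lexx _)) (normM_le Yr (lexx _))) _.
  by rewrite -mulrDr; apply: ler_wpM2l => //; exact: ltW.
have dx_le : `|dx| <= E by apply: le_trans XE; rewrite lerDl.
have Pn : `|P| <= P by rewrite gtr0_norm.
have sn : `|s| <= s by rewrite gtr0_norm.
have AB0 : 0 <= A * B by exact: mulr_ge0.
pose W := Q `^ (s - 1 - 1).
have W0 : 0 < W by apply: powR_gt0.
have Wn : `|W| <= W by rewrite gtr0_norm.
have T1 : `|s * ((s - 1) * W * Qu) * Qt * x| <=
    4 * s * `|s - 1| * (k1 * (A * B)).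
  apply: le_trans (normM_le (normM_le (normM_le sn (normM_le (normM_le (lexx `|s - 1|) Wn) Qu_le)) Qt_le) Xr) _.
  have -> : s * (`|s - 1| * W * (2 * rho * B)) * (2 * rho * A) * rho =
     4 * s * `|s - 1| * ((W * (rho * rho) * rho) * (A * B)) by ring.
  rewrite rho2 Pm; apply: ler_wpM2l; first by rewrite !mulr_ge0// ltW.
  exact: ler_wpM2r.
have T2 : `|s * P * Qtu * x| <= 2 * s * (k1 * (A * B) + k2 * E).
  apply: le_trans (normM_le (normM_le (normM_le sn Pn) Qtu_le) Xr) _.
  have -> : s * P * (2 * (A * B + rho * E)) * rho =
     2 * s * (P * rho * (A * B) + P * (rho * rho) * E) by ring.
  rewrite rho2; apply: ler_wpM2l; first by rewrite mulr_ge0// ltW.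
  by apply: lerD; apply: ler_wpM2r.
have T3 : `|s * P * Qt * xu| <= 2 * s * (k1 * (A * B)).
  apply: le_trans (normM_le (normM_le (normM_le sn Pn) Qt_le) Xu_le) _.
  have -> : s * P * (2 * rho * A) * B = 2 * s * (P * rho * (A * B)) by ring.
  apply: ler_wpM2l; first by rewrite mulr_ge0// ltW.
  exact: ler_wpM2r.
have T4 : `|s * P * Qu * xt| <= 2 * s * (k1 * (A * B)).
  apply: le_trans (normM_le (normM_le (normM_le sn Pn) Qu_le) Xt_le) _.
  have -> : s * P * (2 * rho * B) * A = 2 * s * (P * rho * (A * B)) by ring.
  apply: ler_wpM2l; first by rewrite mulr_ge0// ltW.
  exact: ler_wpM2r.
have T5 : `|Q `^ s * dx| <= k2 * E.
  by apply: normM_le => //; rewrite gtr0_norm ?powR_gt0// Ps.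
apply: le_trans (normD_le (normD_le (normD_le T1 T2) T3) (normD_le T4 T5)) _.
rewrite -/k1 -/k2; clear; lra.
Qed.

Section Regularized.
Variables (s e : R) (x1 x2 x3 x4 y1 y2 y3 y4 : R).
Hypotheses (s12 : 1 / 2 <= s) (e0 : 0 < e) (e1 : e <= 1).

Let X := bilin x1 x2 x3 x4.
Let Y := bilin y1 y2 y3 y4.
Let dX := x1 - x2 - x3 + x4.
Let dY := y1 - y2 - y3 + y4.
Let Xt u := x3 - x4 + u * dX.
Let Yt u := y3 - y4 + u * dY.
Let Xu t := x2 - x4 + t * dX.
Let Yu t := y2 - y4 + t * dY.
Let Q t u := X t u ^+ 2 + Y t u ^+ 2 + e.
Let Qt t u := 2 * (X t u * Xt u + Y t u * Yt u).
Let Qu t u := 2 * (X t u * Xu t + Y t u * Yu t).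
Let Qtu t u := 2 * (Xu t * Xt u + X t u * dX + (Yu t * Yt u + Y t u * dY)).
Let g t u := Q t u `^ s * X t u.
Let gt_ t u := s * Q t u `^ (s - 1) * Qt t u * X t u + Q t u `^ s * Xt u.
Let gtu t u :=
  s * ((s - 1) * Q t u `^ (s - 1 - 1) * Qu t u) * Qt t u * X t u +
  s * Q t u `^ (s - 1) * Qtu t u * X t u + s * Q t u `^ (s - 1) * Qt t u * Xu t +
  (s * Q t u `^ (s - 1) * Qu t u * Xt u + Q t u `^ s * dX).

Let Q0 t u : 0 < Q t u.
Proof. by rewrite /Q ltr_wpDl// addr_ge0 ?sqr_ge0. Qed.

Let dX1 t u : is_derive t (1:R) (X ^~ u) (Xt u).
Proof. exact: is_derive_bilin1. Qed.
Let dX2 t u : is_derive u (1:R) (X t) (Xu t).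
Proof. exact: is_derive_bilin2. Qed.
Let dY1 t u : is_derive t (1:R) (Y ^~ u) (Yt u).
Proof. exact: is_derive_bilin1. Qed.
Let dY2 t u : is_derive u (1:R) (Y t) (Yu t).
Proof. exact: is_derive_bilin2. Qed.

Let dQ1 t u : is_derive t (1:R) (Q ^~ u) (Qt t u).
Proof.
have H1 := dX1 t u; have H2 := dY1 t u.
by apply: is_derive_eq; rewrite /Qt /GRing.scale/=; ring.
Qed.

Let dQ2 t u : is_derive u (1:R) (Q t) (Qu t u).
Proof.
have H1 := dX2 t u; have H2 := dY2 t u.
by apply: is_derive_eq; rewrite /Qu /GRing.scale/=; ring.
Qed.

Let dg t u : is_derive t (1:R) (g ^~ u) (gt_ t u).
Proof.
have H1 := dX1 t u; have H2 := @is_derive_powRc (Q ^~ u) t _ s (Q0 t u) (dQ1 t u).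
by apply: is_derive_eq; rewrite /gt_ /GRing.scale/=; ring.
Qed.

Let dgt t u : is_derive u (1:R) (gt_ t) (gtu t u).
Proof.
have H1 := dX2 t u; have H2 := dY2 t u.
have H3 := @is_derive_powRc (Q t) u _ s (Q0 t u) (dQ2 t u).
have H4 := @is_derive_powRc (Q t) u _ (s - 1) (Q0 t u) (dQ2 t u).
have H5 : is_derive u (1:R) Xt dX.
  by apply: is_derive_eq; rewrite /GRing.scale/=; ring.
have H6 : is_derive u (1:R) Yt dY.
  by apply: is_derive_eq; rewrite /GRing.scale/=; ring.
have H7 : is_derive u (1:R) (Qt t) (Qtu t u).
  by apply: is_derive_eq; rewrite /Qtu /GRing.scale/=; ring.
by apply: is_derive_eq; rewrite /gtu /GRing.scale/=; ring.
Qed.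

Let A := `|x1 - x2| + `|x3 - x4| + (`|y1 - y2| + `|y3 - y4|).
Let B := `|x1 - x3| + `|x2 - x4| + (`|y1 - y3| + `|y2 - y4|).
Let E := `|dX| + `|dY|.

(** The mean value theorem, once in each parameter of the bilinear interpolation.
    The parameter [e] keeps the power smooth and is absent from the constants. *)
Lemma par_regularized r : 1 <= r ->
  `|x1| <= r -> `|x2| <= r -> `|x3| <= r -> `|x4| <= r ->
  `|y1| <= r -> `|y2| <= r -> `|y3| <= r -> `|y4| <= r ->
  `|(x1 ^+ 2 + y1 ^+ 2 + e) `^ s * x1 - (x2 ^+ 2 + y2 ^+ 2 + e) `^ s * x2
    - (x3 ^+ 2 + y3 ^+ 2 + e) `^ s * x3 + (x4 ^+ 2 + y4 ^+ 2 + e) `^ s * x4| <=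
  (4 * s * `|s - 1| + 6 * s) * (163 * r ^+ 2) `^ (s - 1 / 2) * (A * B) +
  (2 * s + 1) * (163 * r ^+ 2) `^ s * E.
Proof.
move=> r1 hx1 hx2 hx3 hx4 hy1 hy2 hy3 hy4.
have [t t01 Et] := @mvt01 (fun t => g t 1 - g t 0) (fun t => gt_ t 1 - gt_ t 0)
  (fun t => is_deriveB (dg t 1) (dg t 0)).
have [u u01 Eu] := @mvt01 (gt_ t) (gtu t) (dgt t).
have -> : (x1 ^+ 2 + y1 ^+ 2 + e) `^ s * x1 - (x2 ^+ 2 + y2 ^+ 2 + e) `^ s * x2
    - (x3 ^+ 2 + y3 ^+ 2 + e) `^ s * x3 + (x4 ^+ 2 + y4 ^+ 2 + e) `^ s * x4 = gtu t u.
  rewrite -Eu -Et /g /Q /X /Y /bilin.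
  have Z (p q w z : R) : [/\ z + 1 * (w - z) + 1 * (q - z) + 1 * 1 * (p - q - w + z) = p,
      z + 0 * (w - z) + 1 * (q - z) + 0 * 1 * (p - q - w + z) = q,
      z + 1 * (w - z) + 0 * (q - z) + 1 * 0 * (p - q - w + z) = w &
      z + 0 * (w - z) + 0 * (q - z) + 0 * 0 * (p - q - w + z) = z] by split; ring.
  have [-> -> -> ->] := Z x1 x2 x3 x4; have [-> -> -> ->] := Z y1 y2 y3 y4; ring.
have hX : `|X t u| <= 9 * r by apply: bilin_bound.
have hY : `|Y t u| <= 9 * r by apply: bilin_bound.
have XA : `|Xt u| + `|Yt u| <= A by apply: lerD; exact: bilin_slope.
have XB : `|Xu t| + `|Yu t| <= B.
  have slope (p1 p2 p3 p4 : R) : `|p2 - p4 + t * (p1 - p2 - p3 + p4)| <= `|p1 - p3| + `|p2 - p4|.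
    have := @bilin_slope p1 p3 p2 p4 t t01.
    by rewrite (_ : p1 - p3 - p2 + p4 = p1 - p2 - p3 + p4)//; ring.
  by apply: lerD; exact: slope.
exact: (mixed_deriv_bound s12 e0 e1 r1 hX hY XA XB (lexx _) erefl erefl erefl erefl).
Qed.

End Regularized.

End PowerNonlinearity.


Section PowerLimit.
Context (R : realType).
Local Notation C := R[i].
Local Notation re := (@complex.Re R).
Local Notation im := (@complex.Im R).
Local Notation normc := (@Normc.normc R).

Definition parK1 (s r : R) := (4 * s * `|s - 1| + 6 * s) * (163 * r ^+ 2) `^ (s - 1 / 2).
Definition parK2 (s r : R) := (2 * s + 1) * (163 * r ^+ 2) `^ s.

Lemma parK1_ge0 s r : 0 <= s -> 0 <= parK1 s r.
Proof. by move=> s0; rewrite mulr_ge0 ?powR_ge0// addr_ge0// !mulr_ge0. Qed.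

Lemma parK2_ge0 s r : 0 <= s -> 0 <= parK2 s r.
Proof. by move=> s0; rewrite mulr_ge0 ?powR_ge0// addr_ge0// !mulr_ge0. Qed.

Lemma approx4 (p1 p2 p3 p4 q1 q2 q3 q4 M eta : R) :
  `|p1 - p2 - p3 + p4| <= M -> `|p1 - q1| <= eta / 4 -> `|p2 - q2| <= eta / 4 ->
  `|p3 - q3| <= eta / 4 -> `|p4 - q4| <= eta / 4 ->
  `|q1 - q2 - q3 + q4| <= M + eta.
Proof.
rewrite !ler_norml => /andP[? ?] /andP[? ?] /andP[? ?] /andP[? ?] /andP[? ?].
by apply/andP; split; lra.
Qed.

(** The parallelogram defect of the power nonlinearity; the regularization is
    removed by continuity. *)
Lemma par_power (s r x1 x2 x3 x4 y1 y2 y3 y4 : R) : 1 / 2 <= s -> 1 <= r ->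
  `|x1| <= r -> `|x2| <= r -> `|x3| <= r -> `|x4| <= r ->
  `|y1| <= r -> `|y2| <= r -> `|y3| <= r -> `|y4| <= r ->
  `|(x1 ^+ 2 + y1 ^+ 2) `^ s * x1 - (x2 ^+ 2 + y2 ^+ 2) `^ s * x2
    - (x3 ^+ 2 + y3 ^+ 2) `^ s * x3 + (x4 ^+ 2 + y4 ^+ 2) `^ s * x4| <=
  parK1 s r * ((`|x1 - x2| + `|x3 - x4| + (`|y1 - y2| + `|y3 - y4|)) *
               (`|x1 - x3| + `|x2 - x4| + (`|y1 - y3| + `|y2 - y4|))) +
  parK2 s r * (`|x1 - x2 - x3 + x4| + `|y1 - y2 - y3 + y4|).
Proof.
move=> s12 r1 hx1 hx2 hx3 hx4 hy1 hy2 hy3 hy4.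
have s0 : 0 < s by lra.
apply/ler_addgt0Pr => eta eta0.
have e4 : 0 < eta / (4 * r) by rewrite divr_gt0//; lra.
have sh (x y : R) := powR_shift (addr_ge0 (sqr_ge0 x) (sqr_ge0 y)) s0 e4.
have [d1 d10 H1] := sh x1 y1; have [d2 d20 H2] := sh x2 y2.
have [d3 d30 H3] := sh x3 y3; have [d4 d40 H4] := sh x4 y4.
pose d := Num.min (Num.min d1 d2) (Num.min d3 d4).
have d0 : 0 < d by rewrite !lt_min d10 d20 d30 d40.
pose e := Num.min (d / 2) 1.
have e0 : 0 < e by rewrite lt_min ltr01 divr_gt0.
have e1 : e <= 1 by rewrite ge_min lexx orbT.
have ed : e < d by rewrite gt_min; apply/orP; left; lra.
move: ed; rewrite !lt_min => /andP[/andP[l1 l2] /andP[l3 l4]].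
have := par_regularized s12 e0 e1 r1 hx1 hx2 hx3 hx4 hy1 hy2 hy3 hy4.
rewrite -/(parK1 s r) -/(parK2 s r).
set RHS := (X in _ <= X); move=> P.
have D (x q qe : R) : `|x| <= r -> `|qe - q| <= eta / (4 * r) ->
    `|qe * x - q * x| <= eta / 4.
  move=> hx hq; rewrite -mulrBl; apply: le_trans (normM_le hq hx) _.
  rewrite le_eqVlt; apply/orP; left; apply/eqP; field; rewrite gt_eqF//; lra.
have E1 := D _ _ _ hx1 (H1 e e0 l1); have E2 := D _ _ _ hx2 (H2 e e0 l2).
have E3 := D _ _ _ hx3 (H3 e e0 l3); have E4 := D _ _ _ hx4 (H4 e e0 l4).
exact: approx4 P E1 E2 E3 E4.
Qed.

Definition powC (s : R) (z : C) : C := ((normc z ^+ 2) `^ s)%:C * z.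

Lemma re_powC s z : re (powC s z) = (re z ^+ 2 + im z ^+ 2) `^ s * re z.
Proof. by rewrite /powC reM /= mul0r subr0 normc_sqr. Qed.

Lemma im_powC s z : im (powC s z) = (im z ^+ 2 + re z ^+ 2) `^ s * im z.
Proof. by rewrite /powC imM /= mul0r addr0 normc_sqr addrC. Qed.

Lemma par_powC (s r : R) (z1 z2 z3 z4 : C) : 1 / 2 <= s -> 1 <= r ->
  normc z1 <= r -> normc z2 <= r -> normc z3 <= r -> normc z4 <= r ->
  normc (powC s z1 - powC s z2 - powC s z3 + powC s z4) <=
  (8 * parK1 s r + 4 * parK2 s r) *
  ((normc (z1 - z2) + normc (z3 - z4)) * (normc (z1 - z3) + normc (z2 - z4))
   + normc (z1 - z2 - z3 + z4)).
Proof.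
move=> s12 r1 h1 h2 h3 h4; have s0 : 0 <= s by lra.
have K1 := parK1_ge0 r s0; have K2 := parK2_ge0 r s0.
have rl z : normc z <= r -> `|re z| <= r by apply: le_trans; exact: re_le_normc.
have il z : normc z <= r -> `|im z| <= r by apply: le_trans; exact: im_le_normc.
have Pr := par_power s12 r1 (rl _ h1) (rl _ h2) (rl _ h3) (rl _ h4)
  (il _ h1) (il _ h2) (il _ h3) (il _ h4).
have Pi := par_power s12 r1 (il _ h1) (il _ h2) (il _ h3) (il _ h4)
  (rl _ h1) (rl _ h2) (rl _ h3) (rl _ h4).
apply: le_trans (normc_le _) _.
rewrite !(reD, imD, reN, imN) !re_powC !im_powC.
have S2 z w : `|re z| + `|re w| + (`|im z| + `|im w|) <= 2 * (normc z + normc w).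
  by have := re_le_normc z; have := re_le_normc w; have := im_le_normc z;
    have := im_le_normc w; lra.
have SA := S2 (z1 - z2) (z3 - z4); have SB := S2 (z1 - z3) (z2 - z4).
have SE : `|re (z1 - z2 - z3 + z4)| + `|im (z1 - z2 - z3 + z4)| <=
    2 * normc (z1 - z2 - z3 + z4).
  by have := re_le_normc (z1 - z2 - z3 + z4); have := im_le_normc (z1 - z2 - z3 + z4); lra.
move: SA SB SE; rewrite !(reD, imD, reN, imN).
pose A := `|re z1 - re z2| + `|re z3 - re z4| + (`|im z1 - im z2| + `|im z3 - im z4|).
pose B := `|re z1 - re z3| + `|re z2 - re z4| + (`|im z1 - im z3| + `|im z2 - im z4|).
pose E := `|re z1 - re z2 - re z3 + re z4| + `|im z1 - im z2 - im z3 + im z4|.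
rewrite -/A -/B -/E => SA SB SE.
have A0 : 0 <= A by rewrite !addr_ge0.
have B0 : 0 <= B by rewrite !addr_ge0.
have AB := ler_pM A0 B0 SA SB.
pose p := normc (z1 - z2) + normc (z3 - z4).
pose q := normc (z1 - z3) + normc (z2 - z4).
pose n := normc (z1 - z2 - z3 + z4).
rewrite -/p -/q -/n in AB SE *.
have Pr' : parK1 s r * (A * B) + parK2 s r * E <=
    parK1 s r * (4 * (p * q)) + parK2 s r * (2 * n).
  apply: lerD; apply: ler_wpM2l => //; lra.
have pq0 : 0 <= p * q by rewrite mulr_ge0// addr_ge0// normc_ge0.
have n0 : 0 <= n by exact: normc_ge0.
have C1 := mulr_ge0 K1 pq0; have C2 := mulr_ge0 K2 n0.
have C3 := mulr_ge0 K1 n0; have C4 := mulr_ge0 K2 pq0.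
have EA : A = `|im z1 - im z2| + `|im z3 - im z4| + (`|re z1 - re z2| + `|re z3 - re z4|).
  by rewrite /A addrC.
have EB : B = `|im z1 - im z3| + `|im z2 - im z4| + (`|re z1 - re z3| + `|re z2 - re z4|).
  by rewrite /B addrC.
have EE : E = `|im z1 - im z2 - im z3 + im z4| + `|re z1 - re z2 - re z3 + re z4|.
  by rewrite /E addrC.
move: Pr Pi; rewrite -EA -EB -EE -/A -/B -/E => Pr Pi.
by apply: le_trans (lerD Pr Pi) _; lra.
Qed.

End PowerLimit.

Lemma par_lin (K : comNzRingType) (c d v1 v2 v3 v4 p1 p2 p3 p4 : K) :
  c * v1 + d * p1 - (c * v2 + d * p2) - (c * v3 + d * p3) + (c * v4 + d * p4) =
  c * (v1 - v2 - v3 + v4) + d * (p1 - p2 - p3 + p4).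
Proof. ring. Qed.

Section NonlinearOperator.
Context (R : realType) (a b : R).
Local Notation D := (`]a, b[%classic : set R).
Local Notation C := R[i].
Local Notation re := (@complex.Re R).
Local Notation im := (@complex.Im R).
Local Notation normc := (@Normc.normc R).
Variables (V : R -> R) (beta sigma MV : R).
Hypotheses (mV : measurable_fun D V) (VM : forall x, D x -> `|V x| <= MV).
Hypothesis (hsigma : 1 / 2 <= sigma).
Local Notation B := (opB V beta sigma).
Implicit Types (u v : R -> C).

Let sigma_ge0 : 0 <= sigma.
Proof. by apply: le_trans hsigma; rewrite divr_ge0. Qed.

Lemma opB_powC v x : B v x = (V x)%:C * v x + beta%:C * powC sigma (v x).
Proof. by rewrite /opB /nlf /powC rmorphM /= mulrA. Qed.

Definition lipB (r : R) : R :=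
  MV + `|beta| * ((8 * parK1 sigma r + 4 * parK2 sigma r) * (2 * r + 1)).

(** Stability of second differences under the nonlinearity: this is what turns
    the regularity in time of the solution into that of the nonlinear term, and
    where the exponent [sigma] has to be at least [1 / 2]. *)
Lemma par_opB (r : R) (v1 v2 v3 v4 : R -> C) x : D x -> 1 <= r ->
  normc (v1 x) <= r -> normc (v2 x) <= r -> normc (v3 x) <= r ->
  normc (v4 x) <= r ->
  normc (B v1 x - B v2 x - B v3 x + B v4 x) <= lipB r *
  ((normc (v1 x - v2 x) + normc (v3 x - v4 x)) *
   (normc (v1 x - v3 x) + normc (v2 x - v4 x)) +
   normc (v1 x - v2 x - v3 x + v4 x)).
Proof.
move=> Dx r1 h1 h2 h3 h4; rewrite !opB_powC.
have P := par_powC hsigma r1 h1 h2 h3 h4.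
have s0 := sigma_ge0.
have K1 := parK1_ge0 r s0; have K2 := parK2_ge0 r s0.
have MV0 : 0 <= MV by apply: le_trans (VM Dx).
set p1 := powC _ (v1 x) in P *; set p2 := powC _ (v2 x) in P *.
set p3 := powC _ (v3 x) in P *; set p4 := powC _ (v4 x) in P *.
rewrite par_lin.
apply: le_trans (normcD _ _) _; rewrite !Normc.normcM !normc_real /lipB.
set n := normc (v1 x - v2 x - v3 x + v4 x) in P *.
pose K := 8 * parK1 sigma r + 4 * parK2 sigma r.
pose q := (normc (v1 x - v2 x) + normc (v3 x - v4 x)) *
  (normc (v1 x - v3 x) + normc (v2 x - v4 x)).
rewrite -/K -/q in P *.
have n0 : 0 <= n by exact: normc_ge0.
have q0 : 0 <= q by rewrite /q mulr_ge0// addr_ge0// normc_ge0.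
have K0 : 0 <= K by rewrite /K addr_ge0// mulr_ge0.
have H1 : `|V x| * n <= MV * n by rewrite ler_wpM2r// VM.
have H2 : `|beta| * normc (p1 - p2 - p3 + p4) <= `|beta| * (K * (q + n)).
  exact: ler_wpM2l.
have H3 : 0 <= `|beta| * (K * (q + n)) * (2 * r).
  by rewrite !mulr_ge0// ?addr_ge0//; lra.
have H4 : 0 <= MV * q by rewrite mulr_ge0.
lra.
Qed.

Lemma powC0 : powC sigma 0 = 0 :> C. Proof. by rewrite /powC mulr0. Qed.

(** The four-point bound with two of the points at the origin. *)
Lemma lip_opB (r : R) (v1 v2 : R -> C) x : D x -> 1 <= r ->
  normc (v1 x) <= r -> normc (v2 x) <= r ->
  normc (B v1 x - B v2 x) <= lipB r * (2 * r + 1) * normc (v1 x - v2 x).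
Proof.
move=> Dx r1 h1 h2; pose z0 (y : R) : C := 0.
have hz : normc (z0 x) <= r by rewrite Normc.normc0; lra.
have := par_opB Dx r1 h1 h2 hz hz.
have -> : B z0 x = 0 by rewrite opB_powC /z0 powC0 !mulr0 addr0.
rewrite /z0 !subr0 !addr0 Normc.normc0 addr0 => H.
apply: le_trans H _; rewrite -mulrA; apply: ler_wpM2l.
  have s0 := sigma_ge0.
  have K1 := parK1_ge0 r s0; have K2 := parK2_ge0 r s0.
  rewrite addr_ge0 ?(le_trans _ (VM Dx))// mulr_ge0// mulr_ge0//; last by lra.
  by rewrite addr_ge0// mulr_ge0.
have n0 := normc_ge0 (v1 x - v2 x).
have : normc (v1 x - v2 x) * (normc (v1 x) + normc (v2 x)) <= normc (v1 x - v2 x) * (2 * r).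
  by apply: ler_wpM2l => //; lra.
lra.
Qed.

Lemma lipB_ge0 r : a < b -> 1 <= r -> 0 <= lipB r.
Proof.
move=> ab r1; have Dm : D ((a + b) / 2) by rewrite inD; apply/andP; split; lra.
have s0 := sigma_ge0.
have K1 := parK1_ge0 r s0; have K2 := parK2_ge0 r s0.
rewrite addr_ge0 ?(le_trans _ (VM Dm))// mulr_ge0// mulr_ge0//; last by lra.
by rewrite addr_ge0// mulr_ge0.
Qed.

Lemma L2_opB v r : a < b -> 1 <= r -> L2 a b v -> (forall x, D x -> normc (v x) <= r) ->
  L2 a b (B v).
Proof.
move=> ab r1 hv vr; have [vre vim] := (L2_parts _ _ _).1 hv.
have mpow : measurable_fun D (fun x => (re (v x) ^+ 2 + im (v x) ^+ 2) `^ sigma).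
  apply: (measurableT_comp (measurable_powR _)).
  by apply: measurable_funD; apply: measurable_funX; [exact: vre.1|exact: vim.1].
apply: (@L2_bounded _ _ _ _ (lipB r * (2 * r + 1) * r)).
- rewrite (_ : (fun x => _) = (fun x => V x * re (v x) +
    beta * ((re (v x) ^+ 2 + im (v x) ^+ 2) `^ sigma * re (v x)))); last first.
    by apply/funext => x; rewrite opB_powC reD (reM _%:C (v x)) (reM beta%:C) re_powC /= !mul0r !subr0.
  apply: measurable_funD; first by apply: measurable_funM => //; exact: vre.1.
  apply: measurable_funM; first exact: measurable_cst.
  by apply: measurable_funM => //; exact: vre.1.
- rewrite (_ : (fun x => _) = (fun x => V x * im (v x) +
    beta * ((re (v x) ^+ 2 + im (v x) ^+ 2) `^ sigma * im (v x)))); last first.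
    apply/funext => x; rewrite opB_powC imD (imM _%:C (v x)) (imM beta%:C) im_powC /= !mul0r !addr0.
    by rewrite [im (v x) ^+ 2 + _]addrC.
  apply: measurable_funD; first by apply: measurable_funM => //; exact: vim.1.
  apply: measurable_funM; first exact: measurable_cst.
  by apply: measurable_funM => //; exact: vim.1.
- move=> x Dx; pose z0 (y : R) : C := 0.
  have hz : normc (z0 x) <= r by rewrite Normc.normc0; lra.
  have := lip_opB Dx r1 (vr x Dx) hz.
  have -> : B z0 x = 0 by rewrite opB_powC /z0 powC0 !mulr0 addr0.
  rewrite /z0 !subr0 => H; apply: le_trans H _; apply: ler_wpM2l; last exact: vr.
  by rewrite mulr_ge0 ?lipB_ge0//; lra.
Qed.

End NonlinearOperator.


(** * Curves in L2 *)

Section Curves.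
Context (R : realType) (a b : R).
Hypothesis hab : a < b.
Local Notation D := (`]a, b[%classic : set R).
Local Notation C := R[i].
Local Notation normL2 := (normL2 a b).
Local Notation normc := (@Normc.normc R).
Implicit Types (J : set R) (u v w : R -> R -> C) (U : R -> C) (s t T K : R).

(** Epsilon forms of [curve_continuous] and [curve_deriv] in L2. *)
Definition cont_L2 J u := (forall t, J t -> L2 a b (u t)) /\
  forall t, J t -> forall eta : R, 0 < eta -> exists2 d : R, 0 < d &
    forall s, J s -> `|t - s| < d -> normL2 (fun x => u s x - u t x) <= eta.

Definition deriv_L2 J u v := forall t, J t -> forall eta : R, 0 < eta ->
  exists2 d : R, 0 < d & forall s, J s -> s != t -> `|t - s| < d ->
    normL2 (fun x => ((s - t)^-1)%:C * (u s x - u t x) - v t x) <= eta.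

Lemma curve_continuous_eps X nrm J u : curve_continuous X nrm J u ->
  forall t, J t -> forall eta : R, 0 < eta -> exists2 d : R, 0 < d &
    forall s, J s -> `|t - s| < d -> nrm (fun x => u s x - u t x) <= eta.
Proof.
move=> [_ H] t Jt eta eta0; have := H t Jt => /cvgrPdist_le /(_ eta eta0).
rewrite nearE/= => /nbhs_ballP[d /= d0 Hd]; exists d => // s Js ts.
have := Hd s ts Js; rewrite sub0r normrN; apply: le_trans; exact: ler_norm.
Qed.

Lemma curve_deriv_eps nrm J u v : curve_deriv nrm J u v ->
  forall t, J t -> forall eta : R, 0 < eta -> exists2 d : R, 0 < d &
    forall s, J s -> s != t -> `|t - s| < d ->
    nrm (fun x => ((s - t)^-1)%:C * (u s x - u t x) - v t x) <= eta.
Proof.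
move=> H t Jt eta eta0; have := H t Jt => /cvgrPdist_le /(_ eta eta0).
rewrite nearE/= => /nbhs_ballP[d /= d0 Hd]; exists d => // s Js st ts.
have := Hd s ts st Js; rewrite sub0r normrN; apply: le_trans; exact: ler_norm.
Qed.

Lemma curve_continuous_L2 J u : curve_continuous (L2 a b) normL2 J u -> cont_L2 J u.
Proof. by move=> H; split; [exact: H.1|exact: curve_continuous_eps H]. Qed.

Lemma is_derive_eps (f : R -> R) (x d : R) :
  (forall eta : R, 0 < eta -> exists2 e : R, 0 < e &
    forall h, h != 0 -> `|h| < e -> `|h^-1 * (f (x + h) - f x) - d| <= eta) ->
  is_derive x (1:R) f d.
Proof.
move=> H.
have L : h^-1 *: (f (h *: 1 + x) - f x) @[h --> 0^'] --> d.
  apply/cvgrPdist_le => eps eps0; have [e e0 He] := H eps eps0.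
  near=> h.
  have h0 : h != 0 by near: h; exact: nbhs_dnbhs_neq.
  have h1 : `|h| < e by near: h; apply: dnbhs0_lt.
  by rewrite /GRing.scale/= mulr1 [h + x]addrC distrC; exact: He.
apply: DeriveDef; first by apply/cvg_ex; exists d.
by apply/cvg_lim => //.
Unshelve. all: by end_near. Qed.

(** Pairing with a fixed function gives a real function, to which the mean value
    theorem applies. *)
Lemma ip_is_derive J u v U t (d0 : R) : (forall s, J s -> L2 a b (u s)) ->
  L2 a b (v t) -> L2 a b U ->
  deriv_L2 J u v -> 0 < d0 -> (forall s, `|t - s| < d0 -> J s) ->
  is_derive t (1:R) (fun s => ip a b (u s) U) (ip a b (v t) U).
Proof.
move=> hu hv hU H d00 HJ; apply: is_derive_eps => eta eta0.
have Jt : J t by apply: HJ; rewrite subrr normr0.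
have n1 : 0 < normL2 U + 1 by rewrite ltr_wpDl// normL2_ge0.
have [d d_gt Hd] := H t Jt _ (divr_gt0 eta0 n1).
exists (Num.min d d0); first by rewrite lt_min d_gt.
move=> h h0; rewrite lt_min => /andP[hd hd0].
have Js : J (t + h) by apply: HJ; rewrite opprD addNKr normrN.
have st : t + h != t by rewrite -subr_eq0 addrAC subrr add0r.
have := Hd (t + h) Js st; rewrite opprD addNKr normrN => /(_ hd).
rewrite addrAC subrr add0r => B.
have hw := L2B (hu _ Js) (hu _ Jt).
have <- : ip a b (fun x => (h^-1)%:C * (u (t + h) x - u t x) - v t x) U =
    h^-1 * (ip a b (u (t + h)) U - ip a b (u t) U) - ip a b (v t) U.
  rewrite ipBl//; last exact: L2Z.
  by rewrite ipZl// ipBl//; exact: hu.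
apply: le_trans (ip_CS (L2B (L2Z _ hw) hv) hU) _.
apply: le_trans (ler_wpM2r (normL2_ge0 _ _ _) B) _.
by rewrite mulrAC ler_pdivrMr// ler_wpM2l ?(ltW eta0)// lerDl.
Qed.

Section Interval.
Variable T : R.
Local Notation J := (`[0, T]%classic : set R).

Lemma inJ t : J t = (0 <= t <= T) :> Prop.
Proof. by rewrite /= in_itv. Qed.

Lemma ip_within u U : cont_L2 J u -> L2 a b U ->
  {within `[0, T], continuous (fun s => ip a b (u s) U)}.
Proof.
move=> [hu cu] hU; apply/within_itvP => t tT eta eta0.
have n1 : 0 < normL2 U + 1 by rewrite ltr_wpDl// normL2_ge0.
have Jt : J t by rewrite inJ.
have [d d0 Hd] := cu t Jt _ (divr_gt0 eta0 n1).
exists d => // s sT ts; have Js : J s by rewrite inJ.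
rewrite distrC -ipBl//; [|exact: hu|exact: hu].
apply: le_trans (ip_CS (L2B (hu s Js) (hu t Jt)) hU) _.
apply: le_trans (ler_wpM2r (normL2_ge0 _ _ _) (Hd s Js ts)) _.
by rewrite mulrAC ler_pdivrMr// ler_wpM2l ?(ltW eta0)// lerDl.
Qed.

Lemma cont_bounded u : 0 <= T -> cont_L2 J u ->
  exists2 K, 0 <= K & forall t, 0 <= t <= T -> normL2 (u t) <= K.
Proof.
move=> T0 [hu cu].
have cn : {within `[0, T], continuous (fun t => normL2 (u t))}.
  apply/within_itvP => t tT eta eta0; have Jt : J t by rewrite inJ.
  have [d d0 Hd] := cu t Jt _ eta0; exists d => // s sT ts.
  have Js : J s by rewrite inJ.
  have H := Hd s Js ts.
  have := normL2D (hu t Jt) (L2B (hu s Js) (hu t Jt)).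
  have := normL2B (hu s Js) (L2B (hu s Js) (hu t Jt)).
  rewrite (_ : (fun x => u t x + _) = u s); last by apply/funext => x; ring.
  rewrite (_ : (fun x => u s x - _) = u t); last by apply/funext => x; ring.
  by move=> A B; rewrite ler_norml; apply/andP; split; lra.
have [m _ Hm] := EVT_max T0 cn.
exists (normL2 (u m)); first exact: normL2_ge0.
by move=> t tT; apply: Hm; rewrite in_itv.
Qed.

Lemma interior_ball t : 0 < t < T -> exists2 d0 : R, 0 < d0 &
  forall s, `|t - s| < d0 -> 0 <= s <= T.
Proof.
move=> /andP[t0 tT]; exists (Num.min t (T - t)).
  by rewrite lt_min t0 subr_gt0.
move=> s; rewrite lt_min !ltr_norml => /andP[/andP[? ?] /andP[? ?]].
by apply/andP; split; lra.
Qed.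

Lemma ip_is_derive_itv u v U t : cont_L2 J u -> L2 a b (v t) ->
  deriv_L2 J u v -> L2 a b U -> 0 < t < T ->
  is_derive t (1:R) (fun s => ip a b (u s) U) (ip a b (v t) U).
Proof.
move=> [hu _] hv H hU /interior_ball[d0 d00 HJ].
by apply: (ip_is_derive hu hv hU H d00) => s /HJ; rewrite inJ.
Qed.

Lemma within_sub (f : R -> R) t1 t2 : 0 <= t1 -> t2 <= T ->
  {within `[0, T], continuous f} -> {within `[t1, t2], continuous f}.
Proof.
move=> t10 t2T; apply: continuous_subspaceW => x.
by rewrite /= !in_itv/= => /andP[? ?]; apply/andP; split; lra.
Qed.

Lemma cancel_norm (n K : R) : 0 <= n -> 0 <= K -> n ^+ 2 <= K * n -> n <= K.
Proof.
move=> n0 K0 H; have [n0'|nn0] := eqVneq n 0; first by rewrite n0'.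
by rewrite -(@ler_pM2r _ n) -?expr2// lt_neqAle eq_sym nn0.
Qed.

(** The mean value theorem for the pairing with the increment itself. *)
Lemma curve_lipschitz u v K : cont_L2 J u -> (forall t, J t -> L2 a b (v t)) ->
  deriv_L2 J u v -> (forall t, 0 <= t <= T -> normL2 (v t) <= K) -> 0 <= K ->
  forall s t, 0 <= s <= T -> 0 <= t <= T ->
  normL2 (fun x => u t x - u s x) <= K * `|t - s|.
Proof.
move=> cu hv H vK K0; have [hu _] := cu.
suff L s t : 0 <= s -> s < t -> t <= T ->
    normL2 (fun x => u t x - u s x) <= K * (t - s).
  move=> s t /andP[s0 sT] /andP[t0 tT]; have [st|ts|<-] := ltgtP s t.
  - by rewrite gtr0_norm ?subr_gt0// L.
  - rewrite distrC gtr0_norm ?subr_gt0//.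
    rewrite -(normL2N _ _ (fun x => u t x - u s x)).
    rewrite (_ : (fun x => - _) = (fun x => u s x - u t x)); first by exact: L.
    by apply/funext => x; rewrite opprB.
  - rewrite subrr normr0 mulr0.
    by rewrite normL2_ip /ip (@eq_intg _ _ _ _ (fun=> 0)) ?intg0 ?sqrtr0// => x _;
      rewrite subrr !mul0r addr0.
move=> s0 st tT.
have Js : J s by rewrite inJ s0 (le_trans (ltW st)).
have Jt : J t by rewrite inJ tT (le_trans s0 (ltW st)).
pose U x := u t x - u s x.
have hU : L2 a b U by apply: L2B; exact: hu.
have cw := within_sub s0 tT (ip_within cu hU).
have dd x : x \in `]s, t[%R -> is_derive x (1:R) (fun r => ip a b (u r) U) (ip a b (v x) U).
  rewrite in_itv/= => /andP[sx xt]; apply: ip_is_derive_itv => //.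
    by apply: hv; rewrite inJ; apply/andP; split; lra.
  by apply/andP; split; lra.
have [c cin E] := MVT st dd cw.
move: cin; rewrite in_itv/= => /andP[sc ct].
have cT : 0 <= c <= T by apply/andP; split; lra.
have hvc : L2 a b (v c) by apply: hv; rewrite inJ.
apply: cancel_norm; [exact: normL2_ge0|by rewrite mulr_ge0// subr_ge0 ltW|].
rewrite normL2_sqr -[ip a b _ _]/(ip a b U U) {1}/U ipBl//; [|exact: hu|exact: hu].
rewrite E [X in _ <= X]mulrAC; apply: ler_wpM2r; first by rewrite subr_ge0 ltW.
apply: le_trans (ler_norm _) _; apply: le_trans (ip_CS hvc hU) _.
by apply: ler_wpM2r; [exact: normL2_ge0|exact: vK].
Qed.

Lemma is_derive_shiftD (f : R -> R) (c x d : R) : is_derive (c + x) (1:R) f d ->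
  is_derive x (1:R) (fun z => f (c + z)) d.
Proof.
move=> H; have K : is_derive x (1:R) (fun z => c + z) 1 by apply: is_derive_eq; ring.
by have := @is_derive1_comp _ f (fun z => c + z) x d 1 H K; rewrite mulr1.
Qed.

Lemma within_shiftD (f : R -> R) (c r : R) : 0 <= c -> c + r <= T ->
  {within `[0, T], continuous f} -> {within `[0, r], continuous (fun x => f (c + x))}.
Proof.
move=> c0 crT /within_itvP cf; apply/within_itvP => x /andP[x0 xr] eta eta0.
have [|d d0 Hd] := cf (c + x) _ eta eta0; first by apply/andP; split; lra.
exists d => // z /andP[z0 zr] xz; apply: Hd; first by apply/andP; split; lra.
by rewrite opprD addrACA subrr add0r.
Qed.

(** The mean value theorem in [r] for the pairing with the second difference
    itself leaves an increment of [v], which is Lipschitz. *)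
Lemma curve_second_diff u v w K : cont_L2 J u -> cont_L2 J v ->
  (forall t, J t -> L2 a b (w t)) -> deriv_L2 J u v -> deriv_L2 J v w ->
  (forall t, 0 <= t <= T -> normL2 (w t) <= K) -> 0 <= K ->
  forall t s r, 0 <= t -> 0 <= s -> 0 <= r -> t + s + r <= T ->
  normL2 (fun x => u (t + s + r) x - u (t + s) x - u (t + r) x + u t x) <= K * s * r.
Proof.
move=> cu cv hw Hu Hv wK K0 t s r t0 s0; rewrite le_eqVlt => /predU1P[<-|r0] tT.
  rewrite mulr0 (_ : (fun x => _) = (fun=> 0)); last first.
    by apply/funext => x; rewrite !addr0; ring.
  by rewrite normL2_ip /ip (@eq_intg _ _ _ _ (fun=> 0)) ?intg0 ?sqrtr0// => x _;
      rewrite !mul0r addr0.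
have [hu _] := cu; have [hv _] := cv.
have J1 : J (t + s + r) by rewrite inJ; apply/andP; split; lra.
have J2 : J (t + s) by rewrite inJ; apply/andP; split; lra.
have J3 : J (t + r) by rewrite inJ; apply/andP; split; lra.
have J4 : J t by rewrite inJ; apply/andP; split; lra.
pose U x := u (t + s + r) x - u (t + s) x - u (t + r) x + u t x.
have hU : L2 a b U.
  by apply: L2D; [apply: L2B; [apply: L2B|]|]; exact: hu.
pose f x := ip a b (u (t + s + x)) U - ip a b (u (t + x)) U.
pose df x := ip a b (v (t + s + x)) U - ip a b (v (t + x)) U.
have cf : {within `[0, r], continuous f}.
  apply/subspace_continuousP => x xr; apply: cvgB.
    have /subspace_continuousP := @within_shiftD _ (t + s) r ltac:(lra) tT (ip_within cu hU).
    exact.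
  have /subspace_continuousP := @within_shiftD _ t r t0 ltac:(lra) (ip_within cu hU).
  exact.
have Df x : x \in `]0, r[%R -> is_derive x (1:R) f (df x).
  rewrite in_itv/= => /andP[x0 xr]; apply: is_deriveB.
    apply: (@is_derive_shiftD (fun r => ip a b (u r) U) (t + s) x).
    apply: (ip_is_derive_itv (v := v)) => //; last by apply/andP; split; lra.
    by apply: hv; rewrite inJ; apply/andP; split; lra.
  apply: (@is_derive_shiftD (fun r => ip a b (u r) U) t x).
  apply: (ip_is_derive_itv (v := v)) => //; last by apply/andP; split; lra.
  by apply: hv; rewrite inJ; apply/andP; split; lra.
have [c cin E] := MVT r0 Df cf.
move: cin; rewrite in_itv/= => /andP[c0 cr].
have c1 : 0 <= t + s + c <= T by apply/andP; split; lra.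
have c2 : 0 <= t + c <= T by apply/andP; split; lra.
have h1 : L2 a b (v (t + s + c)) by apply: hv; rewrite inJ.
have h2 : L2 a b (v (t + c)) by apply: hv; rewrite inJ.
apply: cancel_norm; [exact: normL2_ge0|by rewrite !mulr_ge0// ltW|].
rewrite normL2_sqr -/U.
have -> : ip a b U U = f r - f 0.
  rewrite /f !addr0 {1}/U ipDl//; [|by apply: L2B; [apply: L2B|]; exact: hu|exact: hu].
  rewrite ipBl//; [|by apply: L2B; exact: hu|exact: hu].
  rewrite ipBl//; [|exact: hu|exact: hu]; ring.
rewrite E subr0 [X in _ <= X]mulrAC; apply: ler_wpM2r; first exact: ltW.
rewrite /df -ipBl//.
apply: le_trans (ler_norm _) _; apply: le_trans (ip_CS (L2B h1 h2) hU) _.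
apply: ler_wpM2r; first exact: normL2_ge0.
have := curve_lipschitz cv hw Hv wK K0 c2 c1.
by rewrite (_ : t + s + c - (t + c) = s) ?ger0_norm//; ring.
Qed.

End Interval.

End Curves.


(** * Periodic Sobolev functions and their Fourier projections *)

Section PeriodicSobolev.
Context (R : realType) (a b : R).
Hypothesis hab : a < b.
Local Notation D := (`]a, b[%classic : set R).
Local Notation C := R[i].
Local Notation re := (@complex.Re R).
Local Notation im := (@complex.Im R).
Local Notation normL2 := (normL2 a b).
Local Notation normc := (@Normc.normc R).
Local Notation freq := (freq a b).
Local Notation fmode := (fmode a b).
Local Notation fcoef := (fcoef a b).
Local Notation PN := (PN a b).
Local Notation wD := (wD a b).
Implicit Types (u v w : R -> C) (l : int).

Let ba_gt0 : 0 < b - a. Proof. by rewrite subr_gt0. Qed.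

Lemma fcoef_iter_wD m k u l : Hper a b m u -> (k <= m)%N ->
  fcoef (iter k wD u) l = ('i%C * (freq l)%:C) ^+ k * fcoef u l.
Proof.
move=> [su per]; elim: k => [|k IH] km; first by rewrite expr0 mul1r.
rewrite iterS fcoef_wD//.
- by rewrite IH 1?ltnW// exprS mulrA.
- apply: (sobolev_le (m := (m - k)%N)); first by rewrite subn_gt0.
  by apply: sobolev_iter => //; rewrite subnKC// ltnW.
- exact: per.
Qed.

Lemma normc_fcoef_iter m k u l : Hper a b m u -> (k <= m)%N ->
  `|freq l| ^+ k * normc (fcoef u l) = normc (fcoef (iter k wD u) l).
Proof.
move=> hu km; rewrite (fcoef_iter_wD l hu km) (Normc.normcM (_ ^+ k)); congr (_ * _).
elim: k {km} => [|k IH]; first by rewrite !expr0 Normc.normc1.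
by rewrite !exprS Normc.normcM -IH Normc.normcM normc_i mul1r normc_real.
Qed.

(** The product with a test function vanishes at both end points, hence its
    derivative integrates to zero. *)
Lemma wk_smooth (w g : R -> R) : (forall x, is_derive x (1:R) w (g x)) ->
  continuous g -> wk a b w g.
Proof.
move=> dw cg; have cw := is_derive_continuous dw.
split; [exact: sq_continuous|exact: sq_continuous|].
move=> phi tphi; have [dphi cphi [c [d [ac db out]]]] := tphi.
have dphi' x : is_derive x (1:R) phi (derive1 phi x).
  by apply: DeriveDef; [exact: dphi|rewrite derive1E].
have cph := is_derive_continuous dphi'.
have dprod x : is_derive x (1:R) (fun z => w z * phi z)
    (w x * derive1 phi x + phi x * g x).
  by have := dphi' x; have := dw x => ? ?; apply: is_derive_eq.
have cprod : continuous (fun x => w x * derive1 phi x + phi x * g x).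
  by move=> x; apply: cvgD; apply: cvgM; [exact: cw|exact: cphi|exact: cph|exact: cg].
have := intg_FTC hab dprod cprod.
have pa : phi a = 0 by apply: out; rewrite negb_and -!ltNge ac.
have pb : phi b = 0 by apply: out; rewrite negb_and -!ltNge db orbT.
rewrite pa pb !mulr0 subrr.
have I1 : itg a b (fun x => w x * derive1 phi x) by apply: sqM; exact: sq_continuous.
have I2 : itg a b (fun x => g x * phi x) by apply: sqM; exact: sq_continuous.
rewrite (@eq_intg _ _ _ _ (fun x => w x * derive1 phi x + g x * phi x)); last first.
  by move=> x _; rewrite [phi x * _]mulrC.
by rewrite intgD// => /eqP; rewrite addr_eq0 => /eqP.
Qed.

Lemma weak_deriv_fmode l : weak_deriv a b (fmode l)
  (fun x => 'i%C * (freq l)%:C * fmode l x).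
Proof.
apply/weak_derivP; split; [exact: L2_fmode|exact: L2Z (L2_fmode a b l)|..].
  apply: (@eq_wk _ _ _ (fun x => cos (freq l * (x - a))) (fun x => - freq l * sin (freq l * (x - a)))).
  - by move=> x; rewrite re_fmode.
  - by move=> x; rewrite -mulrA re_iM imM im_fmode /=; ring.
  - apply: wk_smooth; first exact: is_derive_cosl.
    by move=> x; apply: cvgM; [exact: cvg_cst|exact: continuous_sinl].
apply: (@eq_wk _ _ _ (fun x => sin (freq l * (x - a))) (fun x => freq l * cos (freq l * (x - a)))).
- by move=> x; rewrite im_fmode.
- by move=> x; rewrite -mulrA im_iM reM re_fmode /=; ring.
- apply: wk_smooth; first exact: is_derive_sinl.
  by move=> x; apply: cvgM; [exact: cvg_cst|exact: continuous_cosl].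
Qed.

Lemma weak_deriv_sum n (F G : 'I_n -> R -> C) :
  (forall j, weak_deriv a b (F j) (G j)) ->
  weak_deriv a b (fun x => \sum_j F j x) (fun x => \sum_j G j x).
Proof.
elim: n F G => [|n IH] F G H.
  have := weak_deriv_lin 0 0 (weak_deriv_fmode 0) (weak_deriv_fmode 0).
  by congr weak_deriv; apply/funext => x; rewrite big_ord0 !mul0r addr0.
have := weak_deriv_lin 1 1 (H ord0) (IH _ _ (fun j => H (lift ord0 j))).
by congr weak_deriv; apply/funext => x; rewrite big_ord_recl !mul1r.
Qed.

Lemma weak_deriv_trigpoly n (l : 'I_n -> int) c :
  weak_deriv a b (trigpoly a b l c)
    (trigpoly a b l (fun j => 'i%C * (freq (l j))%:C * c j)).
Proof.
apply: weak_deriv_sum => j.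
have := weak_deriv_lin (c j) 0 (weak_deriv_fmode (l j)) (weak_deriv_fmode 0).
by congr weak_deriv; apply/funext => x; rewrite mul0r addr0//; ring.
Qed.

Lemma PN_ae N u v : L2 a b u -> L2 a b v -> ae_same a b u v -> PN N u = PN N v.
Proof.
move=> hu hv uv; apply/funext => x; apply: eq_bigr => j _.
by rewrite (fcoef_ae _ hu hv uv).
Qed.

Lemma proj_error_per m k u : Hper a b m u -> (k <= m)%N -> (2 <= m)%N ->
  forall K, (0 < K)%N ->
  normL2 (fun x => u x - PN K.*2 u x) <=
  ((b - a) / (2 * pi * K%:R)) ^+ k * normL2 (iter k wD u).
Proof.
move=> hu km m2 K K0; have [su _] := hu; have hL := sobolev_L2 su.
have s2 := sobolev_le m2 su.
have cr := crep_ex hab (sobolev_le (ltnW m2) su).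
have [_ _ e] := cr; have hU := crep_L2 hL cr.
have [M M0 lip] := crep_lipschitz hab s2 cr.
rewrite -(ae_normL2 (u := fun x => cont_rep a b u x - PN K.*2 (cont_rep a b u) x)).
- apply: (proj_error hab K0 hU _ lip).
    by apply: (L2_iter hab); exact: sobolev_le su.
  move=> l; rewrite (fcoef_ae l hU hL e) (normc_fcoef_iter l hu km).
  exact: lexx.
- by apply: L2B => //; exact: L2_PN.
- by apply: L2B => //; exact: L2_PN.
- by rewrite (PN_ae _ hU hL e); apply: ae_mono e => x E Dx; rewrite E.
Qed.

(** The derivative commutes with the projection, so that this is the projection
    error of [wD u]. *)
Lemma wD_PN_error m u : Hper a b m.+1 u -> (2 <= m)%N ->
  forall K, (0 < K)%N ->
  normL2 (wD (fun x => u x - PN K.*2 u x)) <=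
  ((b - a) / (2 * pi * K%:R)) ^+ m * normL2 (iter m.+1 wD u).
Proof.
move=> hu m2 K K0; have [su per] := hu.
have [du sdu] := sobolevS hab su.
have per1 : Hper a b m (wD u).
  split => // k km; have := per k.+1; rewrite ltnS => /(_ km).
  by rewrite iterSr.
have wp := weak_deriv_trigpoly (@TN K.*2) (fun j => fcoef u (TN j)).
have := weak_deriv_lin 1 (-1) du wp => wd.
have [wd' e] := wDP hab wd.
have := proj_error_per per1 (leqnn m) m2 K0; rewrite -iterSr.
apply: le_trans.
rewrite (_ : wD _ = wD (fun x => 1 * u x + -1 * trigpoly a b (TN (N:=K.*2)) (fun j => fcoef u (TN j)) x)); last first.
  by congr Defs.wD; apply/funext => x; rewrite mul1r mulN1r.
rewrite (ae_normL2 _ _ e).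
- rewrite le_eqVlt; apply/orP; left; apply/eqP; congr Defs.normL2.
  apply/funext => x; rewrite mul1r mulN1r; congr (_ - _).
  rewrite /Defs.PN; apply: eq_bigr => j _; congr (_ * _).
  have -> : wD u = iter 1 wD u by [].
  by rewrite (fcoef_iter_wD _ hu)// expr1.
- by case: wd'.
- by case: wd.
Qed.

Lemma sum_inv_sqr n : \sum_(0 <= i < n) ((1 + i%:R) ^+ 2)^-1 <= 2 :> R.
Proof.
have T k : \sum_(0 <= i < k) ((1 + i%:R) ^+ 2)^-1 <= 2 - (k%:R + 2^-1)^-1 :> R.
  elim: k => [|k IH]; first by rewrite big_nil add0r invrK subrr.
  rewrite big_nat_recr//=; apply: le_trans (lerD IH (lexx _)) _.
  have k0 : 0 <= k%:R :> R by [].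
  rewrite -[k.+1%:R]natr1 -addrA lerD2l addrC lerBlDr.
  have -> : - (k%:R + 1 + 2^-1)^-1 + (k%:R + 2^-1)^-1 =
      ((k%:R + 1) ^+ 2 - 4^-1)^-1 :> R.
    have -> : (k%:R + 1) ^+ 2 - 4^-1 = (k%:R + 1 + 2^-1) * (k%:R + 2^-1) :> R by field.
    have p0 : k%:R + 1 + 2^-1 != 0 :> R by rewrite gt_eqF//; lra.
    have q0 : k%:R + 2^-1 != 0 :> R by rewrite gt_eqF//; lra.
    have pq : (k%:R + 1 + 2^-1) - (k%:R + 2^-1) = 1 :> R by ring.
    rewrite -[RHS]mul1r -[X in _ = X * _]pq; move: (k%:R + 1 + 2^-1) (k%:R + 2^-1) p0 q0 {pq} => p q p0 q0.
    by field; rewrite p0 q0.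
  have h1 : 0 < (k%:R + 1) ^+ 2 - 4^-1 :> R by nra.
  have h2 : 0 < (k%:R + 1) ^+ 2 :> R by nra.
  by rewrite [1 + _]addrC lef_pV2 ?posrE// gerBl invr_ge0.
apply: le_trans (T n) _; rewrite gerBl invr_ge0; exact: addr_ge0.
Qed.

Lemma sum_inv_sqr_TN N : \sum_(j < N) ((1 + `|(TN j)%:~R|) ^+ 2)^-1 <= 4 :> R.
Proof.
pose f (i : nat) := ((1 + `|(i%:Z - (N./2)%:Z)%:~R|) ^+ 2)^-1 : R.
have -> : \sum_(j < N) ((1 + `|(TN j)%:~R|) ^+ 2)^-1 = \sum_(0 <= i < N) f i.
  by rewrite big_mkord.
have MN : (N./2 <= N)%N by rewrite -{2}(odd_double_half N) -addnn; lia.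
rewrite (@big_cat_nat _ _ _ N./2 0)//= (_ : 4 = 2 + 2 :> R); last by ring.
apply: lerD.
  rewrite big_nat_rev/= add0n; apply: le_trans (sum_inv_sqr N./2).
  rewrite big_nat_cond [leRHS]big_nat_cond; apply: ler_sum => i /andP[/andP[_ iM] _].
  rewrite /f lef_pV2 ?posrE ?exprn_gt0//; try by rewrite ltr_pwDl.
  rewrite lerXn2r ?nnegrE ?addr_ge0// lerD2l.
  rewrite (_ : (N./2 - i.+1)%:Z - (N./2)%:Z = - i.+1%:Z); last by lia.
  by rewrite rmorphN normrN /= ger0_norm// ler_nat.
rewrite -{1}[N./2]add0n big_addn; apply: le_trans (sum_inv_sqr (N - N./2)).
apply: ler_sum => i _; rewrite /f lef_pV2 ?posrE ?exprn_gt0//; try by rewrite ltr_pwDl.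
rewrite lerXn2r ?nnegrE ?addr_ge0// lerD2l.
by rewrite (_ : (i + N./2)%:Z - (N./2)%:Z = i%:Z) ?ger0_norm//; lia.
Qed.

(** Each coefficient is at most a summable weight [(1 + |l|)^-2] plus
    [(1 + |l|)^2] times its square, and Bessel bounds the latter. *)
Lemma sum_fcoef_bound N m u : Hper a b m.+1 u ->
  \sum_(j < N) normc (fcoef u (TN j)) <=
  2 + (b - a)^-1 * (normL2 u ^+ 2 + ((b - a) / (2 * pi)) ^+ 2 * normL2 (wD u) ^+ 2).
Proof.
move=> hu; have p0 := pi_gt0 R; have [su _] := hu.
have hL := sobolev_L2 su.
have [/weak_derivP[_ hd _ _] _] := sobolevS hab su.
have p2 : 0 < 2 * pi :> R by rewrite mulr_gt0.
set r := (b - a) / _.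
have T (j : 'I_N) : normc (fcoef u (TN j)) <=
    2^-1 * ((1 + `|(TN j)%:~R|) ^+ 2)^-1 + (normc (fcoef u (TN j)) ^+ 2 +
    r ^+ 2 * normc (fcoef (wD u) (TN j)) ^+ 2).
  rewrite -[wD u]/(iter 1 wD u) -(normc_fcoef_iter _ hu)// expr1 (exprMn _ `|_|) mulrA.
  have -> : r ^+ 2 * `|freq (TN j)| ^+ 2 = `|(TN j)%:~R| ^+ 2.
    rewrite -exprMn -[r]gtr0_norm ?divr_gt0// -normrM; congr (`|_| ^+ 2).
    rewrite /r /Defs.freq; move: p2; move: (2 * pi) => P P0.
    by field; rewrite !gt_eqF.
  move: `|(TN j)%:~R| (normr_ge0 ((TN j)%:~R : R)) => k k0.
  have c0 := normc_ge0 (fcoef u (TN j)); move: (normc _) c0 => c c0.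
  have k1 : 0 < 1 + k by rewrite ltr_pwDl.
  have q1 : (1 + k)^-1 * (1 + k) = 1 by rewrite mulVf// gt_eqF.
  have -> : ((1 + k) ^+ 2)^-1 = (1 + k)^-1 ^+ 2 by rewrite exprVn.
  move: (1 + k)^-1 q1 => q q1.
  have : 0 <= (q - (1 + k) * c) ^+ 2 by exact: sqr_ge0.
  have : 0 <= (1 - k) ^+ 2 * c ^+ 2 by rewrite mulr_ge0 ?sqr_ge0.
  have : c = q * (1 + k) * c by rewrite q1 mul1r.
  move=> E1 E2 E3; nra.
apply: le_trans (ler_sum _ (fun j _ => T j)) _.
rewrite big_split big_split /= -!mulr_sumr; apply: lerD.
  by have := sum_inv_sqr_TN N; lra.
have B1 := bessel hab (@TN_inj N) hL; have B2 := bessel hab (@TN_inj N) hd.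
rewrite ler_pdivlMl// mulrDr; apply: lerD => //.
by rewrite mulrCA; apply: ler_wpM2l => //; exact: sqr_ge0.
Qed.

End PeriodicSobolev.


(** * Regularity of the exact solution *)

Section SobolevCurves.
Context (R : realType) (a b : R).
Hypothesis hab : a < b.
Local Notation D := (`]a, b[%classic : set R).
Local Notation C := R[i].
Local Notation normL2 := (normL2 a b).
Local Notation wD := (wD a b).
Implicit Types (J : set R) (u v : R -> R -> C).

Lemma cont_L2_iter m k J u X : (forall t, J t -> sobolev a b m (u t)) ->
  curve_continuous X (normH a b m) J u -> (k <= m)%N ->
  cont_L2 a b J (fun t => iter k wD (u t)).
Proof.
move=> su cu km; have sk t : J t -> sobolev a b k (u t).
  by move=> /su; exact: sobolev_le.
split; first by move=> t Jt; apply: (L2_iter hab); exact: sk.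
move=> t Jt eta eta0; have [d d0 Hd] := curve_continuous_eps cu Jt eta0.
exists d => // s Js ts; apply: le_trans (Hd s Js ts).
apply: le_trans (normL2_iter_le a b _ km).
have e := iter_wDB hab (sk s Js) (sk t Jt).
rewrite (ae_normL2 _ _ e)//.
  by apply: (L2_iter hab); apply: sobolevB; exact: sk.
by apply: L2B; apply: (L2_iter hab); exact: sk.
Qed.

Lemma deriv_L2_iter m k J u v : (forall t, J t -> sobolev a b m (u t)) ->
  (forall t, J t -> sobolev a b m (v t)) ->
  curve_deriv (normH a b m) J u v -> (k <= m)%N ->
  deriv_L2 a b J (fun t => iter k wD (u t)) (fun t => iter k wD (v t)).
Proof.
move=> su sv H km t Jt eta eta0.
have sk t' : J t' -> sobolev a b k (u t') by move=> /su; exact: sobolev_le.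
have svk : sobolev a b k (v t) by apply: sobolev_le (sv t Jt).
have [d d0 Hd] := curve_deriv_eps H Jt eta0; exists d => // s Js st ts.
apply: le_trans (Hd s Js st ts); apply: le_trans (normL2_iter_le a b _ km).
set c := ((s - t)^-1)%:C.
have s1 := sobolev_lin c (- c) (sk s Js) (sk t Jt).
have e1 := iter_wD_lin hab c (- c) (sk s Js) (sk t Jt).
have e2 := iter_wDB hab s1 svk.
rewrite (_ : (fun x => c * (u s x - u t x) - v t x) =
   (fun x => c * u s x + - c * u t x - v t x)); last first.
  by apply/funext => x; ring.
have hs := L2_iter hab (sk s Js); have ht := L2_iter hab (sk t Jt).
have hv := L2_iter hab svk.
rewrite (ae_normL2 _ _ e2); last first.
- by apply: L2B => //; apply: (L2_iter hab).
- by apply: (L2_iter hab); apply: sobolevB.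
have e3 : ae_same a b
   (fun x => iter k wD (fun x => c * u s x + - c * u t x) x - iter k wD (v t) x)
   (fun x => c * (iter k wD (u s) x - iter k wD (u t) x) - iter k wD (v t) x).
  by apply: ae_mono e1 => x E Dx; rewrite E//; ring.
rewrite (ae_normL2 _ _ e3)//.
- by apply: L2B => //; apply: (L2_iter hab).
- by apply: L2B => //; apply: L2Z; exact: L2B.
Qed.

End SobolevCurves.

(** The properties of the exact solution that the error analysis uses; [G] is the
    nonlinear term. *)
Record trajectory (R : realType) (a b T : R) (G Psi : R -> R -> R[i]) (K : R) : Prop :=
  Trajectory {
  tr_L2 : forall t, 0 <= t <= T -> L2 a b (Psi t);
  tr_sup : forall t x, 0 <= t <= T -> a < x < b -> Normc.normc (Psi t x) <= K;
  tr_lip : forall s t x, 0 <= s <= T -> 0 <= t <= T -> a < x < b ->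
    Normc.normc (Psi t x - Psi s x) <= K * `|t - s|;
  tr_second : forall t s r, 0 <= t -> 0 <= s -> 0 <= r -> t + s + r <= T ->
    normL2 a b (fun x => Psi (t + s + r) x - Psi (t + s) x - Psi (t + r) x + Psi t x)
    <= K * s * r;
  tr_sum : forall N t, 0 <= t <= T ->
    \sum_(j < N) Normc.normc (fcoef a b (Psi t) (TN j)) <= K;
  tr_ode : forall t l, 0 < t < T ->
    is_derive t (1:R) (fun s => complex.Re (fcoef a b (Psi s) l))
      (freq a b l ^+ 2 * complex.Im (fcoef a b (Psi t) l) +
       complex.Im (fcoef a b (G t) l)) /\
    is_derive t (1:R) (fun s => complex.Im (fcoef a b (Psi s) l))
      (- (freq a b l ^+ 2 * complex.Re (fcoef a b (Psi t) l)) -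
       complex.Re (fcoef a b (G t) l));
  tr_proj : forall t M, 0 <= t <= T -> (0 < M)%N ->
    normL2 a b (fun x => Psi t x - PN a b M.*2 (Psi t) x) <=
    ((b - a) / (2 * pi * M%:R)) ^+ 4 * K }.

Section ExactSolution.
Context (R : realType) (a b : R).
Hypothesis hab : a < b.
Local Notation D := (`]a, b[%classic : set R).
Local Notation C := R[i].
Local Notation re := (@complex.Re R).
Local Notation im := (@complex.Im R).
Local Notation normL2 := (normL2 a b).
Local Notation normc := (@Normc.normc R).
Local Notation wD := (wD a b).
Local Notation fcoef := (fcoef a b).
Local Notation freq := (freq a b).

(** The potential is bounded and measurable only up to a null set; its continuous
    representative [Vb] is so everywhere and gives the same nonlinear term almost
    everywhere. *)
Lemma potential_rep (V : R -> R) : Hper a b 2 (fun x => (V x)%:C) ->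
  exists (Vb : R -> R) (MV : R), [/\ measurable_fun D Vb, forall x, D x -> `|Vb x| <= MV &
    forall beta sigma v, 1 / 2 <= sigma -> L2 a b v ->
    (exists2 r, 1 <= r & forall x, D x -> normc (v x) <= r) ->
    [/\ L2 a b (opB V beta sigma v),
        L2 a b (opB Vb beta sigma v) &
        ae_same a b (opB V beta sigma v) (opB Vb beta sigma v)]].
Proof.
move=> [sV _]; have s1 : sobolev a b 1 (fun x => (V x)%:C) by exact: sobolev_le sV.
have cr := crep_ex hab s1; have [c1 c2 e] := cr.
have hV := sobolev_L2 sV; have [hVr _] := (L2_parts _ _ _).1 hV.
set W := cont_rep a b _ in cr c1 c2 e.
pose MV := csob a b * (normL2 (fun x => (V x)%:C) + normL2 (wD (fun x => (V x)%:C))).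
have mVb : measurable_fun D (fun x => re (W x)) by exact: within_measD.
have WM x : D x -> `|re (W x)| <= MV.
  rewrite inD => /andP[ax xb]; apply: le_trans (re_le_normc _) _.
  by apply: (crep_sup hab s1 cr); rewrite !ltW.
have VW : {ae @leb R, forall x, D x -> V x = re (W x)}.
  by apply: ae_mono e => x E Dx; rewrite E.
exists (fun x => re (W x)), MV; split => // beta sigma v hs hv [r r1 vr].
have h1 := L2_opB beta mVb WM hs hab r1 hv vr.
have ee : ae_same a b (opB V beta sigma v) (opB (fun x => re (W x)) beta sigma v).
  by apply: ae_mono VW => x E Dx; rewrite /opB E.
split => //; apply: (L2_ae _ _ (ae_same_sym ee) h1).
- have := itg_meas (sq_itg (L2_re h1)).
  rewrite (_ : (fun x => re (opB (fun x => re (W x)) beta sigma v x)) =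
    (fun x => re (W x) * re (v x) + re ((nlf beta sigma (normc (v x) ^+ 2))%:C * v x))); last first.
    by apply/funext => x; rewrite /opB reD (reM (re (W x))%:C) /= mul0r subr0.
  move=> m1; rewrite (_ : (fun x => _) = (fun x => V x * re (v x) +
     ((re (W x) * re (v x) + re ((nlf beta sigma (normc (v x) ^+ 2))%:C * v x)) - re (W x) * re (v x)))); last first.
    by apply/funext => x; rewrite /opB reD (reM (V x)%:C) /= mul0r subr0; ring.
  have [vre _] := (L2_parts _ _ _).1 hv.
  apply: measurable_funD; first by apply: measurable_funM; [exact: hVr.1|exact: vre.1].
  by apply: measurable_funB => //; apply: measurable_funM => //; exact: vre.1.
- have := itg_meas (sq_itg (L2_im h1)).
  rewrite (_ : (fun x => im (opB (fun x => re (W x)) beta sigma v x)) =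
    (fun x => re (W x) * im (v x) + im ((nlf beta sigma (normc (v x) ^+ 2))%:C * v x))); last first.
    by apply/funext => x; rewrite /opB imD (imM (re (W x))%:C) /= mul0r addr0.
  move=> m1; rewrite (_ : (fun x => _) = (fun x => V x * im (v x) +
     ((re (W x) * im (v x) + im ((nlf beta sigma (normc (v x) ^+ 2))%:C * v x)) - re (W x) * im (v x)))); last first.
    by apply/funext => x; rewrite /opB imD (imM (V x)%:C) /= mul0r addr0; ring.
  have [_ vim] := (L2_parts _ _ _).1 hv.
  apply: measurable_funD; first by apply: measurable_funM; [exact: hVr.1|exact: vim.1].
  by apply: measurable_funB => //; apply: measurable_funM => //; exact: vim.1.
Qed.

Lemma is_derive_local (f g : R -> R) (x d d0 : R) : is_derive x (1:R) f d ->
  0 < d0 -> (forall z, `|x - z| < d0 -> f z = g z) -> is_derive x (1:R) g d.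
Proof.
move=> H d00 E; apply: near_eq_is_derive H.
by apply/nbhs_ballP; exists d0 => // z /= /E ->.
Qed.

(** A Fourier coefficient is a pairing with a fixed function. *)
Lemma fcoef_ode J (u v : R -> R -> C) t (d0 : R) l : (forall s, J s -> L2 a b (u s)) ->
  L2 a b (v t) -> deriv_L2 a b J u v -> 0 < d0 -> (forall s, `|t - s| < d0 -> J s) ->
  is_derive t (1:R) (fun s => (b - a)^-1 * ip a b (u s) (fmode a b l)) (re (fcoef (v t) l)) /\
  is_derive t (1:R) (fun s => (b - a)^-1 * ip a b (u s) (fun x => 'i%C * fmode a b l x))
    (im (fcoef (v t) l)).
Proof.
move=> hu hv H d00 HJ; rewrite fcoefE//=.
have K1 := ip_is_derive hu hv (L2_fmode a b l) H d00 HJ.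
have K2 := ip_is_derive hu hv (L2_ifmode a b l) H d00 HJ.
by split; apply: is_derive_eq; rewrite /GRing.scale/=; ring.
Qed.

Variables (V : R -> R) (beta sigma T : R) (psi0 : R -> C) (psi : R -> R -> C)
  (Tmax : \bar R).
Hypothesis hsigma : 1 / 2 <= sigma.
Hypothesis hsol : nlse_solution a b V beta sigma psi0 (time_interval Tmax) psi.
Hypothesis hT0 : 0 < T.
Hypothesis hT : (T%:E < Tmax)%E.
Local Notation J := (`[0, T]%classic : set R).
Hypothesis hreg0 : curve_C 0 (Hper a b 4) (normH a b 4) J psi.
Hypothesis hreg1 : curve_C 1 (sobolev a b 2) (normH a b 2) J psi.
Hypothesis hreg2 : curve_C 2 (L2 a b) normL2 J psi.
Variable Vb : R -> R.
Hypothesis hVb : forall beta sigma v, 1 / 2 <= sigma -> L2 a b v ->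
    (exists2 r, 1 <= r & forall x, D x -> normc (v x) <= r) ->
    [/\ L2 a b (opB V beta sigma v),
        L2 a b (opB Vb beta sigma v) &
        ae_same a b (opB V beta sigma v) (opB Vb beta sigma v)].

Let Psi t := cont_rep a b (psi t).

Let hper t : 0 <= t <= T -> Hper a b 4 (psi t).
Proof. by move=> tT; case: hreg0 => -[H _] _; apply: H; rewrite inJ. Qed.

Let hsob k t : (k <= 4)%N -> 0 <= t <= T -> sobolev a b k (psi t).
Proof. by move=> k4 /hper[H _]; exact: sobolev_le H. Qed.

Let hpsi_crep t : 0 <= t <= T -> is_crep a b (psi t) (Psi t).
Proof. by move=> tT; apply: (crep_ex hab); exact: hsob. Qed.

Let hL t : 0 <= t <= T -> L2 a b (psi t).
Proof. by move=> tT; exact: (hsob (k := 0)). Qed.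

Let hPL t : 0 <= t <= T -> L2 a b (Psi t).
Proof. by move=> tT; exact: crep_L2 (hL tT) (hpsi_crep tT). Qed.

Let hPe t : 0 <= t <= T -> ae_same a b (Psi t) (psi t).
Proof. by case/hpsi_crep. Qed.

Let bounds : exists2 K, 1 <= K & forall k t, (k <= 4)%N -> 0 <= t <= T ->
  normL2 (iter k wD (psi t)) <= K.
Proof.
have su t : J t -> sobolev a b 4 (psi t).
  by rewrite inJ => tT; exact: hsob.
have cu k : (k <= 4)%N -> cont_L2 a b J (fun t => iter k wD (psi t)).
  by case: hreg0 => H _ k4; exact: (cont_L2_iter hab su H).
have B k (k4 : (k <= 4)%N) := cont_bounded (ltW hT0) (cu k k4).
have [K0 p0 H0] := B 0 isT; have [K1 p1 H1] := B 1 isT; have [K2 p2 H2] := B 2 isT.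
have [K3 p3 H3] := B 3 isT; have [K4 p4 H4] := B 4 isT.
exists (1 + K0 + K1 + K2 + K3 + K4); first by lra.
move=> [|[|[|[|[|k]]]]] t // _ tT.
- by apply: le_trans (H0 t tT) _; lra.
- by apply: le_trans (H1 t tT) _; lra.
- by apply: le_trans (H2 t tT) _; lra.
- by apply: le_trans (H3 t tT) _; lra.
- by apply: le_trans (H4 t tT) _; lra.
Qed.

Let h1_lipschitz : exists2 K, 0 <= K & forall k s t, (k <= 1)%N ->
  0 <= s <= T -> 0 <= t <= T ->
  normL2 (fun x => iter k wD (psi t) x - iter k wD (psi s) x) <= K * `|t - s|.
Proof.
case: hreg1 => cH [v [dv [cv _]]].
have su t : J t -> sobolev a b 2 (psi t) by case: cH => + _; exact.
have sv t : J t -> sobolev a b 2 (v t) by case: cv => + _; exact.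
have P k : (k <= 2)%N -> exists2 K, 0 <= K & forall s t,
    0 <= s <= T -> 0 <= t <= T ->
    normL2 (fun x => iter k wD (psi t) x - iter k wD (psi s) x) <= K * `|t - s|.
  move=> k2; have c1 := cont_L2_iter hab su cH k2.
  have c2 := cont_L2_iter hab sv cv k2.
  have d1 := deriv_L2_iter hab su sv dv k2.
  have [K K0 HK] := cont_bounded (ltW hT0) c2.
  exists K => // s t sT tT; apply: (curve_lipschitz c1 _ d1 HK K0 sT tT).
  by case: c2.
have [K1 p1 H1] := P 0 isT; have [K2 p2 H2] := P 1 isT.
exists (K1 + K2); first exact: addr_ge0.
move=> [|[|k]] // s t _ sT tT; rewrite mulrDl.
  by apply: le_trans (H1 s t sT tT) _; rewrite lerDl mulr_ge0.
by apply: le_trans (H2 s t sT tT) _; rewrite lerDr mulr_ge0.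
Qed.

(** The pointwise bounds come from the embedding of H1 into the continuous
    functions, applied to the solution and to its increments in time; the second
    differences from two derivatives in L2; the last two fields from periodicity. *)
Lemma solution_trajectory : exists2 K, 1 <= K &
  trajectory a b T (fun t => opB Vb beta sigma (Psi t)) Psi K /\
  forall k t, (k <= 4)%N -> 0 <= t <= T -> normL2 (iter k wD (psi t)) <= K.
Proof.
have [K1 K1_1 HK1] := bounds; have [K2 K2_0 HK2] := h1_lipschitz.
have cs := csob_gt0 hab.
have [v [w [K3 [K3_0 [[c1 c2 hw d1 d2] wK]]]]] : exists (v w : R -> R -> C) (K3 : R), 0 <= K3 /\ [/\ cont_L2 a b J psi,
    cont_L2 a b J v, forall t, J t -> L2 a b (w t), deriv_L2 a b J psi v &
    deriv_L2 a b J v w] /\ forall t, 0 <= t <= T -> normL2 (w t) <= K3.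
  case: hreg2 => c1 [v [d1 [c2 [w [d2 [c3 _]]]]]].
  have [K3 p3 H3] := cont_bounded (ltW hT0) (curve_continuous_L2 c3).
  exists v, w, K3; split => //; split => //; split.
  - exact: curve_continuous_L2.
  - exact: curve_continuous_L2.
  - by case: c3.
  - exact: curve_deriv_eps d1.
  - exact: curve_deriv_eps d2.
pose K4 := 2 + (b - a)^-1 * (K1 ^+ 2 + ((b - a) / (2 * pi)) ^+ 2 * K1 ^+ 2).
have K4_0 : 0 <= K4.
  have ba : 0 <= (b - a)^-1 by rewrite invr_ge0 subr_ge0 ltW.
  by rewrite /K4 !addr_ge0// mulr_ge0// addr_ge0 ?sqr_ge0// mulr_ge0 ?sqr_ge0.
have P1 : 0 <= csob a b * (2 * K1) by rewrite !mulr_ge0 ?(ltW cs)//; lra.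
have P2 : 0 <= csob a b * (2 * K2) by rewrite !mulr_ge0 ?(ltW cs).
pose K := K1 + csob a b * (2 * K1) + csob a b * (2 * K2) + K3 + K4.
have eL t l : 0 <= t <= T -> fcoef (Psi t) l = fcoef (psi t) l.
  by move=> tT; exact: (fcoef_ae l (hPL tT) (hL tT) (hPe tT)).
have sup t x : 0 <= t <= T -> a <= x <= b -> normc (Psi t x) <= csob a b * (2 * K1).
  move=> tT xab; apply: le_trans (crep_sup hab (hsob (k := 1) isT tT) (hpsi_crep tT) xab) _.
  apply: ler_wpM2l; first exact: ltW.
  by have := HK1 0 t isT tT; have := HK1 1 t isT tT; rewrite /=; lra.
exists K; first by rewrite /K; lra.
split; last by move=> k t k4 tT; apply: le_trans (HK1 k t k4 tT) _; rewrite /K; lra.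
split.
- by move=> t tT; exact: hPL.
- move=> t x tT /andP[ax xb]; apply: le_trans (sup t x tT _) _; first by rewrite !ltW.
  by rewrite /K; lra.
- move=> s t x sT tT /andP[ax xb].
  have s1 := hsob (k := 1) isT sT; have t1 := hsob (k := 1) isT tT.
  have xab : a <= x <= b by rewrite !ltW.
  apply: le_trans (crep_sup hab (sobolevB t1 s1) (crep_B (hpsi_crep tT) (hpsi_crep sT)) xab) _.
  have e := iter_wDB hab t1 s1.
  rewrite (ae_normL2 _ _ e) //=; last first.
  + by apply: L2B; apply: (L2_iter hab (n := 1)).
  + by apply: (L2_iter hab (n := 1)); exact: sobolevB.
  have := HK2 0 s t isT sT tT; have := HK2 1 s t isT sT tT; rewrite /= => B1 B2.
  apply: le_trans (_ : csob a b * (2 * K2) * `|t - s| <= _).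
    by rewrite -mulrA; apply: ler_wpM2l; [exact: ltW|lra].
  by apply: ler_wpM2r => //; rewrite /K; lra.
- move=> t s r t0 s0 r0 tsr.
  have b1 : 0 <= t + s + r <= T by apply/andP; split; lra.
  have b2 : 0 <= t + s <= T by apply/andP; split; lra.
  have b3 : 0 <= t + r <= T by apply/andP; split; lra.
  have b4 : 0 <= t <= T by apply/andP; split; lra.
  rewrite (@ae_normL2 _ _ _ _ (fun x => psi (t + s + r) x - psi (t + s) x - psi (t + r) x + psi t x)).
  + apply: le_trans (curve_second_diff c1 c2 hw d1 d2 wK K3_0 t0 s0 r0 tsr) _.
    by rewrite -!mulrA; apply: ler_wpM2r; [exact: mulr_ge0|rewrite /K; lra].
  + by apply: L2D; [apply: L2B; [apply: L2B|]|]; exact: hPL.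
  + by apply: L2D; [apply: L2B; [apply: L2B|]|]; exact: hL.
  + apply: ae_and_mono (ae_and (hPe b1) (hPe b2)) (ae_and (hPe b3) (hPe b4)).
    by move=> x [E1 E2] [E3 E4] Dx; rewrite E1// E2// E3// E4.
- move=> N t tT; under eq_bigr do rewrite (eL t _ tT).
  apply: le_trans (sum_fcoef_bound hab N (hper tT)) _.
  have H0 := HK1 0 t isT tT; have H1 := HK1 1 t isT tT; rewrite /= in H0 H1.
  have K1p : 0 <= K1 by lra.
  have Q0 : normL2 (psi t) ^+ 2 <= K1 ^+ 2 by rewrite lerXn2r ?nnegrE ?normL2_ge0.
  have Q1 : normL2 (wD (psi t)) ^+ 2 <= K1 ^+ 2 by rewrite lerXn2r ?nnegrE ?normL2_ge0.
  apply: le_trans (_ : K4 <= _); last by rewrite /K; lra.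
  rewrite lerD2l; apply: ler_wpM2l; first by rewrite invr_ge0 subr_ge0 ltW.
  by apply: lerD => //; apply: ler_wpM2l => //; exact: sqr_ge0.
- move=> t l tT0; have tT : 0 <= t <= T by case/andP: tT0 => ? ?; rewrite !ltW.
  have [_ _ _ [psit [[cp _] dp pde]]] := hsol.
  have [d0 d00 Hd0] := interior_ball tT0.
  have JT s : 0 <= s <= T -> time_interval Tmax s.
    by move=> /andP[s0 sT]; split => //; apply: le_lt_trans hT; rewrite lee_fin.
  have Hd1 s : `|t - s| < d0 -> J s by move=> /Hd0; rewrite inJ.
  have cpt : L2 a b (psit t) by case: cp => + _; apply; exact: JT.
  have dJ : deriv_L2 a b J psi psit.
    move=> s Js eta eta0; have sT : 0 <= s <= T by rewrite -(inJ T s).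
    have [d dgt Hd] := curve_deriv_eps dp (JT s sT) eta0.
    by exists d => // r Jr; apply: Hd; apply: JT; rewrite -(inJ T r).
  have hLJ s : J s -> L2 a b (psi s) by rewrite inJ; exact: hL.
  have [D1 D2] := fcoef_ode l hLJ cpt dJ d00 Hd1.
  have [hG1 hG2 hG3] : [/\ L2 a b (opB V beta sigma (Psi t)),
        L2 a b (opB Vb beta sigma (Psi t)) &
        ae_same a b (opB V beta sigma (Psi t)) (opB Vb beta sigma (Psi t))].
    apply: hVb => //; first exact: hPL.
    exists (1 + csob a b * (2 * K1)); first by rewrite lerDl.
    move=> x; rewrite inD => /andP[ax xb]; apply: le_trans (sup t x tT _) _.
      by rewrite !ltW.
    by rewrite lerDr.
  have hpp : L2 a b (iter 2 wD (psi t)) by apply: (L2_iter hab); exact: hsob.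
  have E : ae_same a b (fun x => 'i%C * psit t x)
      (fun x => opB Vb beta sigma (Psi t) x - iter 2 wD (psi t) x).
    have := pde t (JT t tT); case/andP: tT0 => t0 _ /(_ t0) P.
    apply: ae_and_mono (ae_and P (hPe tT)) hG3 => x [E1 E2] E3 Dx.
    rewrite E1// -E3// addrC; congr (_ - _).
    by rewrite /opB E2.
  have F := fcoef_ae l (L2Z _ cpt) (L2B hG2 hpp) E.
  move: F; rewrite (fcoefZ _ _ cpt) (fcoefB _ hG2 hpp) (fcoef_iter_wD hab l (hper tT))// -(eL t l tT).
  set p := fcoef (psit t) l in D1 D2 *; set c := fcoef (Psi t) l.
  set g := fcoef (opB _ _ _ _) l => F.
  have F1 : re p = freq l ^+ 2 * im c + im g.
    have := congr1 im F; rewrite im_iM imB => ->.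
    have -> : ('i%C * (freq l)%:C) ^+ 2 = - (freq l ^+ 2)%:C :> C.
      by rewrite exprMn sqr_i mulN1r rmorphXn.
    by rewrite mulNr imN imM /= mul0r addr0; ring.
  have F2 : im p = - (freq l ^+ 2 * re c) - re g.
    have := congr1 re F; rewrite re_iM reB => /eqP; rewrite eqr_oppLR => /eqP ->.
    have -> : ('i%C * (freq l)%:C) ^+ 2 = - (freq l ^+ 2)%:C :> C.
      by rewrite exprMn sqr_i mulN1r rmorphXn.
    by rewrite mulNr reN reM /= mul0r subr0; ring.
  rewrite -F1 -F2; split.
    apply: (is_derive_local D1 d00) => s /Hd0 sT.
    by rewrite eL// fcoefE//; exact: hL.
  apply: (is_derive_local D2 d00) => s /Hd0 sT.
  by rewrite eL// fcoefE//; exact: hL.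
- move=> t M tT M0.
  have ba : 0 < b - a by rewrite subr_gt0.
  rewrite (@ae_normL2 _ _ _ _ (fun x => psi t x - PN a b M.*2 (psi t) x)).
  + apply: le_trans (proj_error_per hab (hper tT) (leqnn 4) isT M0) _.
    apply: ler_wpM2l.
      by rewrite exprn_ge0// divr_ge0 ?(ltW ba)// !mulr_ge0 ?pi_ge0.
    by apply: le_trans (HK1 4 t isT tT) _; rewrite /K; lra.
  + by apply: L2B; [exact: hPL|exact: L2_PN].
  + by apply: L2B; [exact: hL|exact: L2_PN].
  + rewrite (PN_ae _ (hPL tT) (hL tT) (hPe tT)).
    by apply: ae_mono (hPe tT) => x E Dx; rewrite E.
Qed.

End ExactSolution.


(** * Truncated Duhamel formulas *)

Section ComplexCurves.
Context (R : realType).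
Local Notation C := R[i].
Local Notation re := (@complex.Re R).
Local Notation im := (@complex.Im R).
Implicit Types (z : R -> C) (s t w : R) (d : C).

(** Componentwise, to use the real mean value theorem. *)
Definition cderive z t d := is_derive t (1:R) (fun s => re (z s)) (re d) /\
  is_derive t (1:R) (fun s => im (z s)) (im d).

Definition ccontinuous z := continuous (fun s => re (z s)) /\
  continuous (fun s => im (z s)).

Lemma cderive_cst (c : C) t : cderive (fun=> c) t 0.
Proof. by split; exact: is_derive_cst. Qed.

Lemma cderiveD z1 z2 t d1 d2 : cderive z1 t d1 -> cderive z2 t d2 ->
  cderive (fun s => z1 s + z2 s) t (d1 + d2).
Proof.
move=> [r1 i1] [r2 i2]; split; rewrite (reD, imD).
  rewrite (_ : (fun s => _) = (fun s => re (z1 s)) + (fun s => re (z2 s))).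
    exact: is_deriveD.
  by apply/funext => s; rewrite reD.
rewrite (_ : (fun s => _) = (fun s => im (z1 s)) + (fun s => im (z2 s))).
  exact: is_deriveD.
by apply/funext => s; rewrite imD.
Qed.

Lemma cderiveM z1 z2 t d1 d2 : cderive z1 t d1 -> cderive z2 t d2 ->
  cderive (fun s => z1 s * z2 s) t (d1 * z2 t + z1 t * d2).
Proof.
move=> [r1 i1] [r2 i2]; split.
  rewrite (_ : (fun s => _) =
    (fun s => re (z1 s) * re (z2 s) - im (z1 s) * im (z2 s))).
    by apply: is_derive_eq; rewrite reD !reM /GRing.scale/=; ring.
  by apply/funext => s; rewrite reM.
rewrite (_ : (fun s => _) =
    (fun s => re (z1 s) * im (z2 s) + im (z1 s) * re (z2 s))).
  by apply: is_derive_eq; rewrite imD !imM /GRing.scale/=; ring.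
by apply/funext => s; rewrite imM.
Qed.

Lemma cderiveZ (c : C) z t d : cderive z t d -> cderive (fun s => c * z s) t (c * d).
Proof.
by move=> H; have := cderiveM (cderive_cst c t) H; rewrite mul0r add0r.
Qed.

Lemma cderive_sum n (z : 'I_n -> R -> C) t (d : 'I_n -> C) :
  (forall i, cderive (z i) t (d i)) ->
  cderive (fun s => \sum_i z i s) t (\sum_i d i).
Proof.
elim: n z d => [|n IH] z d H.
  rewrite big_ord0 (_ : (fun s => _) = (fun=> 0)); first exact: cderive_cst.
  by apply/funext => s; rewrite big_ord0.
rewrite big_ord_recl (_ : (fun s => _) =
  (fun s => z ord0 s + \sum_(i < n) z (lift ord0 i) s)).
  by apply: cderiveD => //; apply: IH.
by apply/funext => s; rewrite big_ord_recl.
Qed.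

Lemma cderive_affine z (c e t : R) d : cderive z (c + e * t) d ->
  cderive (fun s => z (c + e * s)) t (e%:C * d).
Proof.
have K : is_derive t (1:R) (fun s => c + e * s) e.
  by apply: is_derive_eq; rewrite /GRing.scale/=; ring.
move=> [r i]; split.
  have := @is_derive1_comp _ (fun s => re (z s)) (fun s => c + e * s) t _ _ r K.
  by rewrite (_ : re (_ * _) = re d * e)// reM /=; ring.
have := @is_derive1_comp _ (fun s => im (z s)) (fun s => c + e * s) t _ _ i K.
by rewrite (_ : im (_ * _) = im d * e)// imM /=; ring.
Qed.

Lemma cderive_ei w t : cderive (fun s => ei (w * s)) t ('i%C * w%:C * ei (w * t)).
Proof.
split.
  have -> : re ('i%C * w%:C * ei (w * t)) = - sin (w * t) * w.
    by rewrite -mulrA re_iM imM /=; ring.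
  have K : is_derive t (1:R) (fun s => w * s) w.
    by apply: is_derive_eq; rewrite /GRing.scale/=; ring.
  exact: (@is_derive1_comp _ (@cos R) (fun s => w * s) t _ _ (is_derive_cos _) K).
have -> : im ('i%C * w%:C * ei (w * t)) = cos (w * t) * w.
  by rewrite -mulrA im_iM reM /=; ring.
have K : is_derive t (1:R) (fun s => w * s) w.
  by apply: is_derive_eq; rewrite /GRing.scale/=; ring.
exact: (@is_derive1_comp _ (@sin R) (fun s => w * s) t _ _ (is_derive_sin _) K).
Qed.

Lemma ccontinuous_cst (c : C) : ccontinuous (fun=> c).
Proof. by split => x; exact: cvg_cst. Qed.

Lemma ccontinuousD z1 z2 : ccontinuous z1 -> ccontinuous z2 ->
  ccontinuous (fun s => z1 s + z2 s).
Proof.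
move=> [r1 i1] [r2 i2]; split.
  rewrite (_ : (fun s => _) = (fun s => re (z1 s)) \+ (fun s => re (z2 s))).
    by move=> x; apply: cvgD; [exact: r1|exact: r2].
  by apply/funext => s; rewrite reD.
rewrite (_ : (fun s => _) = (fun s => im (z1 s)) \+ (fun s => im (z2 s))).
  by move=> x; apply: cvgD; [exact: i1|exact: i2].
by apply/funext => s; rewrite imD.
Qed.

Lemma ccontinuousM z1 z2 : ccontinuous z1 -> ccontinuous z2 ->
  ccontinuous (fun s => z1 s * z2 s).
Proof.
move=> [r1 i1] [r2 i2]; split.
  rewrite (_ : (fun s => _) =
    (fun s => re (z1 s) * re (z2 s) - im (z1 s) * im (z2 s))).
    by move=> x; apply: cvgB; apply: cvgM; [exact: r1|exact: r2|exact: i1|exact: i2].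
  by apply/funext => s; rewrite reM.
rewrite (_ : (fun s => _) =
    (fun s => re (z1 s) * im (z2 s) + im (z1 s) * re (z2 s))).
  by move=> x; apply: cvgD; apply: cvgM; [exact: r1|exact: i2|exact: i1|exact: r2].
by apply/funext => s; rewrite imM.
Qed.

Lemma ccontinuous_sum n (z : 'I_n -> R -> C) :
  (forall i, ccontinuous (z i)) -> ccontinuous (fun s => \sum_i z i s).
Proof.
elim: n z => [|n IH] z H.
  rewrite (_ : (fun s => _) = (fun=> 0)); first exact: ccontinuous_cst.
  by apply/funext => s; rewrite big_ord0.
rewrite (_ : (fun s => _) =
  (fun s => z ord0 s + \sum_(i < n) z (lift ord0 i) s)).
  by apply: ccontinuousD => //; apply: IH.
by apply/funext => s; rewrite big_ord_recl.
Qed.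

Lemma ccontinuous_affine z (c e : R) : ccontinuous z ->
  ccontinuous (fun s => z (c + e * s)).
Proof.
have K : continuous (fun s => c + e * s).
  by move=> x; apply: cvgD; [exact: cvg_cst|apply: cvgM; [exact: cvg_cst|exact: cvg_id]].
move=> [r i]; split=> x.
  exact: (continuous_comp (K x) (r _)).
exact: (continuous_comp (K x) (i _)).
Qed.

Lemma ccontinuous_derive z (dz : R -> C) : (forall t, cderive z t (dz t)) -> ccontinuous z.
Proof.
by move=> H; split; [apply: (is_derive_continuous (df := fun t => re (dz t)))|
  apply: (is_derive_continuous (df := fun t => im (dz t)))] => x; case: (H x).
Qed.

Lemma ccontinuous_ei w : ccontinuous (fun s => ei (w * s)).
Proof. exact: (ccontinuous_derive (cderive_ei w)). Qed.

Lemma sin_le t : 0 <= t -> sin t <= t.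
Proof.
rewrite le_eqVlt => /predU1P[<-|t0]; first by rewrite sin0.
have cs : {within `[0, t], continuous (@sin R)}.
  by apply: continuous_subspaceT => x; exact: continuous_sin.
have [c _] := @MVT R sin cos 0 t t0 (fun x _ => is_derive_sin x) cs.
rewrite sin0 !subr0 => ->; rewrite -[leRHS]mul1r; apply: ler_wpM2r (cos_le1 _).
exact: ltW.
Qed.

Lemma normr_sin_le t : 0 <= t -> `|sin t| <= t.
Proof.
move=> t0; rewrite ler_norml sin_le// andbT.
have [t1|t1] := leP t 1; last by have := sin_geN1 t; lra.
suff : 0 <= sin t by lra.
by apply: sin_ge0_pi; apply/andP; split => //; have := pi_ge2 R; lra.
Qed.

(** The integral of [cos (w r)] over [0 <= r <= s]. *)
Definition int_cos w s : R := if w == 0 then s else sin (w * s) / w.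

(** The integral of [ei (w r)] over [0 <= r <= s]. *)
Definition int_ei w s : C :=
  if w == 0 then s%:C else (ei (w * s) - 1) / ('i%C * w%:C).

Lemma i_neq0 : 'i%C != 0 :> C.
Proof. by apply/eqP => -[] /eqP; rewrite oner_eq0. Qed.

Lemma realC_neq0 w : w != 0 -> w%:C != 0 :> C.
Proof. by move=> w0; rewrite fmorph_eq0. Qed.

Lemma cderive_int_cos w t : cderive (fun s => (int_cos w s)%:C) t (cos (w * t))%:C.
Proof.
rewrite /int_cos; split => /=; last exact: is_derive_cst.
case: eqVneq => [->|w0]; first by rewrite mul0r cos0; exact: is_derive_id.
have K : is_derive t (1:R) (fun s => w * s) w.
  by apply: is_derive_eq; rewrite /GRing.scale/=; ring.
have D := @is_derive1_comp _ (@sin R) (fun s => w * s) t _ _ (is_derive_sin _) K.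
rewrite (_ : (fun s => _) = (fun s => w^-1 * (sin \o (fun s => w * s)) s)).
  by apply: is_derive_eq; rewrite /GRing.scale/=; field.
by apply/funext => s; rewrite mulrC.
Qed.

Lemma cderive_int_ei w t : cderive (int_ei w) t (ei (w * t)).
Proof.
rewrite /int_ei; case: (eqVneq w 0) => [->|w0].
  by rewrite mul0r ei0; split; [exact: is_derive_id|exact: is_derive_cst].
have iw : 'i%C * w%:C != 0 :> C by rewrite mulf_neq0 ?i_neq0 ?realC_neq0.
have := cderiveZ ('i%C * w%:C)^-1 (cderiveD (cderive_ei w t) (cderive_cst (-1) t)).
rewrite addr0 mulKf//; congr cderive.
by apply/funext => s; rewrite mulrC.
Qed.

Lemma int_cos0 w : int_cos w 0 = 0.
Proof. by rewrite /int_cos; case: ifP => // _; rewrite mulr0 sin0 mul0r. Qed.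

Lemma int_ei0 w : int_ei w 0 = 0.
Proof. by rewrite /int_ei; case: ifP => // _; rewrite mulr0 ei0 subrr mul0r. Qed.

Lemma int_cos_le w t : 0 <= w -> 0 <= t -> `|int_cos w t| <= t.
Proof.
move=> w0 t0; rewrite /int_cos; case: (eqVneq w 0) => [_|wn0]; first by rewrite ger0_norm.
have wp : 0 < w by rewrite lt_neqAle eq_sym wn0.
by rewrite normrM normfV (gtr0_norm wp) ler_pdivrMr// mulrC normr_sin_le// mulr_ge0.
Qed.

Lemma int_ei_le w t : 0 <= w -> 0 <= t -> Normc.normc (int_ei w t) <= t.
Proof.
move=> w0 t0; rewrite /int_ei; case: (eqVneq w 0) => [_|wn0].
  by rewrite normc_real ger0_norm.
have wp : 0 < w by rewrite lt_neqAle eq_sym wn0.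
rewrite Normc.normcM Normc.normcV Normc.normcM normc_i mul1r normc_real (gtr0_norm wp).
rewrite ler_pdivrMr// -(@ler_pXn2r _ 2) ?nnegrE ?mulr_ge0 ?normc_ge0//.
rewrite normc_ei_sub1 -[X in X <= _]real_normK ?num_real// lerXn2r ?nnegrE ?mulr_ge0//.
rewrite normrM (@ger0_norm _ 2)//.
have : `|sin (w * t / 2)| <= w * t / 2 by rewrite normr_sin_le// !mulr_ge0.
lra.
Qed.

(** The multipliers of the scheme are the integrals that Duhamel's formula leaves
    once the nonlinear term is frozen at the middle, or for the first step at the
    left end, of the time interval. *)
Lemma mul_phi_s w (tau : R) : tau != 0 -> tau * phi_s (tau * - w) = int_cos w tau.
Proof.
move=> t0; rewrite /phi_s /int_cos mulf_eq0 (negbTE t0) oppr_eq0/=.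
case: (eqVneq w 0) => [_|w0]; first by rewrite mulr1.
by rewrite mulrN sinN (mulrC tau w); field; rewrite w0.
Qed.

Lemma mul_phi_1 w (tau : R) : tau != 0 ->
  ei (w * tau) * (tau%:C * phi_1 ('i%C * (tau * - w)%:C)) = int_ei w tau.
Proof.
move=> t0; rewrite /phi_1 /int_ei.
case: (eqVneq w 0) => [->|w0].
  by rewrite oppr0 !mulr0 eqxx mul0r ei0 mulr1 mul1r.
have r0 : (tau * - w)%:C != 0 :> C by rewrite realC_neq0// mulf_neq0// oppr_eq0.
rewrite mulf_eq0 (negbTE i_neq0) (negbTE r0)/= cexp_i mulrN (mulrC tau w).
rewrite rmorphN rmorphM/= mulrN invrN !mulrA.
have wC := realC_neq0 w0; have tC := realC_neq0 t0.
rewrite mulrN -mulNr (_ : - (ei (w * tau) * tau%:C * (ei (- (w * tau)) - 1)) =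
  tau%:C * (ei (w * tau) - ei (w * tau) * ei (- (w * tau)))); last by ring.
by rewrite eiNK -(mulrA 'i%C) -rmorphM/= (mulrC w tau) rmorphM /=; field; rewrite i_neq0 wC tC.
Qed.

End ComplexCurves.


Section CoefficientNorm.
Context (R : realType) (a b : R).
Hypothesis hab : a < b.
Local Notation C := R[i].
Local Notation re := (@complex.Re R).
Local Notation im := (@complex.Im R).
Local Notation normc := (@Normc.normc R).

(** By Parseval this is a multiple of the l^2 norm; reading it off the
    trigonometric polynomial gives the triangle inequality and makes the
    constants in the comparison with the L^2 norm equal to 1. *)
Definition ell n (c : 'I_n -> C) : R := normL2 a b (trigpoly a b (@TN n) c).

Variable n : nat.
Implicit Types (c d : 'I_n -> C).

Let ba_gt0 : 0 < b - a. Proof. by rewrite subr_gt0. Qed.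

Lemma ell_ge0 c : 0 <= ell c. Proof. exact: normL2_ge0. Qed.

Lemma ell_sqr c : ell c ^+ 2 = (b - a) * \sum_(j < n) normc (c j) ^+ 2.
Proof. by rewrite /ell normL2_trigpoly//; exact: TN_inj. Qed.

Lemma ellD c d : ell (fun j => c j + d j) <= ell c + ell d.
Proof.
have := normL2D (L2_trigpoly a b (@TN n) c) (L2_trigpoly a b (@TN n) d).
rewrite (_ : (fun x => _) = trigpoly a b (@TN n) (fun j => c j + d j))//.
apply/funext => x; rewrite /trigpoly -big_split/=.
by apply: eq_bigr => j _; rewrite mulrDl.
Qed.

Lemma ell_le K c d : 0 <= K -> (forall j, normc (c j) <= K * normc (d j)) ->
  ell c <= K * ell d.
Proof.
move=> K0 H; rewrite -(@ler_pXn2r _ 2) ?nnegrE ?mulr_ge0 ?ell_ge0//.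
rewrite exprMn !ell_sqr mulrCA ler_pM2l// mulr_sumr; apply: ler_sum => j _.
by rewrite -exprMn lerXn2r ?nnegrE ?mulr_ge0 ?normc_ge0.
Qed.

Lemma ell_mono c d : (forall j, normc (c j) <= normc (d j)) -> ell c <= ell d.
Proof. by move=> H; rewrite -[leRHS]mul1r; apply: ell_le => // j; rewrite mul1r. Qed.

Lemma eq_ell c d : (forall j, c j = d j) -> ell c = ell d.
Proof. by move=> H; congr ell; apply/funext. Qed.

Lemma ell0 : ell (fun _ : 'I_n => 0) = 0.
Proof.
apply/eqP; rewrite -[_ == 0](@expf_eq0 _ _ 2) ell_sqr big1 ?mulr0// => j _.
by rewrite Normc.normc0 expr0n.
Qed.

Lemma ell_sum m (F : nat -> 'I_n -> C) :
  ell (fun j => \sum_(k < m) F k j) <= \sum_(k < m) ell (F k).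
Proof.
elim: m => [|m IH].
  by rewrite big_ord0 (@eq_ell _ (fun=> 0)) ?ell0// => j; rewrite big_ord0.
rewrite big_ord_recr/= (@eq_ell _ (fun j => \sum_(k < m) F k j + F m j)); last first.
  by move=> j; rewrite big_ord_recr.
by apply: le_trans (ellD _ _) _; rewrite lerD2r.
Qed.

Lemma ell_fcoef u : L2 a b u -> ell (fun j : 'I_n => fcoef a b u (TN j)) <= normL2 a b u.
Proof.
move=> hu; rewrite -(@ler_pXn2r _ 2) ?nnegrE ?normL2_ge0 ?ell_ge0//.
by rewrite ell_sqr; apply: bessel => //; exact: TN_inj.
Qed.

(** The mean value theorem for the pairing of [Z s] with [Z tau]. *)
Lemma ell_growth (Z dZ : R -> 'I_n -> C) (tau B : R) : 0 < tau -> 0 <= B ->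
  (forall j, ccontinuous (Z^~ j)) -> (forall j, Z 0 j = 0) ->
  (forall s j, 0 < s < tau -> cderive (Z^~ j) s (dZ s j)) ->
  (forall s, 0 < s < tau -> ell (dZ s) <= B) -> ell (Z tau) <= B * tau.
Proof.
move=> tau0 B0 cZ Z0 HZ HB.
pose pair c d : R := re (\sum_j conjc (c j) * d j).
have pairE c d : (b - a) * pair c d = ip a b (trigpoly a b (@TN n) c) (trigpoly a b (@TN n) d).
  rewrite (ip_trigpoly hab); last exact: L2_trigpoly.
  rewrite /pair re_sum; congr (_ * _); apply: eq_bigr => j _.
  rewrite (fcoef_trigpoly_inj hab)//; last exact: TN_inj.
  by case: (c j) => ? ?; rewrite reM /=; ring.
pose zeta s : C := \sum_j conjc (Z tau j) * Z s j.
have cz : ccontinuous zeta.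
  by apply: ccontinuous_sum => j; apply: ccontinuousM => //; exact: ccontinuous_cst.
have dz s : s \in `]0, tau[%R -> is_derive s (1:R) (fun t => re (zeta t)) (pair (Z tau) (dZ s)).
  rewrite in_itv/= => sT; have [+ _] : cderive zeta s (\sum_j conjc (Z tau j) * dZ s j).
    by apply: cderive_sum => j; apply: cderiveZ; exact: HZ.
  by [].
have [s sT E] := MVT tau0 dz (continuous_subspaceT cz.1).
rewrite in_itv/= in sT; move: E.
rewrite (_ : zeta 0 = 0) ?subr0 /=; last first.
  by rewrite /zeta big1// => j _; rewrite Z0 mulr0.
move=> E; apply: cancel_norm; [exact: ell_ge0|by rewrite mulr_ge0 // ltW|].
rewrite {1}/ell normL2_sqr -pairE [pair _ _]E mulrA pairE [leRHS]mulrAC.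
apply: ler_wpM2r; first exact: ltW.
apply: le_trans (ler_norm _) _.
have hz := L2_trigpoly a b (@TN n).
apply: le_trans (ip_CS (hz _) (hz _)) _.
by rewrite mulrC; apply: ler_wpM2r; [exact: ell_ge0|exact: HB].
Qed.

(** Summation by parts against oscillating weights [rho] whose partial sums
    are damped by [alpha]. *)
Lemma ell_abel (alpha : 'I_n -> R) (rho d : nat -> 'I_n -> C) (B : R) M : 0 <= B ->
  (forall k j, `|alpha j| * normc (\sum_(i < k) rho i j) <= B) ->
  ell (fun j => (alpha j)%:C * \sum_(m < M.+1) rho m j * d m j) <=
  B * (ell (d M) + \sum_(m < M) ell (fun j => d m.+1 j - d m j)).
Proof.
move=> B0 HB; pose S k j : C := \sum_(i < k) rho i j.
have SE k j : S k.+1 j = S k j + rho k j by rewrite /S big_ord_recr.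
have E j : \sum_(m < M.+1) rho m j * d m j =
    S M.+1 j * d M j - \sum_(m < M) S m.+1 j * (d m.+1 j - d m j).
  elim: M => [|M IH]; first by rewrite /S !big_ord1 big_ord0 subr0.
  rewrite big_ord_recr/= IH (SE M.+1) [in RHS]big_ord_recr/=; ring.
rewrite (@eq_ell _ (fun j => (alpha j)%:C * S M.+1 j * d M j +
   \sum_(m < M) - ((alpha j)%:C * S m.+1 j * (d m.+1 j - d m j)))); last first.
  move=> j; rewrite E mulrBr mulrA sumrN; congr (_ - _).
  by rewrite mulr_sumr; apply: eq_bigr => m _; rewrite mulrA.
have P k c : ell (fun j => (alpha j)%:C * S k j * c j) <= B * ell c.
  apply: ell_le => // j; rewrite !Normc.normcM normc_real.
  by apply: ler_wpM2r; [exact: normc_ge0|exact: HB].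
apply: le_trans (ellD _ _) _; rewrite mulrDr; apply: lerD; first exact: P.
apply: le_trans (ell_sum M
  (fun m j => - ((alpha j)%:C * S m.+1 j * (d m.+1 j - d m j)))) _.
rewrite mulr_sumr; apply: ler_sum => m _.
apply: le_trans (P m.+1 _); apply: ell_mono => j.
by rewrite normcN.
Qed.

End CoefficientNorm.

Section Consistency.
Context (R : realType) (a b : R).
Hypothesis hab : a < b.
Local Notation C := R[i].
Local Notation normc := (@Normc.normc R).
Local Notation ell := (ell a b).
Variables (n : nat) (w : 'I_n -> R) (tau T K : R) (c g : R -> 'I_n -> C).
Hypothesis w_ge0 : forall j, 0 <= w j.
Hypothesis tau_gt0 : 0 < tau.
Hypothesis cfl : forall j, tau * w j <= pi / 2.
Hypothesis K_ge0 : 0 <= K.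
Hypothesis c_cont : forall j, ccontinuous (c^~ j).
Hypothesis c_ode : forall t j, 0 < t < T ->
  cderive (c^~ j) t (- ('i%C * ((w j)%:C * c t j + g t j))).
Hypothesis g_lip : forall s t, 0 <= s -> s <= t -> t <= T ->
  ell (fun j => g t j - g s j) <= K * (t - s).
Hypothesis g_second : forall t s r, 0 <= t -> 0 <= s -> 0 <= r -> t + s + r <= T ->
  ell (fun j => g (t + s + r) j - g (t + s) j - g (t + r) j + g t j) <= K * s * r.

Lemma mul_ii : 'i%C * 'i%C = -1 :> C.
Proof. by rewrite -expr2 sqr_i. Qed.

(** As a function of [tau], the defect vanishes at 0 and has the derivative
    [- i ei (w s) (g s - g 0)], which is of order [s]. *)
Lemma first_step_defect : tau <= T ->
  ell (fun j => ei (w j * tau) * c tau j - c 0 j + 'i%C * int_ei (w j) tau * g 0 j)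
  <= K * tau * tau.
Proof.
move=> tauT.
pose Z s j : C := ei (w j * s) * c s j + (- c 0 j) + int_ei (w j) s * ('i%C * g 0 j).
pose dZ s j : C := 'i%C * (w j)%:C * ei (w j * s) * c s j +
  ei (w j * s) * (- ('i%C * ((w j)%:C * c s j + g s j))) + 0 +
  (ei (w j * s) * ('i%C * g 0 j) + int_ei (w j) s * 0).
have dei j s := @cderive_int_ei R (w j) s.
rewrite (@eq_ell _ _ _ _ _ (Z tau)); last by move=> j; rewrite /Z; ring.
apply: (@ell_growth _ _ _ hab _ Z dZ) => //.
- by rewrite mulr_ge0 // ltW.
- move=> j; apply: ccontinuousD; last first.
    by apply: ccontinuousM; [exact: (ccontinuous_derive (dei j))|exact: ccontinuous_cst].
  by apply: ccontinuousD; [apply: ccontinuousM => //; exact: ccontinuous_ei|exact: ccontinuous_cst].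
- by move=> j; rewrite /Z mulr0 ei0 int_ei0; ring.
- move=> s j /andP[s0 st]; apply: cderiveD; last by apply: cderiveM => //; exact: cderive_cst.
  apply: cderiveD; last exact: cderive_cst.
  apply: cderiveM; first exact: cderive_ei.
  by apply: c_ode; rewrite s0 (lt_le_trans st).
- move=> s /andP[s0 st]; apply: le_trans (_ : K * (s - 0) <= _); last first.
    by rewrite subr0; apply: ler_wpM2l => //; exact: ltW.
  apply: le_trans (g_lip (lexx 0) (ltW s0) (le_trans (ltW st) tauT)).
  apply: (@ell_mono _ _ _ hab) => j.
  rewrite (_ : dZ s j = - 'i%C * ei (w j * s) * (g s j - g 0 j)); last by rewrite /dZ; ring.
  by rewrite !Normc.normcM normcN normc_i normc_ei !mul1r.
Qed.

(** The ratio of the geometric sum is at distance [2 sin (tau w)] from 1. The step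
    size restriction keeps [tau w] below [pi / 2], hence this distance above
    [tau w / 2]: there is no resonance, and [|sin (w s)| <= w tau] compensates. *)
Lemma damped_geometric j s k (r0 : R) : 0 <= s -> s <= tau ->
  `|sin (w j * s)| * normc (\sum_(i < k) ei (r0 + (w j * tau) *+ 2 * i%:R)) <= 4.
Proof.
move=> s0 st; set theta := w j * tau; set S := \sum_(i < k) _.
have th0 : 0 <= theta by rewrite mulr_ge0// ltW.
have E : S * (ei (theta *+ 2) - 1) = ei (r0 + theta *+ 2 * k%:R) - ei r0.
  rewrite /S; elim: k {S} => [|k IH]; first by rewrite big_ord0 mulr0 addr0 subrr mul0r.
  rewrite big_ord_recr/= mulrDl IH mulrBr mulr1 -eiD -[in RHS]natr1.
  rewrite (_ : r0 + theta *+ 2 * (k%:R + 1) = r0 + theta *+ 2 * k%:R + theta *+ 2); last by ring.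
  ring.
have N : normc (ei (theta *+ 2) - 1) = 2 * sin theta.
  have sth : 0 <= sin theta by apply: le_trans (sin_ge_quarter th0 _); rewrite ?divr_ge0// /theta mulrC.
  apply/eqP; rewrite -(@eqrXn2 _ 2) ?normc_ge0 ?mulr_ge0// normc_ei_sub1.
  by rewrite (mulr2n theta) (_ : (theta + theta) / 2 = theta)//; field.
have B : normc S * (2 * sin theta) <= 2.
  rewrite -N -Normc.normcM E; apply: le_trans (normcB _ _) _.
  by rewrite !normc_ei.
have q : theta / 4 <= sin theta by apply: sin_ge_quarter => //; rewrite /theta mulrC.
have nS := normc_ge0 S.
have A : `|sin (w j * s)| <= theta.
  apply: le_trans (normr_sin_le _) _; first by rewrite mulr_ge0.
  by apply: ler_wpM2l.
apply: le_trans (_ : theta * normc S <= _); first exact: ler_wpM2r.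
have : normc S * (theta / 4) <= normc S * sin theta by exact: ler_wpM2l.
lra.
Qed.

(** As a function of [tau], the defect at one time level has a derivative made of
    two terms: [cos (w s)] times a second difference of [g], of order [s ^ 2], and
    [sin (w s)] times a first difference, only of order [s]. Summing the latter
    over the time levels costs nothing thanks to the oscillating weights, whose
    damped partial sums are bounded: summation by parts replaces the first
    differences of [g] by second differences. *)
Lemma two_step_defect p M : (p + M.*2)%:R * tau <= T ->
  ell (fun j => \sum_(m < M) ei (w j * tau * (p + m.*2).+1%:R) *
    (ei (w j * tau) * c ((p + m.*2).+2%:R * tau) j
     - ei (- w j * tau) * c ((p + m.*2)%:R * tau) j
     + 2 * 'i%C * (int_cos (w j) tau)%:C * g ((p + m.*2).+1%:R * tau) j))
  <= (17 * K * T + 8 * K) * tau * tau.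
Proof.
case: M => [|M] pM.
  rewrite (@eq_ell _ _ _ _ _ (fun=> 0)); last by move=> j; rewrite big_ord0.
  have T0 : 0 <= T by apply: le_trans pM; rewrite mulr_ge0// ltW.
  by rewrite ell0// !mulr_ge0 ?addr_ge0// ?mulr_ge0// ltW.
pose tk m := (p + m.*2).+1%:R * tau.
have tkE m : tk m = (p + m.*2)%:R * tau + tau.
  by rewrite /tk -[(_).+1%:R]natr1 mulrDl mul1r.
have tkP m : (m < M.+1)%N -> tau <= tk m /\ tk m + tau <= T.
  move=> mM; split; first by rewrite tkE lerDr mulr_ge0// ltW.
  apply: le_trans pM; rewrite /tk -{2}[tau]mul1r -mulrDl natr1.
  by rewrite ler_pM2r// ler_nat; lia.
pose Z s j : C := \sum_(m < M.+1) ei (w j * tau * (p + m.*2).+1%:R) *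
  (ei (w j * s) * c (tk m + 1 * s) j + (-1) * (ei (- w j * s) * c (tk m + -1 * s) j)
   + (int_cos (w j) s)%:C * (2 * 'i%C * g (tk m) j)).
pose dW s j m : C :=
  ('i%C * (w j)%:C * ei (w j * s) * c (tk m + 1 * s) j +
   ei (w j * s) * (1%:C * - ('i%C * ((w j)%:C * c (tk m + 1 * s) j + g (tk m + 1 * s) j)))) +
  (-1) * ('i%C * (- w j)%:C * ei (- w j * s) * c (tk m + -1 * s) j +
   ei (- w j * s) * ((-1)%:C * - ('i%C * ((w j)%:C * c (tk m + -1 * s) j + g (tk m + -1 * s) j)))) +
  ((cos (w j * s))%:C * (2 * 'i%C * g (tk m) j) + (int_cos (w j) s)%:C * 0).
pose dZ s j : C := \sum_(m < M.+1) ei (w j * tau * (p + m.*2).+1%:R) * dW s j m.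
rewrite (@eq_ell _ _ _ _ _ (Z tau)); last first.
  move=> j; apply: eq_bigr => m _; congr (_ * _).
  rewrite mul1r !mulN1r (_ : tk m + tau = (p + m.*2).+2%:R * tau); last first.
    by rewrite /tk -{2}[tau]mul1r -mulrDl natr1.
  rewrite (_ : tk m - tau = (p + m.*2)%:R * tau); last by rewrite tkE addrK.
  by rewrite /tk; ring.
apply: (@ell_growth _ _ _ hab _ Z dZ) => //.
- have T0 : 0 <= T by apply: le_trans pM; rewrite mulr_ge0// ltW.
  by rewrite !mulr_ge0 ?addr_ge0// ?mulr_ge0// ltW.
- move=> j; apply: ccontinuous_sum => m; apply: ccontinuousM; first exact: ccontinuous_cst.
  apply: ccontinuousD; last first.
    apply: ccontinuousM; last exact: ccontinuous_cst.
    exact: (ccontinuous_derive (cderive_int_cos (w j))).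
  apply: ccontinuousD.
    by apply: ccontinuousM; [exact: ccontinuous_ei|exact: (ccontinuous_affine _ _ (c_cont j))].
  apply: ccontinuousM; first exact: ccontinuous_cst.
  by apply: ccontinuousM; [exact: ccontinuous_ei|exact: (ccontinuous_affine _ _ (c_cont j))].
- move=> j; rewrite /Z big1// => m _.
  by rewrite !mulr0 ei0 int_cos0 !addr0; ring.
- move=> s j /andP[s0 st]; apply: cderive_sum => m; apply: cderiveZ.
  have [t1 t2] := tkP m (ltn_ord m).
  apply: cderiveD; last by apply: cderiveM; [exact: cderive_int_cos|exact: cderive_cst].
  apply: cderiveD.
    apply: cderiveM; first exact: cderive_ei.
    apply: (cderive_affine (z := c^~ j)); apply: c_ode; apply/andP; split; lra.
  apply: cderiveZ; apply: cderiveM; first exact: cderive_ei.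
  by apply: (cderive_affine (z := c^~ j)); apply: c_ode; apply/andP; split; lra.
- move=> s /andP[s0 st].
  pose rho m j : C := ei (w j * tau * (p.+1)%:R + (w j * tau) *+ 2 * m%:R).
  pose d1 m j : C := g (tk m + s) j - g (tk m) j - g (tk m) j + g (tk m - s) j.
  pose d2 m j : C := g (tk m + s) j - g (tk m - s) j.
  rewrite (@eq_ell _ _ _ _ _ (fun j =>
     \sum_(m < M.+1) (- ('i%C * (cos (w j * s))%:C * rho m j * d1 m j)) +
     (sin (w j * s))%:C * \sum_(m < M.+1) rho m j * d2 m j)); last first.
    move=> j; rewrite mulr_sumr -big_split/=; apply: eq_bigr => m _.
    have -> : ei (w j * tau * (p + m.*2).+1%:R) = rho m j.
      congr ei; rewrite (mulr2n (_ * tau)) -addSn natrD -addnn natrD; ring.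
    rewrite /dW /d1 /d2 mul1r !mulN1r.
    have -> : ei (w j * s) = (cos (w j * s))%:C + 'i%C * (sin (w j * s))%:C.
      by apply: complex_ext; rewrite ?reD ?imD ?reM ?imM /=; ring.
    have -> : ei (- w j * s) = (cos (w j * s))%:C - 'i%C * (sin (w j * s))%:C.
      by apply: complex_ext; rewrite ?reB ?imB ?reM ?imM mulNr /= ?cosN ?sinN; ring.
    have -> : (- w j)%:C = - (w j)%:C :> C by apply: complex_ext; rewrite /= ?oppr0.
    have -> : (-1)%:C = - 1 :> C by apply: complex_ext; rewrite /= ?oppr0.
    have -> : 1%:C = 1 :> C by [].
    have I := mul_ii; move: (w j)%:C (c _ j) (c _ j) (cos _)%:C (sin _)%:C => W c1 c2 co si.
    move: (g (tk m + s) j) (g (tk m - s) j) (g (tk m) j) (rho m j) => g1 g2 g0 r.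
    move: ('i%C) I => i I.
    transitivity (- (i * co * r * (g1 - g0 - g0 + g2)) - (i * i) * (si * (r * (g1 - g2)))).
      ring.
    by rewrite I; ring.
  apply: le_trans (ellD _ _ _ _) _.
  have sT : s <= tau by exact: ltW.
  have MT : (M.+1)%:R * (2 * tau) <= T.
    apply: le_trans pM; rewrite mulrA ler_pM2r// -natrM ler_nat; lia.
  have A1 : ell (fun j => \sum_(m < M.+1) (- ('i%C * (cos (w j * s))%:C * rho m j * d1 m j)))
      <= K * T * tau.
    apply: le_trans (@ell_sum _ _ _ hab _ M.+1
      (fun m j => (- ('i%C * (cos (w j * s))%:C * rho m j * d1 m j)))) _.
    apply: le_trans (_ : \sum_(m < M.+1) K * s * s <= _).
      apply: ler_sum => m _; have [t1 t2] := tkP m (ltn_ord m).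
      have t0 : 0 <= tk m - s by lra.
      have tT : tk m - s + s + s <= T by lra.
      apply: le_trans (g_second t0 (ltW s0) (ltW s0) tT).
      apply: (@ell_mono _ _ _ hab) => j; rewrite subrK /d1.
      rewrite normcN !Normc.normcM normc_i normc_real normc_ei mulr1 mul1r.
      rewrite -[leRHS]mul1r; apply: ler_wpM2r; first exact: normc_ge0.
      by rewrite ler_norml cos_geN1 cos_le1.
    rewrite sumr_const card_ord -[leLHS]mulr_natl.
    have ss : s * s <= tau * tau by apply: ler_pM => //; exact: ltW.
    apply: le_trans (_ : M.+1%:R * (K * (tau * tau)) <= _).
      by apply: ler_wpM2l => //; rewrite -mulrA; apply: ler_wpM2l.
    have := ler_wpM2l K_ge0 (ler_wpM2r (ltW tau_gt0) MT).
    have Q : 0 <= M.+1%:R * (K * (tau * tau)) by rewrite !mulr_ge0// ltW.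
    lra.
  have A2 : ell (fun j => (sin (w j * s))%:C * \sum_(m < M.+1) rho m j * d2 m j) <=
      4 * (ell (d2 M) + \sum_(m < M) ell (fun j => d2 m.+1 j - d2 m j)).
    apply: (@ell_abel _ _ _ hab _ (fun j => sin (w j * s))) => // k j.
    by apply: damped_geometric => //; exact: ltW.
  have A3 : ell (d2 M) <= 2 * K * tau.
    have [t1 t2] := tkP M (ltnSn M).
    apply: le_trans (g_lip (s := tk M - s) (t := tk M + s) _ _ _) _; try lra.
    have := ler_wpM2l K_ge0 sT; lra.
  have A4 : \sum_(m < M) ell (fun j => d2 m.+1 j - d2 m j) <= 4 * K * T * tau.
    apply: le_trans (_ : \sum_(m < M) K * (2 * s) * (2 * tau) <= _).
      apply: ler_sum => m _; have [t1 t2] := tkP m (ltnW (ltn_ord m)).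
      have [t3 t4] := tkP m.+1 (ltn_ord m).
      have tS : tk m.+1 = tk m + 2 * tau.
        rewrite /tk doubleS !addnS -[_.+3%:R]natr1 -[_.+2%:R]natr1; ring.
      have Ts : tk m - s + 2 * s + 2 * tau <= T by lra.
      apply: le_trans (g_second (t := tk m - s) (s := 2 * s) (r := 2 * tau) _ _ _ Ts); try lra.
      apply: (@ell_mono _ _ _ hab) => j; rewrite /d2 tS.
      rewrite (_ : tk m - s + 2 * s + 2 * tau = tk m + 2 * tau + s); last by ring.
      rewrite (_ : tk m - s + 2 * s = tk m + s); last by ring.
      rewrite (_ : tk m - s + 2 * tau = tk m + 2 * tau - s); last by ring.
      by rewrite [X in normc X <= _](_ : _ = g (tk m + 2 * tau + s) j - g (tk m + s) j
        - g (tk m + 2 * tau - s) j + g (tk m - s) j)//; ring.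
    rewrite sumr_const card_ord -[leLHS]mulr_natl.
    have H1 : M%:R * (2 * tau) <= T.
      by apply: le_trans MT; apply: ler_wpM2r; [lra|rewrite ler_nat].
    have Ks : 0 <= K * s by rewrite mulr_ge0// ltW.
    have H2 := ler_wpM2l Ks H1.
    have T0 : 0 <= T by apply: le_trans H1; rewrite !mulr_ge0// ltW.
    have H3 : K * s * T <= K * T * tau.
      by rewrite mulrAC; apply: ler_wpM2l => //; rewrite mulr_ge0.
    have Q : 0 <= K * s * T by rewrite !mulr_ge0// ltW.
    lra.
  have A5 : 0 <= ell (d2 M) by exact: ell_ge0.
  lra.
Qed.


Variables d gam : nat -> 'I_n -> C.
Hypothesis d0 : forall j, d 0 j = c 0 j.
Hypothesis d1 : forall j,
  ei (w j * tau) * d 1%N j = d 0 j - 'i%C * int_ei (w j) tau * gam 0 j.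
Hypothesis d2 : forall m j, ei (w j * tau * m.+2%:R) * d m.+2 j =
  ei (w j * tau * m%:R) * d m j -
  2 * 'i%C * (int_cos (w j) tau)%:C * (ei (w j * tau * m.+1%:R) * gam m.+1 j).

Local Notation eta k := (fun j => g (k%:R * tau) j - gam k j).

Lemma sum_every_second (x : nat -> R) p M : (forall k, 0 <= x k) ->
  \sum_(m < M) x (p + m.*2).+1 <= \sum_(k < M.*2) x (p + k)%N.
Proof.
move=> x0; elim: M => [|M IH]; first by rewrite !big_ord0.
rewrite doubleS !big_ord_recr/= addnS -addrA; apply: lerD => //.
by rewrite lerDr.
Qed.

(** Applying the scheme to the exact solution, the rotated error at two steps
    apart differs by the local defect and by the error of the nonlinear term. *)
Lemma error_recursion m : m%:R * tau <= T ->
  ell (fun j => c (m%:R * tau) j - d m j) <=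
  (17 * K * T + 9 * K) * tau * tau + 2 * tau * \sum_(k < m) ell (eta k).
Proof.
move=> mT.
pose E k j : C := ei (w j * tau * k%:R) * (c (k%:R * tau) j - d k j).
have normE k : ell (E k) = ell (fun j => c (k%:R * tau) j - d k j).
  by apply/eqP; rewrite eq_le; apply/andP; split; apply: (@ell_mono _ _ _ hab) => j;
    rewrite /E Normc.normcM normc_ei mul1r.
have E0 j : E 0 j = 0 by rewrite /E mul0r d0 subrr mulr0.
have E1 : tau <= T -> ell (E 1%N) <= K * tau * tau + 2 * tau * ell (eta 0).
  move=> tauT; rewrite (@eq_ell _ _ _ _ _ (fun j =>
    (ei (w j * tau) * c tau j - c 0 j + 'i%C * int_ei (w j) tau * g 0 j) +
    (- ('i%C * int_ei (w j) tau)) * (g (0 * tau) j - gam 0 j))); last first.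
    by move=> j; rewrite /E mul0r !mulr1 mul1r mulrBr d1 d0; ring.
  apply: le_trans (ellD _ _ _ _) _; apply: lerD; first exact: first_step_defect.
  apply: (@ell_le _ _ _ hab) => [|j]; first by rewrite mulr_ge0// ltW.
  rewrite Normc.normcM normcN Normc.normcM normc_i mul1r.
  apply: ler_wpM2r; first exact: normc_ge0.
  by apply: le_trans (int_ei_le (w_ge0 j) (ltW tau_gt0)) _; have := ltW tau_gt0; lra.
have telescope p M : (p + M.*2)%:R * tau <= T -> ell (E (p + M.*2)%N) <=
    ell (E p) + ((17 * K * T + 8 * K) * tau * tau +
    2 * tau * \sum_(k < M.*2) ell (eta (p + k)%N)).
  move=> pM; rewrite (@eq_ell _ _ _ _ _ (fun j => E p j +
    (\sum_(m < M) ei (w j * tau * (p + m.*2).+1%:R) *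
    (ei (w j * tau) * c ((p + m.*2).+2%:R * tau) j
     - ei (- w j * tau) * c ((p + m.*2)%:R * tau) j
     + 2 * 'i%C * (int_cos (w j) tau)%:C * g ((p + m.*2).+1%:R * tau) j) +
    \sum_(m < M) - (2 * 'i%C * (int_cos (w j) tau)%:C *
      (ei (w j * tau * (p + m.*2).+1%:R) *
      (g ((p + m.*2).+1%:R * tau) j - gam (p + m.*2).+1 j)))))); last first.
    move=> j; elim: M {pM} => [|M IH]; first by rewrite !big_ord0 addn0 !addr0.
    rewrite !big_ord_recr/= doubleS !addnS.
    set q := (p + M.*2)%N in IH *.
    have X : E q.+2 j = E q j +
       (ei (w j * tau * q.+1%:R) * (ei (w j * tau) * c (q.+2%:R * tau) j
         - ei (- w j * tau) * c (q%:R * tau) j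
         + 2 * 'i%C * (int_cos (w j) tau)%:C * g (q.+1%:R * tau) j) +
       - (2 * 'i%C * (int_cos (w j) tau)%:C *
      (ei (w j * tau * q.+1%:R) * (g (q.+1%:R * tau) j - gam q.+1 j)))).
      have e2 : ei (w j * tau * q.+2%:R) = ei (w j * tau * q.+1%:R) * ei (w j * tau).
        by rewrite -eiD -[q.+2%:R]natr1 mulrDr mulr1.
      have e0 : ei (w j * tau * q%:R) = ei (w j * tau * q.+1%:R) * ei (- w j * tau).
        by rewrite -eiD -[q.+1%:R]natr1; congr ei; ring.
      rewrite /E !mulrBr d2 e2 e0; ring.
    rewrite X IH; ring.
  apply: le_trans (ellD _ _ _ _) _; rewrite lerD2l.
  apply: le_trans (ellD _ _ _ _) _; apply: lerD; first exact: two_step_defect.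
  apply: le_trans (@ell_sum _ _ _ hab _ M (fun m j =>
    - (2 * 'i%C * (int_cos (w j) tau)%:C * (ei (w j * tau * (p + m.*2).+1%:R) *
      (g ((p + m.*2).+1%:R * tau) j - gam (p + m.*2).+1 j))))) _.
  have S := @sum_every_second (fun k => ell (eta k)) p M (fun k => ell_ge0 _ _ _).
  have t2 : 0 <= 2 * tau by rewrite mulr_ge0// ltW.
  apply: le_trans (ler_wpM2l t2 S); rewrite mulr_sumr; apply: ler_sum => k _.
  apply: (@ell_le _ _ _ hab) => // j.
  rewrite normcN !Normc.normcM normc_i normc_ei mul1r mulr1 normc_real.
  have -> : normc 2 = 2 by have := normc_real (2 : R); rewrite ger0_norm// => <-; rewrite rmorph_nat.
  apply: ler_wpM2r; first exact: normc_ge0.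
  by apply: ler_wpM2l => //; exact: int_cos_le (ltW tau_gt0).
have K1 : 0 <= K * tau * tau by rewrite !mulr_ge0// ltW.
have split (q r : nat) : \sum_(k < q + r) ell (eta k) =
    \sum_(k < q) ell (eta k) + \sum_(k < r) ell (eta (q + k)%N) by rewrite big_split_ord.
have := split (odd m) m./2.*2; have := telescope (odd m) m./2.
rewrite odd_double_half normE => P ->; apply: le_trans (P mT) _.
have [om|em] := boolP (odd m); last first.
  rewrite big_ord0 add0r (@eq_ell _ _ _ _ _ (fun=> 0) E0) ?ell0//.
  lra.
rewrite big_ord1.
have tT : tau <= T.
  apply: le_trans mT; rewrite -[leLHS]mul1r ler_pM2r// ler1n.
  by case: (m) om.
have := E1 tT; lra.
Qed.

End Consistency.


(** * The scheme in terms of Fourier coefficients *)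

Section Scheme.
Context (R : realType) (a b : R).
Hypothesis hab : a < b.
Local Notation C := R[i].
Local Notation fcoef := (fcoef a b).
Local Notation freq := (freq a b).
Local Notation tp := (trigpoly a b (@TN _)).
Variables (V : R -> R) (beta sigma : R) (psi0 : R -> C) (N : nat) (tau : R).
Hypothesis tau0 : tau != 0.
Local Notation sEWI := (sEWI a b V beta sigma psi0 N tau).
Local Notation w j := (freq (TN j) ^+ 2).

Lemma trigpolyB (c d : 'I_N -> C) (k : C) :
  (fun x => tp c x - k * tp d x) = tp (fun j => c j - k * d j).
Proof.
apply/funext => x; rewrite /trigpoly mulr_sumr -sumrB.
by apply: eq_bigr => j _; rewrite mulrBl mulrA.
Qed.

Lemma fmult_trigpoly m (c : 'I_N -> C) :
  fmult a b N m (tp c) = tp (fun j => m (- w j) * c j).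
Proof.
apply/funext => x; apply: eq_bigr => j _.
by rewrite (fcoef_trigpoly_inj hab) //; exact: TN_inj.
Qed.

Lemma sEWI_S1 : sEWI 1 =
  (fun x => fmult a b N (fun d => cexp ('i%C * (tau * d)%:C)) (sEWI 0) x
        - 'i%C * tau%:C *
          fmult a b N (fun d => phi_1 ('i%C * (tau * d)%:C))
            (PN a b N (opB V beta sigma (sEWI 0))) x).
Proof. by []. Qed.

Lemma sEWI_S2 n : sEWI n.+2 =
  (fun x =>
        fmult a b N (fun d => cexp ('i%C * (2 * tau * d)%:C)) (sEWI n) x
        - 2 * 'i%C * tau%:C *
          fmult a b N (fun d => cexp ('i%C * (tau * d)%:C))
            (fmult a b N (fun d => (phi_s (tau * d))%:C)
              (PN a b N (opB V beta sigma (sEWI n.+1)))) x).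
Proof. by []. Qed.

Lemma sEWI_trigpoly n : sEWI n = tp (fun j : 'I_N => fcoef (sEWI n) (TN j)).
Proof.
suff [c e] : exists c : 'I_N -> C, sEWI n = tp c.
  rewrite e; congr trigpoly; apply/funext => j.
  by rewrite (fcoef_trigpoly_inj hab) //; exact: TN_inj.
elim/ltn_ind: n => -[|[|n]] IH.
- by exists (fun j : 'I_N => fcoef psi0 (TN j)).
- by rewrite sEWI_S1 (_ : sEWI 0 = PN a b N psi0)//; eexists; rewrite !PN_trigpoly !fmult_trigpoly; exact: trigpolyB.
- have [c e] := IH n (leqnSn n.+1).
  by rewrite sEWI_S2 e; eexists; rewrite !PN_trigpoly !fmult_trigpoly; exact: trigpolyB.
Qed.

Lemma fcoef_PN u (j : 'I_N) : fcoef (PN a b N u) (TN j) = fcoef u (TN j).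
Proof. by rewrite PN_trigpoly (fcoef_trigpoly_inj hab) //; exact: TN_inj. Qed.

Lemma fcoef_sEWI1 (j : 'I_N) :
  ei (w j * tau) * fcoef (sEWI 1) (TN j) =
  fcoef (sEWI 0) (TN j) -
  'i%C * int_ei (w j) tau * fcoef (opB V beta sigma (sEWI 0)) (TN j).
Proof.
rewrite sEWI_S1 (sEWI_trigpoly 0) (PN_trigpoly _ _ _ (opB _ _ _ _)) !fmult_trigpoly trigpolyB.
rewrite !(fcoef_trigpoly_inj hab); try exact: TN_inj.
rewrite -(sEWI_trigpoly 0) cexp_i -(mul_phi_1 _ tau0) !mulrN (mulrC tau).
set e := ei _; have E : e * ei (- (w j * tau)) = 1 by exact: eiNK.
rewrite -[X in _ = X - _]mul1r -E; ring.
Qed.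

Lemma fcoef_sEWI2 n (j : 'I_N) :
  ei (w j * tau * n.+2%:R) * fcoef (sEWI n.+2) (TN j) =
  ei (w j * tau * n%:R) * fcoef (sEWI n) (TN j) -
  2 * 'i%C * (int_cos (w j) tau)%:C *
  (ei (w j * tau * n.+1%:R) * fcoef (opB V beta sigma (sEWI n.+1)) (TN j)).
Proof.
rewrite sEWI_S2 [in fmult _ _ _ _ (sEWI n)](sEWI_trigpoly n) (PN_trigpoly _ _ _ (opB _ _ _ _)).
rewrite !fmult_trigpoly trigpolyB (fcoef_trigpoly_inj hab); last exact: TN_inj.
rewrite !cexp_i -(mul_phi_s _ tau0) rmorphM /=.
have e0 : ei (w j * tau * n.+2%:R) * ei (2 * tau * - w j) = ei (w j * tau * n%:R).
  by rewrite -eiD -[n.+2%:R]natr1 -[n.+1%:R]natr1; congr ei; ring.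
have e1 : ei (w j * tau * n.+2%:R) * ei (tau * - w j) = ei (w j * tau * n.+1%:R).
  by rewrite -eiD -[n.+2%:R]natr1; congr ei; ring.
rewrite -e0 -e1; ring.
Qed.

End Scheme.

(** Gronwall's inequality, where the recursive bound is only available as long
    as the previous terms are at most [Y]. *)
Lemma discrete_gronwall (R : realFieldType) (y : nat -> R) (A q Y : R) n0 :
  0 <= A -> 0 <= q -> A * (1 + q) ^+ n0 <= Y ->
  (forall n, (n <= n0)%N -> (forall k, (k < n)%N -> y k <= Y) ->
     y n <= A + q * \sum_(k < n) y k) ->
  forall n, (n <= n0)%N -> y n <= A * (1 + q) ^+ n.
Proof.
move=> A0 q0 AY H; elim/ltn_ind => n IH n_n0.
have q1 : 1 <= 1 + q by rewrite lerDl.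
apply: le_trans (H n n_n0 _) _.
  move=> k kn; apply: le_trans (IH k kn (leq_trans (ltnW kn) n_n0)) _.
  apply: le_trans AY; apply: ler_wpM2l => //; apply: ler_weXn2l => //.
  exact: leq_trans (ltnW kn) n_n0.
apply: le_trans (_ : A + q * \sum_(k < n) A * (1 + q) ^+ k <= _).
  rewrite lerD2l; apply: ler_wpM2l => //; apply: ler_sum => k _.
  exact: IH (ltn_ord k) (leq_trans (ltnW (ltn_ord k)) n_n0).
rewrite -mulr_sumr mulrCA -{1}[A]mulr1 -mulrDr; apply: ler_wpM2l => //.
have := subrX1 (1 + q) n; rewrite (addrC 1 q) addrK => <-.
by rewrite addrCA subrr addr0.
Qed.

Section FourierBounds.
Context (R : realType) (a b : R).
Hypothesis hab : a < b.
Local Notation C := R[i].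
Local Notation normc := (@Normc.normc R).

Lemma L2_normc u : L2 a b u -> L2 a b (fun x => (normc (u x))%:C).
Proof.
move=> [mr mi iu]; split.
- rewrite (_ : (fun x => _) = (fun x => Num.sqrt (complex.Re (u x) ^+ 2 + complex.Im (u x) ^+ 2))); last first.
    by apply/funext => x; rewrite -normc_sqr sqrtr_sqr ger0_norm// normc_ge0.
  apply: (measurableT_comp (continuous_measurable_fun (@sqrt_continuous R))).
  by apply: measurable_funD; apply: measurable_funX.
- exact: measurable_cst.
- rewrite (_ : (fun x => _) = (fun x => (normc (u x) ^+ 2)%:E))//.
  by apply/funext => x; rewrite normc_real ger0_norm// normc_ge0.
Qed.

Lemma coef_le_ell n (c : 'I_n -> C) j : normc (c j) <= (Num.sqrt (b - a))^-1 * ell a b c.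
Proof.
have ba : 0 < b - a by rewrite subr_gt0.
have s0 : 0 < Num.sqrt (b - a) by rewrite sqrtr_gt0.
rewrite mulrC ler_pdivlMr// -(@ler_pXn2r _ 2) ?nnegrE ?mulr_ge0 ?normc_ge0 ?ell_ge0 ?sqrtr_ge0//.
rewrite exprMn sqr_sqrtr ?(ltW ba)// ell_sqr// [leLHS]mulrC ler_pM2l//.
by rewrite (bigD1 j)//= lerDl sumr_ge0// => i _; rewrite sqr_ge0.
Qed.

Lemma freq_TN (M : nat) (j : 'I_M.*2) : (0 < M)%N -> (b - a) * `|freq a b (TN j)| <= 2 * pi * M%:R.
Proof.
move=> M0; have ba : 0 < b - a by rewrite subr_gt0.
rewrite /Defs.freq normrM normfV (gtr0_norm ba) mulrC divfK ?gt_eqF//.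
rewrite !normrM (@ger0_norm _ 2)// (@ger0_norm _ pi) ?pi_ge0//.
apply: ler_wpM2l; first by rewrite mulr_ge0 ?pi_ge0.
rewrite -intr_norm -[M%:R]/((M%:Z)%:~R) ler_int /TN doubleK.
by have := ltn_ord j; lia.
Qed.

Lemma ccontinuous_lip (z : R -> C) L : (forall s t, normc (z t - z s) <= L * `|t - s|) ->
  ccontinuous z.
Proof.
move=> H.
have K (f : R -> R) : (forall s t, `|f t - f s| <= L * `|t - s|) -> continuous f.
  move=> Hf x; apply/cvgrPdist_le => e e0; near=> t.
  apply: le_trans (Hf t x) _; apply: le_trans (_ : (`|L| + 1) * `|x - t| <= _).
    by apply: ler_wpM2r => //; have := ler_norm L; lra.
  have L0 : 0 < `|L| + 1 by rewrite ltr_wpDl.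
  rewrite mulrC -ler_pdivlMr//; near: t.
  by apply/nbhs_ballP; exists (e / (`|L| + 1)) => /= [|t]; [exact: divr_gt0|exact: ltW].
split; apply: K => s t; apply: le_trans (H s t).
  by rewrite -reB; exact: re_le_normc.
by rewrite -imB; exact: im_le_normc.
Unshelve. all: by end_near.
Qed.

End FourierBounds.


(** * Error of the Fourier coefficients *)

Ltac nonneg := repeat first [ by [] | by apply: ltW | exact: sqr_ge0 | exact: expR_ge0
  | apply: addr_ge0 | apply: mulr_ge0 | apply: exprn_ge0 | apply: divr_ge0 ].

Section CoefficientError.
Context (R : realType) (a b : R).
Hypothesis hab : a < b.
Local Notation D := (`]a, b[%classic : set R).
Local Notation C := R[i].
Local Notation re := (@complex.Re R).
Local Notation im := (@complex.Im R).
Local Notation normL2 := (normL2 a b).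
Local Notation normc := (@Normc.normc R).
Local Notation fcoef := (fcoef a b).
Local Notation freq := (freq a b).
Local Notation ell := (ell a b).
Variables (V Vb : R -> R) (beta sigma MV T K : R) (psi0 : R -> C) (Psi : R -> R -> C).
Hypothesis hsigma : 1 / 2 <= sigma.
Hypothesis mVb : measurable_fun D Vb.
Hypothesis VbM : forall x, D x -> `|Vb x| <= MV.
Hypothesis hVb : forall v, L2 a b v ->
    (exists2 r, 1 <= r & forall x, D x -> normc (v x) <= r) ->
    [/\ L2 a b (opB V beta sigma v),
        L2 a b (opB Vb beta sigma v) &
        ae_same a b (opB V beta sigma v) (opB Vb beta sigma v)].
Hypothesis T_gt0 : 0 < T.
Hypothesis K_ge1 : 1 <= K.
Local Notation B := (opB Vb beta sigma).
Hypothesis traj : trajectory a b T (fun t => B (Psi t)) Psi K.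
Hypothesis psi0E : forall l, fcoef psi0 l = fcoef (Psi 0) l.

Definition lip_const := lipB beta sigma MV (K + 1) * (2 * (K + 1) + 1).
(** Bounds both the first and the mixed second differences in time of the
    nonlinear term along the solution. *)
Definition time_const := lip_const * K * Num.sqrt (b - a) +
  lipB beta sigma MV (K + 1) * (4 * K ^+ 2 * Num.sqrt (b - a) + K).
Definition err_const :=
  (17 * time_const * T + 9 * time_const + 2 * T * lip_const * K) *
  expR (2 * lip_const * T).
(** For smaller meshes the error stays so small that the numerical solution is
    bounded by [K + 1]. *)
Definition mesh_bound := (1 + 2 * err_const * Num.sqrt (b - a))^-1.

Let r1 : 1 <= K + 1. Proof. by rewrite lerDr; apply: le_trans K_ge1. Qed.

Let K0 : 0 <= K. Proof. by apply: le_trans K_ge1. Qed.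

Let LB0 : 0 <= lipB beta sigma MV (K + 1).
Proof. exact: (lipB_ge0 beta VbM hsigma hab r1). Qed.

Let L0 : 0 <= lip_const.
Proof. by rewrite /lip_const mulr_ge0// addr_ge0// mulr_ge0// addr_ge0. Qed.

Let s0 : 0 <= Num.sqrt (b - a). Proof. exact: sqrtr_ge0. Qed.

Lemma time_const_ge0 : 0 <= time_const.
Proof.
by rewrite /time_const; nonneg.
Qed.

Lemma err_const_ge0 : 0 <= err_const.
Proof.
have := time_const_ge0 => t0; have T0 := ltW T_gt0.
by rewrite /err_const; nonneg.
Qed.

Lemma mesh_bound_gt0 : 0 < mesh_bound.
Proof.
have := err_const_ge0 => e0.
by rewrite invr_gt0 ltr_wpDr//; nonneg.
Qed.

Let PsiK t x : 0 <= t <= T -> D x -> normc (Psi t x) <= K + 1.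
Proof.
move=> tT; rewrite inD => Dx; apply: le_trans (tr_sup traj tT Dx) _.
by rewrite lerDl.
Qed.

Let L2Psi t : 0 <= t <= T -> L2 a b (Psi t).
Proof. exact: (tr_L2 traj). Qed.

Let L2nl t : 0 <= t <= T -> L2 a b (B (Psi t)).
Proof.
move=> tT; apply: (L2_opB beta mVb VbM hsigma hab r1 (L2Psi tT)) => x.
exact: PsiK.
Qed.

Lemma nonlinear_lipschitz u v : L2 a b u -> L2 a b v ->
  (forall x, D x -> normc (u x) <= K + 1) -> (forall x, D x -> normc (v x) <= K + 1) ->
  normL2 (fun x => B u x - B v x) <= lip_const * normL2 (fun x => u x - v x).
Proof.
move=> hu hv uK vK.
have hB w : L2 a b w -> (forall x, D x -> normc (w x) <= K + 1) -> L2 a b (B w).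
  by move=> hw wK; exact: (L2_opB beta mVb VbM hsigma hab r1 hw wK).
have -> : lip_const * normL2 (fun x => u x - v x) =
    normL2 (fun x => lip_const%:C * (u x - v x)).
  by rewrite normL2Z ?normc_real ?ger0_norm//; exact: L2B.
apply: normL2_le; [by apply: L2B; exact: hB|by apply: L2Z; exact: L2B|].
move=> x Dx; rewrite Normc.normcM normc_real ger0_norm//.
exact: (lip_opB beta VbM hsigma Dx r1 (uK x Dx) (vK x Dx)).
Qed.

Lemma nonlinear_time_lip s t : 0 <= s -> s <= t -> t <= T ->
  normL2 (fun x => B (Psi t) x - B (Psi s) x) <= time_const * (t - s).
Proof.
move=> s_0 st tT.
have sT' : 0 <= s <= T by rewrite s_0 (le_trans st).
have tT' : 0 <= t <= T by rewrite tT (le_trans s_0).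
apply: le_trans (nonlinear_lipschitz (L2Psi tT') (L2Psi sT') _ _) _.
- by move=> x; exact: PsiK.
- by move=> x; exact: PsiK.
apply: le_trans (_ : lip_const * (K * (t - s) * Num.sqrt (b - a)) <= _).
  apply: ler_wpM2l => //; apply: normL2_le_cst => //; first exact: (L2B (L2Psi tT') (L2Psi sT')).
  move=> x; rewrite inD => Dx; apply: le_trans (tr_lip traj sT' tT' Dx) _.
  by rewrite ger0_norm// subr_ge0.
have ts : 0 <= t - s by rewrite subr_ge0.
rewrite /time_const [leRHS]mulrDl.
rewrite (_ : lip_const * _ = lip_const * K * Num.sqrt (b - a) * (t - s)); last by ring.
by rewrite lerDl; nonneg.
Qed.

Lemma nonlinear_time_second t s r : 0 <= t -> 0 <= s -> 0 <= r -> t + s + r <= T ->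
  normL2 (fun x => B (Psi (t + s + r)) x - B (Psi (t + s)) x - B (Psi (t + r)) x
    + B (Psi t) x) <= time_const * s * r.
Proof.
move=> t_0 s_0 r_0 T1.
have b1 : 0 <= t + s + r <= T by apply/andP; split; lra.
have b2 : 0 <= t + s <= T by apply/andP; split; lra.
have b3 : 0 <= t + r <= T by apply/andP; split; lra.
have b4 : 0 <= t <= T by apply/andP; split; lra.
have L4 (f : R -> R -> C) : (forall t, 0 <= t <= T -> L2 a b (f t)) ->
    L2 a b (fun x => f (t + s + r) x - f (t + s) x - f (t + r) x + f t x).
  by move=> H; apply: L2D; [apply: L2B; [apply: L2B|]|]; exact: H.
pose d x := Psi (t + s + r) x - Psi (t + s) x - Psi (t + r) x + Psi t x.
have hd : L2 a b d by exact: L4.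
pose LB := lipB beta sigma MV (K + 1).
pose m := LB * (4 * K ^+ 2 * s * r).
have m0 : 0 <= m by rewrite /m; nonneg.
have hm := L2_cst a b m%:C.
have hn := L2Z LB%:C (L2_normc hd).
apply: le_trans (_ : normL2 (fun x => m%:C + LB%:C * (normc (d x))%:C) <= _).
  apply: normL2_le; [exact: (L4 (fun t => B (Psi t)))|exact: L2D|].
  move=> x Dx; have n0 := normc_ge0 (d x).
  rewrite -rmorphM -rmorphD /= -[X in _ <= X]/(normc (m + LB * normc (d x))%:C).
  rewrite normc_real ger0_norm; last by rewrite addr_ge0// mulr_ge0.
  have Dx' := Dx; rewrite inD in Dx'.
  apply: le_trans (par_opB beta VbM hsigma Dx r1 (PsiK b1 Dx) (PsiK b2 Dx)
    (PsiK b3 Dx) (PsiK b4 Dx)) _.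
  rewrite -/LB /m mulrDr lerD2r; apply: ler_wpM2l => //.
  have l1 := tr_lip traj b2 b1 Dx'; have l2 := tr_lip traj b4 b3 Dx'.
  have l3 := tr_lip traj b3 b1 Dx'; have l4 := tr_lip traj b4 b2 Dx'.
  rewrite (_ : t + s + r - (t + s) = r) in l1; last by ring.
  rewrite (_ : t + r - t = r) in l2; last by ring.
  rewrite (_ : t + s + r - (t + r) = s) in l3; last by ring.
  rewrite (_ : t + s - t = s) in l4; last by ring.
  rewrite !ger0_norm// in l1 l2 l3 l4.
  apply: le_trans (_ : (2 * (K * r)) * (2 * (K * s)) <= _); last by lra.
  by apply: ler_pM; rewrite ?addr_ge0 ?normc_ge0//; lra.
apply: le_trans (normL2D hm hn) _.
rewrite normL2_cst// normL2Z; last exact: L2_normc.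
rewrite normc_real ger0_norm//.
rewrite (@eq_normL2 _ _ _ (fun x => (normc (d x))%:C) d); last first.
  by move=> x _; rewrite normc_real ger0_norm ?normc_ge0.
have := ler_wpM2l (LB0 : 0 <= LB) (tr_second traj t_0 s_0 r_0 T1).
rewrite -/d => H; apply: le_trans (lerD (lexx _) H) _.
rewrite /time_const -/LB /m.
have : 0 <= lip_const * K * Num.sqrt (b - a) * s * r by nonneg.
lra.
Qed.

(** The trajectory lives on [[0, T]]; freezing time outside makes its coefficients
    continuous on the whole line. *)
Let clip t := Num.min (Num.max 0 t) T.

Let clip_in t : 0 <= clip t <= T.
Proof.
by rewrite /clip ge_min lexx orbT le_min le_max lexx (ltW T_gt0).
Qed.

Let clip_id t : 0 <= t <= T -> clip t = t.
Proof. by move=> /andP[t0 tT]; rewrite /clip max_r// min_l. Qed.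

Let clip_lip s t : `|clip t - clip s| <= `|t - s|.
Proof.
have T0 := ltW T_gt0.
have P x : [\/ x <= 0 /\ clip x = 0, (0 <= x /\ x <= T) /\ clip x = x |
    T <= x /\ clip x = T].
  have [x0|x0] := leP x 0.
    by constructor 1; split=> //; rewrite /clip max_l// min_l.
  have [xT|xT] := leP x T.
    by constructor 2; rewrite clip_id ?(ltW x0)//; split=> //; split=> //; exact: ltW.
  by constructor 3; rewrite /clip max_r ?ltW// min_r ?ltW.
have q1 := ler_norm (t - s); have q2 := ler_norm (s - t); rewrite distrC in q2.
have q0 := normr_ge0 (t - s).
by case: (P t) => -[h1 ->]; case: (P s) => -[h2 ->]; rewrite ler_norml; apply/andP; split; lra.
Qed.

(** The nonlinearity is only locally Lipschitz, so that the numerical solution has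
    to be bounded along with the estimate: the coefficients of the exact solution
    are summable, and the sum of the errors of the coefficients is at most [N]
    times the l^2 error, which is of order [h ^ 4] since [tau <= h ^ 2]. *)
Lemma coefficient_error M (tau : R) : (0 < M)%N -> 0 < tau ->
  let h := (b - a) / (M.*2)%:R in h < mesh_bound -> tau <= h ^+ 2 / (2 * pi) ->
  forall n, n%:R * tau <= T ->
  ell (fun j : 'I_M.*2 => fcoef (Psi (n%:R * tau)) (TN j) -
    fcoef (sEWI a b V beta sigma psi0 M.*2 tau n) (TN j)) <=
  err_const * (tau ^+ 2 + h ^+ 4).
Proof.
move=> M0 tau0 h hh0 htau n nT.
have ba : 0 < b - a by rewrite subr_gt0.
have MR : 0 < M%:R :> R by rewrite ltr0n.
have p0 := pi_gt0 R; have p2 := pi_ge2 R.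
have h0 : 0 < h by rewrite /h divr_gt0// ltr0n double_gt0.
have hE : h * M%:R * 2 = b - a.
  by rewrite /h -muln2 natrM; field; rewrite gt_eqF.
pose d n (j : 'I_M.*2) := fcoef (sEWI a b V beta sigma psi0 M.*2 tau n) (TN j).
pose gam n (j : 'I_M.*2) := fcoef (opB V beta sigma (sEWI a b V beta sigma psi0 M.*2 tau n)) (TN j).
pose c t (j : 'I_M.*2) := fcoef (Psi (clip t)) (TN j).
pose g t (j : 'I_M.*2) := fcoef (B (Psi t)) (TN j).
pose w (j : 'I_M.*2) := freq (TN j) ^+ 2.
have taun0 : tau != 0 by rewrite gt_eqF.
have cfl j : tau * w j <= pi / 2.
  have F := freq_TN hab j M0; rewrite -hE in F.
  have F1 : h * `|freq (TN j)| <= pi.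
    rewrite -(@ler_pM2r _ (M%:R * 2)) ?mulr_gt0//; lra.
  have F2 : h ^+ 2 * w j <= pi ^+ 2.
    rewrite /w -[freq _ ^+ 2]real_normK ?num_real// -exprMn lerXn2r ?nnegrE ?(ltW p0)//.
    by rewrite mulr_ge0 ?(ltW h0).
  apply: le_trans (_ : h ^+ 2 / (2 * pi) * w j <= _).
    by apply: ler_wpM2r => //; exact: sqr_ge0.
  rewrite mulrAC ler_pdivrMr ?mulr_gt0//.
  by apply: le_trans F2 _; rewrite expr2; lra.
have c_lip s t j : normc (c t j - c s j) <=
    (Num.sqrt (b - a))^-1 * (K * Num.sqrt (b - a)) * `|t - s|.
  apply: le_trans (coef_le_ell hab (fun j => c t j - c s j) j) _.
  rewrite -mulrA; apply: ler_wpM2l; first by rewrite invr_ge0.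
  have h1 := L2Psi (clip_in t); have h2 := L2Psi (clip_in s).
  rewrite (@eq_ell _ _ _ _ _ (fun j : 'I_M.*2 => fcoef (fun x => Psi (clip t) x - Psi (clip s) x) (TN j))); last first.
    by move=> i; rewrite fcoefB.
  apply: le_trans (ell_fcoef hab _ (L2B h1 h2)) _.
  rewrite mulrAC; apply: normL2_le_cst => //; first exact: L2B.
  move=> x; rewrite inD => Dx.
  apply: le_trans (tr_lip traj (clip_in s) (clip_in t) Dx) _.
  by apply: ler_wpM2l.
have c_cont j : ccontinuous (c^~ j) by apply: ccontinuous_lip => s t; exact: c_lip.
have reR (r : R) (z : C) : re (r%:C * z) = r * re z by rewrite reM /= mul0r subr0.
have imR (r : R) (z : C) : im (r%:C * z) = r * im z by rewrite imM /= mul0r addr0.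
have c_ode t j : 0 < t < T ->
    cderive (c^~ j) t (- ('i%C * ((w j)%:C * c t j + g t j))).
  move=> tT; have [d0 d00 Hd] := interior_ball tT.
  have tT' : 0 <= t <= T by case/andP: tT => ? ?; rewrite !ltW.
  have [D1 D2] := tr_ode traj (TN j) tT.
  split.
    rewrite reN re_iM opprK imD imR /c clip_id//.
    by apply: (is_derive_local D1 d00) => z /Hd zT; rewrite clip_id.
  rewrite imN im_iM reD reR opprD /c clip_id//.
  by apply: (is_derive_local D2 d00) => z /Hd zT; rewrite clip_id.
have g_lip s t : 0 <= s -> s <= t -> t <= T ->
    ell (fun j => g t j - g s j) <= time_const * (t - s).
  move=> s_0 st tT.
  have sT' : 0 <= s <= T by rewrite s_0 (le_trans st).
  have tT' : 0 <= t <= T by rewrite tT (le_trans s_0).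
  apply: le_trans (nonlinear_time_lip s_0 st tT).
  apply: le_trans (ell_fcoef hab M.*2 (L2B (L2nl tT') (L2nl sT'))).
  rewrite (@eq_ell _ _ _ _ _ (fun j : 'I_M.*2 => fcoef (fun x => B (Psi t) x - B (Psi s) x) (TN j)))//.
  by move=> i; rewrite fcoefB//; exact: L2nl.
have g_second t s r : 0 <= t -> 0 <= s -> 0 <= r -> t + s + r <= T ->
    ell (fun j => g (t + s + r) j - g (t + s) j - g (t + r) j + g t j) <=
    time_const * s * r.
  move=> t_0 s_0 r_0 T1.
  have b1 : 0 <= t + s + r <= T by apply/andP; split; lra.
  have b2 : 0 <= t + s <= T by apply/andP; split; lra.
  have b3 : 0 <= t + r <= T by apply/andP; split; lra.
  have b4 : 0 <= t <= T by apply/andP; split; lra.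
  have B12 := L2B (L2nl b1) (L2nl b2); have B123 := L2B B12 (L2nl b3).
  apply: le_trans (nonlinear_time_second t_0 s_0 r_0 T1).
  apply: le_trans (ell_fcoef hab M.*2 (L2D B123 (L2nl b4))).
  rewrite (@eq_ell _ _ _ _ _ (fun j : 'I_M.*2 => fcoef (fun x => B (Psi (t + s + r)) x -
     B (Psi (t + s)) x - B (Psi (t + r)) x + B (Psi t) x) (TN j)))// => i.
  rewrite (fcoefD _ B123 (L2nl b4)) (fcoefB _ B12 (L2nl b3)).
  by rewrite (fcoefB _ (L2nl b1) (L2nl b2)).
have d0E j : d 0 j = c 0 j.
  by rewrite /d /c clip_id ?lexx ?ltW//= fcoef_PN// psi0E.
have w_ge0 j : 0 <= w j by exact: sqr_ge0.
have d1E j : ei (w j * tau) * d 1%N j = d 0 j - 'i%C * int_ei (w j) tau * gam 0 j.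
  exact: (fcoef_sEWI1 hab V beta sigma psi0 taun0).
have d2E m j : ei (w j * tau * m.+2%:R) * d m.+2 j = ei (w j * tau * m%:R) * d m j -
    2 * 'i%C * (int_cos (w j) tau)%:C * (ei (w j * tau * m.+1%:R) * gam m.+1 j).
  exact: (fcoef_sEWI2 hab V beta sigma psi0 taun0).
have REC := @error_recursion R a b hab M.*2 w tau T time_const c g w_ge0 tau0 cfl
  time_const_ge0 c_cont c_ode g_lip g_second d gam d0E d1E d2E.
pose y k := ell (fun j => c (k%:R * tau) j - d k j).
pose Y := h / Num.sqrt (b - a).
pose A := err_const / expR (2 * lip_const * T) * (tau ^+ 2 + h ^+ 4).
pose q := 2 * tau * lip_const.
have sp : 0 < Num.sqrt (b - a) by rewrite sqrtr_gt0.
have e0 := err_const_ge0.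
have q0 : 0 <= q by rewrite /q; nonneg.
have th0 : 0 <= tau ^+ 2 + h ^+ 4 by rewrite addr_ge0// exprn_ge0// ltW.
have A0 : 0 <= A by rewrite /A mulr_ge0// divr_ge0// expR_ge0.
have AE : A * (1 + q) ^+ n <= err_const * (tau ^+ 2 + h ^+ 4).
  have E1 : (1 + q) ^+ n <= expR (2 * lip_const * T).
    apply: le_trans (_ : expR q ^+ n <= _).
      by apply: lerXn2r; rewrite ?nnegrE ?expR_ge0 ?addr_ge0// expR_ge1Dx.
    rewrite -expRM_natl ler_expR -mulr_natl /q.
    by have := ler_wpM2l L0 nT; lra.
  have X0 := expR_gt0 (2 * lip_const * T).
  rewrite /A; move: (expR (2 * lip_const * T)) X0 E1 => X X0 E1.
  move: (err_const) e0 => e e0.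
  rewrite mulrAC; apply: ler_wpM2r => //; rewrite -mulrA -[leRHS]mulr1.
  by apply: ler_wpM2l => //; rewrite mulrC ler_pdivrMr// mul1r.
have AY : A * (1 + q) ^+ n <= Y.
  apply: le_trans AE _; rewrite /Y ler_pdivlMr//.
  have h1 : h <= 1.
    apply: le_trans (ltW hh0) _; rewrite /mesh_bound invf_le1 ?lerDl; first by nonneg.
    by rewrite ltr_wpDr//; nonneg.
  have tauh : tau <= h ^+ 2.
    apply: le_trans htau _; rewrite ler_pdivrMr ?mulr_gt0//.
    by rewrite -[leLHS]mulr1; apply: ler_wpM2l; [exact: sqr_ge0|lra].
  have tau2 : tau ^+ 2 <= h ^+ 4.
    by rewrite (exprM h 2 2) lerXn2r ?nnegrE ?sqr_ge0// ltW.
  have h3 : h ^+ 3 <= h.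
    by rewrite -[leRHS]expr1; apply: ler_wiXn2l => //; exact: ltW.
  have H : 2 * err_const * Num.sqrt (b - a) * h <= 1.
    have P : 0 < 1 + 2 * err_const * Num.sqrt (b - a) by rewrite ltr_wpDr//; nonneg.
    have := ltW hh0; rewrite /mesh_bound -[_^-1]mul1r ler_pdivlMr//; lra.
  have Q : 0 <= 2 * err_const * Num.sqrt (b - a) by nonneg.
  apply: le_trans (_ : err_const * (2 * h ^+ 4) * Num.sqrt (b - a) <= _).
    by apply: ler_wpM2r => //; apply: ler_wpM2l => //; lra.
  rewrite (_ : _ * _ = 2 * err_const * Num.sqrt (b - a) * h ^+ 3 * h); last by ring.
  rewrite -[leRHS]mul1r; apply: ler_wpM2r; first exact: ltW.
  by apply: le_trans H; apply: ler_wpM2l.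
suff S m : (m <= n)%N -> (forall k, (k < m)%N -> y k <= Y) ->
    y m <= A + q * \sum_(k < m) y k.
  have := discrete_gronwall A0 q0 AY S (leqnn n) => P.
  apply: le_trans AE; move: P; rewrite /y /c clip_id//.
  by rewrite nT mulr_ge0// ltW.
move=> mn yY.
have kT k : (k <= n)%N -> 0 <= k%:R * tau <= T.
  move=> kn; rewrite mulr_ge0 ?(ltW tau0)//=; apply: le_trans nT.
  by rewrite ler_pM2r// ler_nat.
have mT : m%:R * tau <= T by case/andP: (kT m mn).
have eta_bound k : (k < m)%N ->
    ell (fun j => g (k%:R * tau) j - gam k j) <= lip_const * (K * h ^+ 4 + y k).
  move=> km; have kn : (k <= n)%N by exact: leq_trans (ltnW km) mn.
  have kT' := kT k kn; set t := k%:R * tau in kT' *.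
  pose num := sEWI a b V beta sigma psi0 M.*2 tau k.
  have numE : num = trigpoly a b (@TN M.*2) (d k) by exact: sEWI_trigpoly.
  have hnum : L2 a b num by rewrite numE; exact: L2_trigpoly.
  have cE j : c t j = fcoef (Psi t) (TN j) by rewrite /c clip_id.
  have numK x : D x -> normc (num x) <= K + 1.
    move=> _; rewrite numE /trigpoly; apply: le_trans (normc_sum _ _ _) _.
    apply: le_trans (_ : \sum_(j < M.*2) (normc (c t j) + normc (c t j - d k j)) <= _).
      apply: ler_sum => j _; rewrite Normc.normcM normc_fmode mulr1.
      have := normcB (c t j) (c t j - d k j).
      by rewrite opprB addrC subrK.
    rewrite big_split/=; apply: lerD.
      apply: le_trans (tr_sum traj M.*2 kT'); apply: ler_sum => j _.
      by rewrite -cE.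
    apply: le_trans (_ : \sum_(j < M.*2) (Num.sqrt (b - a))^-1 * Y <= _).
      apply: ler_sum => j _; apply: le_trans (coef_le_ell hab (fun j => c t j - d k j) j) _.
      by apply: ler_wpM2l; [rewrite invr_ge0|exact: yY].
    rewrite sumr_const card_ord -[leLHS]mulr_natl /Y.
    have : Num.sqrt (b - a) * Num.sqrt (b - a) = b - a by rewrite -expr2 sqr_sqrtr// ltW.
    set sb := Num.sqrt _ in sp * => sbE.
    rewrite (_ : M.*2%:R * (sb^-1 * (h / sb)) = (h * M%:R * 2) / (sb * sb)); last first.
      by rewrite -muln2 natrM; field; rewrite gt_eqF.
    by rewrite sbE hE divff// gt_eqF.
  have [h1 h2 h3] := hVb hnum (ex_intro2 _ _ (K + 1) r1 numK).
  have PsiKt x : D x -> normc (Psi t x) <= K + 1 by exact: PsiK.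
  rewrite (@eq_ell _ _ _ _ _ (fun j : 'I_M.*2 =>
      fcoef (fun x => B (Psi t) x - B num x) (TN j))); last first.
    move=> j; rewrite (fcoefB _ (L2nl kT') h2); congr (_ - _).
    exact: (fcoef_ae _ h1 h2 h3).
  apply: le_trans (ell_fcoef hab _ (L2B (L2nl kT') h2)) _.
  apply: le_trans (nonlinear_lipschitz (L2Psi kT') hnum PsiKt numK) _.
  apply: ler_wpM2l => //.
  have hP := L2_PN a b M.*2 (Psi t).
  rewrite (_ : (fun x => Psi t x - num x) =
    (fun x => (Psi t x - PN a b M.*2 (Psi t) x) + (PN a b M.*2 (Psi t) x - num x))); last first.
    by apply/funext => x; rewrite addrA subrK.
  apply: le_trans (normL2D (L2B (L2Psi kT') hP) (L2B hP hnum)) _.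
  apply: lerD.
    apply: le_trans (tr_proj traj kT' M0) _; rewrite mulrC; apply: ler_wpM2l => //.
    rewrite lerXn2r ?nnegrE ?(ltW h0)//; last first.
      rewrite ler_pdivrMr ?mulr_gt0// -hE.
      have : h * M%:R * 1 <= h * M%:R * pi.
        by apply: ler_wpM2l; [rewrite mulr_ge0// ltW|lra].
      lra.
    by rewrite divr_ge0 ?mulr_ge0// ltW.
  rewrite /y /ell (_ : (fun x => PN a b M.*2 (Psi t) x - num x) =
     trigpoly a b (@TN M.*2) (fun j => c t j - d k j))//.
  have E := trigpolyB a b (fun j => c t j) (d k) 1.
  rewrite (_ : (fun j => c t j - d k j) = (fun j => c t j - 1 * d k j)); last first.
    by apply/funext => j; rewrite mul1r.
  rewrite -E; apply/funext => x; rewrite mul1r numE PN_trigpoly.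
  by congr (trigpoly _ _ _ _ _ - _); apply/funext => j; rewrite cE.
apply: le_trans (REC m mT) _.
have t2 : 0 <= 2 * tau by rewrite mulr_ge0// ltW.
apply: le_trans (_ : (17 * time_const * T + 9 * time_const) * tau * tau +
   2 * tau * \sum_(k < m) lip_const * (K * h ^+ 4 + y k) <= _).
  by rewrite lerD2l; apply: ler_wpM2l => //; apply: ler_sum => k _; exact: eta_bound.
rewrite -mulr_sumr big_split/= sumr_const card_ord -[X in _ * (_ * (X + _))]mulr_natl.
have -> : A = (17 * time_const * T + 9 * time_const + 2 * T * lip_const * K) * (tau ^+ 2 + h ^+ 4).
  by rewrite /A /err_const mulfK// gt_eqF// expR_gt0.
have h4 : 0 <= h ^+ 4 by rewrite exprn_ge0// ltW.
have P1 : 0 <= (17 * time_const * T + 9 * time_const) * h ^+ 4.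
  by have := time_const_ge0 => t0; nonneg.
have P2 : 0 <= 2 * T * lip_const * K * tau ^+ 2.
  by nonneg.
have P3 : (m%:R * tau) * (2 * lip_const * K * h ^+ 4) <= T * (2 * lip_const * K * h ^+ 4).
  by apply: ler_wpM2r => //; nonneg.
rewrite /q; move: P1 P2 P3; rewrite expr2; lra.
Qed.

End CoefficientError.


(** * The error bounds *)

Section Splitting.
Context (R : realType).
Local Notation C := R[i].

Lemma powR_3_2 (tau : R) : 0 <= tau -> tau `^ (3 / 2) = tau * Num.sqrt tau.
Proof.
rewrite le_eqVlt => /predU1P[<-|t0]; first by rewrite powR0 ?mul0r// mulf_neq0.
rewrite (_ : 3 / 2 = 1 + 2^-1 :> R); last by field.
by rewrite powRD ?(gt_eqF t0) ?implybT// powRr1 ?powR12_sqrt// ltW.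
Qed.

(** The step size restriction turns [tau ^ 2 / h], which the loss of one
    derivative produces, into [tau ^ (3 / 2)]. *)
Lemma error_rates (tau h K E y n0 n1 : R) : 0 < tau -> 0 < h -> h < 1 ->
  tau <= h ^+ 2 / (2 * pi) -> 0 <= K -> 0 <= E ->
  y <= E * (tau ^+ 2 + h ^+ 4) ->
  n0 <= h ^+ 4 * K + y -> n1 <= h ^+ 3 * K + pi / h * y ->
  n0 <= (2 * K + E + pi * E + 1) * (tau ^+ 2 + h ^+ 4) /\
  n0 + n1 <= (2 * K + E + pi * E + 1) * (tau `^ (3 / 2) + h ^+ 3).
Proof.
move=> t0 hp h1 htau K0 E0 y_le e1 e2.
have p0 := pi_gt0 R; have p2 := pi_ge2 R.
have pE : 0 <= pi * E by rewrite mulr_ge0// ltW.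
have th : tau <= h ^+ 2.
  apply: le_trans htau _; rewrite ler_pdivrMr ?mulr_gt0//.
  by rewrite -[leLHS]mulr1; apply: ler_wpM2l; [exact: sqr_ge0|lra].
have h4 : h ^+ 4 <= h ^+ 3 by apply: ler_wiXn2l => //; exact: ltW.
have h40 : 0 <= h ^+ 4 by rewrite exprn_ge0// ltW.
set s := Num.sqrt tau.
have s0 : 0 <= s by exact: sqrtr_ge0.
have ss : s * s = tau by rewrite -expr2 sqr_sqrtr// ltW.
have sh : s <= h by rewrite -(@ler_pXn2r _ 2) ?nnegrE ?(ltW hp)// expr2 ss.
have tau2 : tau ^+ 2 = tau * s * s by rewrite -mulrA ss.
have ts0 : 0 <= tau * s by rewrite mulr_ge0// ltW.
have tau2h : tau ^+ 2 <= tau * s * h by rewrite tau2; apply: ler_wpM2l.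
have tau2s : tau ^+ 2 <= tau * s.
  by apply: le_trans tau2h _; rewrite -[leRHS]mulr1; apply: ler_wpM2l => //; exact: ltW.
have Kh : 0 <= K * tau ^+ 2 by rewrite mulr_ge0 ?sqr_ge0.
have B1 : n0 <= (K + E) * (tau ^+ 2 + h ^+ 4) by lra.
have th0 : 0 <= tau ^+ 2 + h ^+ 4 by rewrite addr_ge0 ?sqr_ge0.
split.
  apply: le_trans B1 _; apply: ler_wpM2r => //; lra.
rewrite powR_3_2 -/s; last exact: ltW.
have B2 : pi / h * y <= pi * E * (tau * s + h ^+ 3).
  apply: le_trans (_ : pi / h * (E * (h * (tau * s + h ^+ 3))) <= _); last first.
    by rewrite le_eqVlt; apply/orP; left; apply/eqP; move: (pi : R) => p; field; rewrite gt_eqF.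
  apply: ler_wpM2l; first by rewrite divr_ge0// ltW.
  apply: le_trans y_le _; apply: ler_wpM2l => //.
  by rewrite mulrDr -exprS lerD2r mulrC.
have B3 : (K + E) * (tau ^+ 2 + h ^+ 4) <= (K + E) * (tau * s + h ^+ 3).
  by apply: ler_wpM2l; [exact: addr_ge0|exact: lerD].
have Kts : 0 <= K * (tau * s) by rewrite mulr_ge0.
have h30 : 0 <= h ^+ 3 by apply: le_trans h4.
lra.
Qed.

Variables (a b : R).
Hypothesis hab : a < b.
Local Notation normL2 := (normL2 a b).
Local Notation wD := (wD a b).

(** Splitting the error at the projection of the exact solution; differentiating
    a trigonometric polynomial costs at most the largest frequency. *)
Lemma error_split (u : R -> C) (M : nat) (d : 'I_M.*2 -> C) (K h : R) :
  (0 < M)%N -> h = (b - a) / (M.*2)%:R -> 0 <= K ->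
  Hper a b 4 u -> normL2 (iter 4 wD u) <= K ->
  let err x := u x - trigpoly a b (@TN M.*2) d x in
  let y := ell a b (fun j => fcoef a b u (TN j) - d j) in
  normL2 err <= h ^+ 4 * K + y /\
  normL2 (wD err) <= h ^+ 3 * K + pi / h * y.
Proof.
move=> M0 hE K0 hu uK err y.
have ba : 0 < b - a by rewrite subr_gt0.
have MR : 0 < M%:R :> R by rewrite ltr0n.
have p0 := pi_gt0 R; have p2 := pi_ge2 R.
have h0 : 0 < h by rewrite hE divr_gt0// ltr0n double_gt0.
have hM : h * M%:R * 2 = b - a.
  by rewrite hE -muln2 natrM; field; rewrite gt_eqF.
pose e (j : 'I_M.*2) := fcoef a b u (TN j) - d j.
have hL : L2 a b u by case: hu => su _; exact: sobolev_L2 su.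
have hq : 0 <= (b - a) / (2 * pi * M%:R) by rewrite divr_ge0 ?mulr_ge0// ltW.
have q : (b - a) / (2 * pi * M%:R) <= h.
  rewrite ler_pdivrMr ?mulr_gt0// -hM.
  have : h * M%:R * 1 <= h * M%:R * pi.
    by apply: ler_wpM2l; [rewrite mulr_ge0// ltW|lra].
  lra.
have Q k (X : R) : X <= K -> ((b - a) / (2 * pi * M%:R)) ^+ k * X <= h ^+ k * K.
  move=> XK; apply: le_trans (_ : ((b - a) / (2 * pi * M%:R)) ^+ k * K <= _).
    by apply: ler_wpM2l => //; exact: exprn_ge0.
  by apply: ler_wpM2r => //; rewrite lerXn2r ?nnegrE ?(ltW h0).
have errE : err = (fun x => 1 * (u x - PN a b M.*2 u x) + 1 * trigpoly a b (@TN M.*2) e x).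
  apply/funext => x; have := congr1 (@^~ x) (trigpolyB a b (fun j => fcoef a b u (TN j)) d 1).
  rewrite -PN_trigpoly /= !mul1r (_ : trigpoly _ _ _ (fun j => _ - 1 * d j) x = trigpoly a b (@TN M.*2) e x); last first.
    by congr trigpoly; apply/funext => j; rewrite mul1r.
  by move=> <-; rewrite addrA subrK.
have hP := L2B hL (L2_PN a b M.*2 u).
have ht := L2_trigpoly a b (@TN M.*2) e.
split.
  rewrite errE (_ : (fun x => _) = (fun x => (u x - PN a b M.*2 u x) + trigpoly a b (@TN M.*2) e x)); last first.
    by apply/funext => x; rewrite !mul1r.
  apply: le_trans (normL2D hP ht) _; apply: lerD => //.
  by apply: le_trans (proj_error_per hab hu (leqnn 4) isT M0) _; exact: Q.
have wP : weak_deriv a b (fun x => u x - PN a b M.*2 u x)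
    (wD (fun x => u x - PN a b M.*2 u x)).
  have [du _] := sobolevS hab (hu.1 : sobolev a b 4 u).
  have := weak_deriv_lin 1 (-1) du (weak_deriv_trigpoly hab (@TN M.*2) (fun j => fcoef a b u (TN j))).
  rewrite (_ : (fun x => 1 * u x + _) = (fun x => u x - PN a b M.*2 u x)); last first.
    by apply/funext => x; rewrite mul1r mulN1r PN_trigpoly.
  by move=> /(wDP hab)[].
have wt := weak_deriv_trigpoly hab (@TN M.*2) e.
have := weak_deriv_lin 1 1 wP wt; rewrite -errE => wE.
have [[_ hwE _] ae] := wDP hab wE.
have [_ h1 _] := wP; have [_ h2 _] := wt.
rewrite (ae_normL2 hwE (L2D (L2Z 1 h1) (L2Z 1 h2)) ae).
rewrite (_ : (fun x => _) = (fun x => wD (fun x => u x - PN a b M.*2 u x) x +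
   trigpoly a b (@TN M.*2) (fun j => 'i%C * (freq a b (TN j))%:C * e j) x)); last first.
  by apply/funext => x; rewrite !mul1r.
apply: le_trans (normL2D h1 h2) _; apply: lerD.
  by apply: le_trans (wD_PN_error hab hu isT M0) _; exact: Q.
apply: (@ell_le _ _ _ hab) => [|j]; first by rewrite divr_ge0// ltW.
rewrite !Normc.normcM normc_i mul1r normc_real; apply: ler_wpM2r; first exact: normc_ge0.
have := freq_TN hab j M0; rewrite -hM ler_pdivlMr// => F.
rewrite -(@ler_pM2r _ (M%:R * 2)) ?mulr_gt0//; lra.
Qed.

End Splitting.

Theorem theorem4p3 (R : realType) (a b : R) (hab : a < b)
    (V : R -> R) (hV : Hper a b 2 (fun x => (V x)%:C))
    (beta sigma : R) (hsigma : 1 / 2 <= sigma)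
    (psi0 : R -> R[i]) (psi : R -> R -> R[i]) (Tmax : \bar R)
    (hpsi : maximal_solution a b V beta sigma psi0 Tmax psi)
    (T : R) (hT0 : 0 < T) (hT : (T%:E < Tmax)%E)
    (hreg0 : curve_C 0 (Hper a b 4) (normH a b 4) `[0, T] psi)
    (hreg1 : curve_C 1 (sobolev a b 2) (normH a b 2) `[0, T] psi)
    (hreg2 : curve_C 2 (L2 a b) (normL2 a b) `[0, T] psi) :
  exists tau0 h0 C : R, [/\ 0 < tau0, 0 < h0, 0 < C &
    forall (tau : R) (N : nat), (0 < N)%N -> ~~ odd N ->
      let h := (b - a) / N%:R in
      0 < tau < tau0 -> 0 < h < h0 -> tau <= h ^+ 2 / (2 * pi) ->
      forall n : nat, n%:R <= T / tau ->
        let err x := psi (n%:R * tau) x - sEWI a b V beta sigma psi0 N tau n x in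
        normL2 a b err <= C * (tau ^+ 2 + h ^+ 4) /\
        normH a b 1 err <= C * (tau `^ (3 / 2) + h ^+ 3)].
Proof.
have [hsol _] := hpsi.
have [Vb [MV [mVb VbM hVb]]] := potential_rep hab hV.
have [K K1 [traj Kb]] := solution_trajectory hab hsigma hsol hT0 hT hreg0 hreg1 hreg2
  hVb.
have K0 : 0 <= K by apply: le_trans K1.
have hper t : 0 <= t <= T -> Hper a b 4 (psi t).
  by move=> tT; case: hreg0 => -[H _] _; apply: H; rewrite inJ.
have hL t : 0 <= t <= T -> L2 a b (psi t) by move=> /hper[/sobolev_L2].
have Tin : 0 <= (0 : R) <= T by rewrite lexx ltW.
have crep t : 0 <= t <= T -> is_crep a b (psi t) (cont_rep a b (psi t)).
  by move=> /hper[s _]; apply: (crep_ex hab); exact: sobolev_le s.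
have psiE t l : 0 <= t <= T -> fcoef a b (psi t) l = fcoef a b (cont_rep a b (psi t)) l.
  move=> tT; have [_ _ e] := crep t tT.
  by rewrite (fcoef_ae l (crep_L2 (hL t tT) (crep t tT)) (hL t tT) e).
have psi0E l : fcoef a b psi0 l = fcoef a b (cont_rep a b (psi 0)) l.
  by rewrite -psiE//; case: hsol => _ h0 e _; rewrite (fcoef_ae l (hL 0 Tin) h0 e).
have CE := coefficient_error hab hsigma mVb VbM (fun v => hVb beta sigma v hsigma) hT0 K1 traj psi0E.
have := mesh_bound_gt0 hab beta hsigma VbM hT0 K1.
have := err_const_ge0 hab beta hsigma VbM hT0 K1.
move: (err_const _ _ _ _ _ _ _) (mesh_bound _ _ _ _ _ _ _) CE => E h0 CE E0 h00.
exists 1, (Num.min 1 h0), (2 * K + E + pi * E + 1).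
have p0 := pi_gt0 R; have p2 := pi_ge2 R.
have pE : 0 <= pi * E by rewrite mulr_ge0// ltW.
split => //; first by rewrite lt_min ltr01.
  lra.
move=> tau N N0 Neven h /andP[t0 t1] /andP[hp] + htau n nT.
rewrite lt_min => /andP[h1 hh0] err.
have NM : N = (N./2).*2 by rewrite -[LHS]odd_double_half (negbTE Neven).
move: (N./2) NM => M NM; subst N.
have M0 : (0 < M)%N by rewrite -double_gt0.
have nT' : n%:R * tau <= T by rewrite -ler_pdivlMr.
have tT : 0 <= n%:R * tau <= T by rewrite nT' mulr_ge0// ltW.
have y_le := CE M tau M0 t0 hh0 htau n nT'.
have [] := error_split hab (fun j => fcoef a b (sEWI a b V beta sigma psi0 M.*2 tau n) (TN j))
  M0 (erefl h) K0 (hper _ tT) (Kb 4 _ isT tT).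
rewrite -(sEWI_trigpoly hab) -/err.
rewrite (@eq_ell _ _ _ _ _ (fun j : 'I_M.*2 => fcoef a b (cont_rep a b (psi (n%:R * tau))) (TN j) -
    fcoef a b (sEWI a b V beta sigma psi0 M.*2 tau n) (TN j))); last first.
  by move=> j; rewrite psiE.
move: y_le; set y := ell _ _ _ => y_le e1 e2.
have [r0 r1] := error_rates t0 hp h1 htau K0 E0 y_le e1 e2.
by split=> //; exact: le_trans (normH1_le _ _ _) r1.
Qed.
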